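(* Let $q\in(0,1)$ and $c\in[0,+\infty)$, and let $\hat{\mathcal{A}}_c=\hat{\mathcal{O}}(S^2_{qc})\rtimes\mathcal{U}_q(\mathrm{su}_2)$ be the cross product $*$-algebra described in the context. Let $H$ be an invertible self-adjoint operator on a Hilbert space $\mathcal{G}$, and let the representation space be the direct sum $\mathcal{H}=\bigoplus_{n,j=0}^\infty\mathcal{H}_{nj}$ with $\mathcal{H}_{nj}=\mathcal{G}$; for $\eta\in\mathcal{G}$ let $\eta_{nj}$ denote the vector of $\mathcal{H}$ with $\eta$ in the component $\mathcal{H}_{nj}$ and zero elsewhere. For $c\in(0,+\infty)$ and each choice of sign $\pm$, the following formulas give a $*$-representation $(I)_{\pm,H}$ of $\hat{\mathcal{A}}_c$; for $c=0$ there is only the representation $(I)_{+,H}$: \begin{align*} A\eta_{nj}&=\lambda_\pm q^{2n}\eta_{nj},\qquad B\eta_{nj}=c_\pm(n)\eta_{n-1,j},\qquad B^*\eta_{nj}=c_\pm(n+1)\eta_{n+1,j},\\ E\eta_{nj}&=q^{-1/2}\lambda^{-1}\big[q^{-n}\lambda_j(\lambda_\pm^{-2}q^{-2j}c+H^{-4})^{1/2}H\eta_{n,j-1}\\ &\qquad\qquad-q^{-j}(\lambda_\pm^{-2}q^{-2n-2}c+\lambda_\pm^{-1}-q^{2n+2})^{1/2}H\eta_{n+1,j}\big],\\ F\eta_{nj}&=q^{-1/2}\lambda^{-1}\big[q^{-n}\lambda_{j+1}(\lambda_\pm^{-2}q^{-2j-2}c+H^{-4})^{1/2}H\eta_{n,j+1}\\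 &\qquad\qquad-q^{-j}(\lambda_\pm^{-2}q^{-2n}c+\lambda_\pm^{-1}-q^{2n})^{1/2}H\eta_{n-1,j}\big],\\ K\eta_{nj}&=q^{n-j}H\eta_{nj}, \end{align*} where $n,j\in\mathbb{N}_0$.
   Context: Notation: $\mathbb{N}_0=\{0,1,2,\dots\}$, $\lambda:=q-q^{-1}$, $\lambda_n:=(1-q^{2n})^{1/2}$ for $n\in\mathbb{N}_0$, $\lambda_\pm:=\frac12\pm(c+\frac14)^{1/2}$, $c_\pm(n):=(c+\lambda_\pm q^{2n}-(\lambda_\pm q^{2n})^2)^{1/2}$. (The subscripted $\lambda_j$ with $j\in\mathbb{N}_0$ and $\lambda_\pm$ are different quantities.) Vectors $\eta_{nj}$ with a negative index are zero. ''Invertible'' means that $H$ has trivial kernel; functions of $H$ are taken in the functional calculus of self-adjoint operators. In the formulas an operator $T$ on $\mathcal{G}$ applied to $\eta_{nj}$ means $(T\eta)_{nj}$. The operators $E,F,K$ are in general unbounded, and the formulas are understood for those $\eta$ for which the expressions occurring are defined. $\mathcal{U}_q(\mathrm{su}_2)$ is the unital complex $*$-algebra with generators $E,F,K,K^{-1}$, relations $KK^{-1}=K^{-1}K=1$, $KE=qEK$, $FK=qKF$, $EF-FE=\lambda^{-1}(K^2-K^{-2})$, and involution $E^*=F$, $K^*=K$. For $c\in[0,+\infty)$, $\mathcal{O}(S^2_{qc})$ is the unital $*$-algebra with generators $A=A^*$, $B$, $B^*$ and relations $AB=q^{-2}BA$, $AB^*=q^2B^*A$, $B^*B=A-A^2+c$,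 $BB^*=q^2A-q^4A^2+c$. $\hat{\mathcal{O}}(S^2_{qc})$ is its localization at the Ore set $\{A^n:n\in\mathbb{N}_0\}$, i.e. an inverse $A^{-1}$ of $A$ is adjoined. The cross product $*$-algebra $\hat{\mathcal{A}}_c=\hat{\mathcal{O}}(S^2_{qc})\rtimes\mathcal{U}_q(\mathrm{su}_2)$ is the $*$-algebra with generators $A,A^{-1},B,B^*,E,F,K,K^{-1}$, the relations of the two algebras, $AA^{-1}=A^{-1}A=1$, and the cross relations $KA=AK$, $EA=AE+q^{-1/2}B^*K$, $FA=AF-q^{-3/2}BK$, $KB=q^{-1}BK$, $EB=qBE-q^{1/2}(1+q^2)AK+q^{1/2}K$, $FB=qBF$, $KB^*=qB^*K$, $EB^*=q^{-1}B^*E$, $FB^*=q^{-1}B^*F+q^{-1/2}(1+q^2)AK-q^{-1/2}K$.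
   Formalization: For the sign −, the second summands of E and F carry the opposite sign (+q^{-j}(…)^{1/2}H instead of −q^{-j}(…)^{1/2}H): as printed, EA=AE+q^{-1/2}B*K fails since λ_-<0. The formulas for the sign + are unchanged. *)

(* Defs.v *)
(* The field of complex numbers is R[i] with R : realType. *)
From HB Require Import structures.
From mathcomp Require Import all_boot all_order all_algebra sesquilinear.
From mathcomp Require Import complex.
From mathcomp Require Import all_classical all_reals all_analysis.

Set Implicit Arguments.
Unset Strict Implicit.
Unset Printing Implicit Defensive.

Import Order.TTheory GRing.Theory Num.Theory.
Import numFieldNormedType.Exports.

Local Open Scope classical_set_scope.
Local Open Scope ring_scope.
Local Open Scope complex_scope.

(* The inner product is linear in its first argument. *)
HB.mixin Record CompleteNormedModule_isHilbert (R : realType) V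
    of CompleteNormedModule R[i] V := {
  hdot : {dot V for Num.conj};
  hdot_norm : forall x : V, `|x| ^+ 2 = hdot x x }.

#[short(type="hilbertType")]
HB.structure Definition Hilbert (R : realType) :=
  { V of CompleteNormedModule_isHilbert R V & CompleteNormedModule R[i] V }.

Notation "''[' x , y ]" := (hdot x y) : ring_scope.

Definition subspace (K : pzRingType) (V : lmodType K) (D : set V) : Prop :=
  D 0 /\ forall (a : K) x y, D x -> D y -> D (a *: x + y).

Section Operators.
Variables (R : realType) (G : hilbertType R).

(* An operator is a domain with an underlying function; the values of the
   function outside the domain are irrelevant. *)
Record operator := Operator { odom : set G; oval :> G -> G }.

Definition oeq (S T : operator) : Prop :=
  odom S = odom T /\ forall x, odom T x -> S x = T x.

Definition oid : operator := Operator setT id.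
Definition ocomp (S T : operator) : operator :=
  Operator [set x | odom T x /\ odom S (T x)] (S \o T).
Definition oexp (T : operator) (n : nat) : operator := iter n (ocomp T) oid.
Definition oinv (T : operator) : operator :=
  Operator (T @` odom T) (fun y => xget 0 [set x | odom T x /\ T x = y]).

Definition self_adjoint (T : operator) : Prop :=
  [/\ subspace (odom T),
      forall (a : R[i]) x y, odom T x -> odom T y ->
        T (a *: x + y) = a *: T x + T y,
      dense (odom T)
    & forall y z, (forall x, odom T x -> '[T x, y] = '[x, z]) <->
        (odom T y /\ T y = z)].

Definition invertible (T : operator) : Prop :=
  forall x, odom T x -> T x = 0 -> x = 0.

(* The intersection of the domains of all powers T ^ k, k an integer. *)
Definition odom_infty (T : operator) : set G :=
  [set x | forall k, odom (oexp T k) x /\ odom (oexp (oinv T) k) x].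

Record resolution := Resolution {
  rproj :> R -> G -> G;
  rproj_linear : forall t, linear (rproj t);
  rproj_sym : forall t x y, '[rproj t x, y] = '[x, rproj t y];
  rproj_mul : forall s t x, rproj s (rproj t x) = rproj (Num.min s t) x;
  rproj_right : forall t x, rproj s x @[s --> t^'+] --> rproj t x;
  rproj_ninfty : forall x, rproj s x @[s --> -oo] --> (0 : G);
  rproj_pinfty : forall x, rproj s x @[s --> +oo] --> x }.


Definition rdistr (E : resolution) (x : G) (t : R) : R := complex.Re '[E t x, x].

Lemma rproj_norm (E : resolution) t x : '[E t x, x] = `|E t x| ^+ 2.
Proof. by rewrite hdot_norm -[in RHS]rproj_sym rproj_mul minxx. Qed.

Lemma rdistr_sub (E : resolution) s t x : s <= t ->
  '[E t x, x] - '[E s x, x] = `|E t x - E s x| ^+ 2.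
Proof.
move=> st; rewrite hdot_norm !linearBl !linearBr /=.
rewrite -!rproj_sym !rproj_mul !minxx (min_idPl st) (min_idPr st).
by rewrite subrr subr0.
Qed.

Lemma Re_mono (a b : R[i]) : a <= b -> complex.Re a <= complex.Re b.
Proof. by rewrite lecE => /andP[]. Qed.

Lemma rdistr_nd (E : resolution) x : nondecreasing (rdistr E x).
Proof.
move=> s t st; apply: Re_mono; rewrite -subr_ge0 rdistr_sub//.
Qed.

Lemma rdistr_rc (E : resolution) x : right_continuous (rdistr E x).
Proof.
move=> t; apply/cvgrPdist_lt => e e0.
have se : 0 < (Num.sqrt e)%:C :> R[i] by rewrite ltcR sqrtr_gt0.
have /cvgrPdist_lt/(_ _ se) Ex := @rproj_right E t x.
near=> s.
have ts : t <= s by apply: ltW; near: s; exact: nbhs_right_gt.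
have d : complex.Re (`|E s x - E t x| ^+ 2) = rdistr E x s - rdistr E x t.
  by rewrite -rdistr_sub// /rdistr; case: '[_, _] => ? ?; case: '[_, _].
rewrite distrC ger0_norm ?subr_ge0 ?rdistr_nd// -d.
have : `|E s x - E t x| ^+ 2 < (Num.sqrt e)%:C ^+ 2.
  by rewrite ltrXn2r// ?nnegrE ?(ltW se)// distrC; near: s.
rewrite -rmorphXn/= sqr_sqrtr ?ltW// ltcE => /andP[_] /=.
by [].
Unshelve. all: by end_near. Qed.

HB.instance Definition _ (E : resolution) (x : G) :=
  isCumulative.Build R _ R (rdistr E x) (@rdistr_nd E x) (@rdistr_rc E x).

Definition rmeasure (E : resolution) (x : G) :=
  lebesgue_stieltjes_measure (rdistr E x).

(* The domain of the integral of f with respect to E. *)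
Definition rdom (E : resolution) (f : R -> R) : set G :=
  [set x | (\int[rmeasure E x]_t ((f t) ^+ 2)%:E < +oo)%E].

(* The integral of f against the complex measure t |-> '[E t x, y], given by
   polarization of the positive measures rmeasure E x. *)
Definition rform (E : resolution) (f : R -> R) (x y : G) : R[i] :=
  4^-1 * \sum_(k < 4)
    'i ^+ k * (\int[rmeasure E (x + 'i ^+ k *: y)]_t f t)%:C.

(* The operator integral of f (real-valued, Borel measurable) against E. *)
Definition rint (E : resolution) (f : R -> R) : operator :=
  Operator (rdom E f)
    (fun x => xget 0 [set y | forall z, rdom E f z -> '[y, z] = rform E f x z]).

Let step (t : R) (x : G) : G := if 0 <= t then x else 0.

Let step_linear t : linear (step t).
Proof. by move=> a x y; rewrite /step; case: ifP; rewrite ?scaler0 ?addr0. Qed.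

Let step_sym t x y : '[step t x, y] = '[x, step t y].
Proof.
rewrite /step; case: ifP => // _.
by rewrite -(scale0r (0 : G)) linearZl_LR linearZr_LR /= rmorph0 !mul0r.
Qed.

Let step_mul s t x : step s (step t x) = step (Num.min s t) x.
Proof. by rewrite /step le_min; case: leP; case: leP. Qed.

Let step_right t x : step s x @[s --> t^'+] --> step t x.
Proof.
apply: cvg_near_cst; rewrite /step; have [t0|t0] := leP 0 t.
  near=> s; have -> // : 0 <= s.
  by apply: le_trans t0 _; apply: ltW; near: s; exact: nbhs_right_gt.
near=> s; rewrite leNgt; have -> // : s < 0.
by near: s; exact: nbhs_right_lt.
Unshelve. all: by end_near. Qed.

Let step_ninfty x : step s x @[s --> -oo] --> (0 : G).
Proof.
apply: cvg_near_cst; near=> s; rewrite /step leNgt; have -> // : s < 0.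
by near: s; exact: nbhs_ninfty_lt (real0 _).
Unshelve. all: by end_near. Qed.

Let step_pinfty x : step s x @[s --> +oo] --> x.
Proof.
apply: cvg_near_cst; near=> s; rewrite /step; have -> // : 0 <= s.
by near: s; exact: nbhs_pinfty_ge (real0 _).
Unshelve. all: by end_near. Qed.

(* The resolution of the identity of the zero operator, used only as the
   default value of a choice operator. *)
Definition resolution0 : resolution := Resolution step_linear step_sym step_mul
  step_right step_ninfty step_pinfty.

HB.instance Definition _ := gen_eqMixin resolution.
HB.instance Definition _ := gen_choiceMixin resolution.

(* The resolution of the identity E such that T is the integral of t against
   E t; it exists when T is self-adjoint, by the spectral theorem. *)
Definition spectral_resolution (T : operator) : resolution :=
  xget resolution0 [set E | oeq T (rint E id)].

Definition fcalc (T : operator) (f : R -> R) : operator :=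
  rint (spectral_resolution T) f.

End Operators.

Arguments fcalc {R G} T f.

Section DirectSum.
Variables (R : realType) (G HH : hilbertType R) (ket : nat -> nat -> G -> HH).

(* The finite sums of vectors ket n j x with x in D0. *)
Definition finite_sums (D0 : set G) : set HH :=
  [set h | exists (N : nat) (u : nat -> nat -> G),
    (forall n j, D0 (u n j)) /\
    h = \sum_(n < N) \sum_(j < N) ket n j (u n j)].

(* HH is the Hilbert space direct sum of copies of G indexed by nat * nat;
   ket n j is the embedding of the copy with index (n, j). *)
Definition hilbert_sum : Prop :=
  [/\ forall n j, linear (ket n j),
      forall n j x y, '[ket n j x, ket n j y] = '[x, y],
      forall n j m k x y, (n, j) != (m, k) -> '[ket n j x, ket m k y] = 0
    & dense (finite_sums setT)].

(* Vectors with a negative index are zero. *)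
Definition ketz (n j : int) (x : G) : HH :=
  match n, j with
  | Posz n, Posz j => ket n j x
  | _, _ => 0
  end.

End DirectSum.

(* gA' and gK' stand for the inverses of A and K, and gBs for B^*. *)
Inductive generator := gA | gA' | gB | gBs | gE | gF | gK | gK'.

Definition gstar (g : generator) : generator :=
  match g with
  | gB => gBs | gBs => gB | gE => gF | gF => gE
  | gA => gA | gA' => gA' | gK => gK | gK' => gK'
  end.

Section CrossProduct.
Variables (R : realType) (q c : R).

Inductive term :=
  | Gen of generator
  | Cst of R[i]
  | Add of term & term
  | Mul of term & term.

Fixpoint tstar (t : term) : term :=
  match t with
  | Gen g => Gen (gstar g)
  | Cst k => Cst k^*
  | Add t u => Add (tstar t) (tstar u)
  | Mul t u => Mul (tstar u) (tstar t)
  end.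

Declare Scope term_scope.
Local Open Scope term_scope.
Local Notation "k *: t" := (Mul (Cst (k%R)%:C) t) : term_scope.
Local Notation "t + u" := (Add t u) : term_scope.
Local Notation "t - u" := (Add t (Mul (Cst (-1)%R) u)) : term_scope.
Local Notation "t * u" := (Mul t u) : term_scope.
Local Notation "1" := (Cst 1%R) : term_scope.
Local Notation A := (Gen gA).
Local Notation A' := (Gen gA').
Local Notation B := (Gen gB).
Local Notation Bs := (Gen gBs).
Local Notation E := (Gen gE).
Local Notation F := (Gen gF).
Local Notation K := (Gen gK).
Local Notation K' := (Gen gK').
Local Notation sq := (Num.sqrt q).
Local Notation lambda := (q - q^-1)%R.

Inductive cross_rel : term -> term -> Prop :=
  | rel_KK' : cross_rel (K * K') 1
  | rel_K'K : cross_rel (K' * K) 1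
  | rel_KE : cross_rel (K * E) (q *: (E * K))
  | rel_FK : cross_rel (F * K) (q *: (K * F))
  | rel_EF : cross_rel (E * F - F * E) (lambda^-1 *: (K * K - K' * K'))
  | rel_AB : cross_rel (A * B) (q ^- 2 *: (B * A))
  | rel_ABs : cross_rel (A * Bs) (q ^+ 2 *: (Bs * A))
  | rel_BsB : cross_rel (Bs * B) (A - A * A + c *: 1)
  | rel_BBs : cross_rel (B * Bs) (q ^+ 2 *: A - q ^+ 4 *: (A * A) + c *: 1)
  | rel_AA' : cross_rel (A * A') 1
  | rel_A'A : cross_rel (A' * A) 1
  | rel_KA : cross_rel (K * A) (A * K)
  | rel_EA : cross_rel (E * A) (A * E + sq^-1 *: (Bs * K))
  | rel_FA : cross_rel (F * A) (A * F - sq ^- 3 *: (B * K))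
  | rel_KB : cross_rel (K * B) (q^-1 *: (B * K))
  | rel_EB : cross_rel (E * B)
      (q *: (B * E) - (sq * (1 + q ^+ 2)) *: (A * K) + sq *: K)
  | rel_FB : cross_rel (F * B) (q *: (B * F))
  | rel_KBs : cross_rel (K * Bs) (q *: (Bs * K))
  | rel_EBs : cross_rel (E * Bs) (q^-1 *: (Bs * E))
  | rel_FBs : cross_rel (F * Bs)
      (q^-1 *: (Bs * F) + (sq^-1 * (1 + q ^+ 2)) *: (A * K) - sq^-1 *: K).

(* The smallest congruence containing the relations, compatible with the
   involution and making the quotient a unital complex algebra. *)
Inductive teq : term -> term -> Prop :=
  | teq_rel t u of cross_rel t u : teq t u
  | teq_refl t : teq t t
  | teq_sym t u of teq t u : teq u t
  | teq_trans t u v of teq t u & teq u v : teq t v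
  | teq_add t t' u u' of teq t t' & teq u u' : teq (t + u) (t' + u')
  | teq_mul t t' u u' of teq t t' & teq u u' : teq (t * u) (t' * u')
  | teq_star t u of teq t u : teq (tstar t) (tstar u)
  | teq_addA t u v : teq (t + (u + v)) (t + u + v)
  | teq_addC t u : teq (t + u) (u + t)
  | teq_add0 t : teq (Cst 0%R + t) t
  | teq_addN t : teq (t - t) (Cst 0%R)
  | teq_mulA t u v : teq (t * (u * v)) (t * u * v)
  | teq_mul1 t : teq (1 * t) t
  | teq_mulDl t u v : teq ((t + u) * v) (t * v + u * v)
  | teq_mulDr t u v : teq (t * (u + v)) (t * u + t * v)
  | teq_cstC k t : teq (Cst k * t) (t * Cst k)
  | teq_cstD k l : teq (Cst (k + l)%R) (Cst k + Cst l)
  | teq_cstM k l : teq (Cst (k * l)%R) (Cst k * Cst l).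

HB.instance Definition _ := gen_eqMixin term.
HB.instance Definition _ := gen_choiceMixin term.

Let teqb : rel term := fun t u => `[< teq t u >].

Let teqb_refl : reflexive teqb.
Proof. by move=> t; apply/asboolP; exact: teq_refl. Qed.

Let teqb_sym : symmetric teqb.
Proof. by move=> t u; apply/asboolP/asboolP; exact: teq_sym. Qed.

Let teqb_trans : transitive teqb.
Proof.
by move=> u t v /asboolP tu /asboolP uv; apply/asboolP; exact: teq_trans uv.
Qed.

Canonical teq_equiv := EquivRel teqb teqb_refl teqb_sym teqb_trans.

Definition crossA : Type := {eq_quot teq_equiv}%qT.
HB.instance Definition _ := EqQuotient.on crossA.
HB.instance Definition _ := Choice.on crossA.

Definition cls (t : term) : crossA := \pi_crossA%qT t.

Lemma clsP t u : teq t u <-> cls t = cls u.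
Proof.
by split=> [tu|/eqmodP/asboolP//]; apply/eqmodP/asboolP.
Qed.

Lemma cls_repr x : cls (repr x) = x.
Proof. exact: reprK. Qed.

Lemma repr_cls t : teq (repr (cls t)) t.
Proof. by apply/clsP; rewrite cls_repr. Qed.

Lemma crossA_ind (P : crossA -> Prop) : (forall t, P (cls t)) -> forall x, P x.
Proof. by move=> Pt x; rewrite -(cls_repr x). Qed.

Let add (x y : crossA) := cls (repr x + repr y).
Let mul (x y : crossA) := cls (repr x * repr y).
Let opp (x : crossA) := cls (Cst (-1)%R * repr x).
Let scale (k : R[i]) (x : crossA) := cls (Cst k * repr x).
Definition crossA_star (x : crossA) : crossA := cls (tstar (repr x)).

Let addE t u : add (cls t) (cls u) = cls (t + u).
Proof. by apply/clsP/teq_add; exact: repr_cls. Qed.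
Let mulE t u : mul (cls t) (cls u) = cls (t * u).
Proof. by apply/clsP/teq_mul; exact: repr_cls. Qed.
Let oppE t : opp (cls t) = cls (Cst (-1)%R * t).
Proof. by apply/clsP/teq_mul; [exact: teq_refl|exact: repr_cls]. Qed.
Let scaleE k t : scale k (cls t) = cls (Cst k * t).
Proof. by apply/clsP/teq_mul; [exact: teq_refl|exact: repr_cls]. Qed.

Let addA : associative add.
Proof.
elim/crossA_ind => t; elim/crossA_ind => u; elim/crossA_ind => v.
by rewrite !addE; apply/clsP/teq_addA.
Qed.
Let addC : commutative add.
Proof.
by elim/crossA_ind => t; elim/crossA_ind => u; rewrite !addE; apply/clsP/teq_addC.
Qed.
Let add0 : left_id (cls (Cst 0%R)) add.
Proof. by elim/crossA_ind => t; rewrite addE; apply/clsP/teq_add0. Qed.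
Let addN : left_inverse (cls (Cst 0%R)) opp add.
Proof.
elim/crossA_ind => t; rewrite addC oppE addE; apply/clsP/teq_addN.
Qed.
HB.instance Definition _ := GRing.isZmodule.Build crossA addA addC add0 addN.

Let mulA : associative mul.
Proof.
elim/crossA_ind => t; elim/crossA_ind => u; elim/crossA_ind => v.
by rewrite !mulE; apply/clsP/teq_mulA.
Qed.
Let mul1 : left_id (cls 1) mul.
Proof. by elim/crossA_ind => t; rewrite mulE; apply/clsP/teq_mul1. Qed.
Let mulr1 : right_id (cls 1) mul.
Proof.
elim/crossA_ind => t; rewrite mulE; apply/clsP.
exact: teq_trans (teq_sym (teq_cstC _ _)) (teq_mul1 _).
Qed.
Let mulDl : left_distributive mul add.
Proof.
elim/crossA_ind => t; elim/crossA_ind => u; elim/crossA_ind => v.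
by rewrite !(mulE, addE); apply/clsP/teq_mulDl.
Qed.
Let mulDr : right_distributive mul add.
Proof.
elim/crossA_ind => t; elim/crossA_ind => u; elim/crossA_ind => v.
by rewrite !(mulE, addE); apply/clsP/teq_mulDr.
Qed.
HB.instance Definition _ :=
  GRing.Zmodule_isPzRing.Build crossA mulA mul1 mulr1 mulDl mulDr.

Let scaleA (k l : R[i]) x : scale k (scale l x) = scale (k * l)%R x.
Proof.
elim/crossA_ind: x => t; rewrite !scaleE; apply/clsP.
apply: teq_trans (teq_mulA _ _ _) _.
by apply: teq_mul; [exact/teq_sym/teq_cstM|exact: teq_refl].
Qed.
Let scale1 : left_id 1%R scale.
Proof. by elim/crossA_ind => t; rewrite scaleE; apply/clsP/teq_mul1. Qed.
Let scaleDr : right_distributive scale +%R.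
Proof.
move=> k; elim/crossA_ind => t; elim/crossA_ind => u.
rewrite -[X in scale k X]/(add _ _) -[RHS]/(add _ _) addE !scaleE addE.
by apply/clsP/teq_mulDr.
Qed.
Let scaleDl x : {morph scale^~ x : k l / (k + l)%R}.
Proof.
move=> k l; elim/crossA_ind: x => t; rewrite -[RHS]/(add _ _) !scaleE addE.
apply/clsP.
apply: teq_trans (teq_mulDl _ _ _).
by apply: teq_mul; [exact: teq_cstD|exact: teq_refl].
Qed.
(* The library's lalgType requires 1 != 0, which is not known a priori. *)
HB.instance Definition _ :=
  GRing.Zmodule_isLmodule.Build R[i] crossA scaleA scale1 scaleDr scaleDl.


Lemma gstarK : involutive gstar. Proof. by case. Qed.

Lemma tstarK : involutive tstar.
Proof.
elim=> [g|k|t IHt u IHu|t IHt u IHu] /=; last 2 first.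
- by rewrite IHt IHu.
- by rewrite IHt IHu.
- by rewrite gstarK.
- by rewrite conjcK.
Qed.

Lemma crossA_starE t : crossA_star (cls t) = cls (tstar t).
Proof. by apply/clsP/teq_star; exact: repr_cls. Qed.

Lemma crossA_starK : involutive crossA_star.
Proof. by elim/crossA_ind => t; rewrite !crossA_starE tstarK. Qed.

Lemma crossA_starM x y :
  crossA_star (x * y)%R = (crossA_star y * crossA_star x)%R.
Proof.
elim/crossA_ind: x => t; elim/crossA_ind: y => u.
rewrite -[(_ * _)%R]/(mul _ _) -[RHS]/(mul _ _).
by rewrite mulE !crossA_starE mulE.
Qed.

Lemma crossA_star_lin k x y :
  crossA_star (k *: x + y)%R = (k^* *: crossA_star x + crossA_star y)%R.
Proof.
elim/crossA_ind: x => t; elim/crossA_ind: y => u.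
rewrite -[(_ + _)%R in LHS]/(add (scale k _) _).
rewrite -[RHS]/(add (scale _ _) _).
rewrite !(crossA_starE, scaleE, addE) /=; apply/clsP.
by apply: teq_add; [exact/teq_sym/teq_cstC|exact: teq_refl].
Qed.

End CrossProduct.

Arguments crossA_star {R q c} x.

(* The generators as elements of the algebra. *)
Definition gen {R : realType} {q c : R} (g : generator) : crossA q c :=
  cls q c (Gen R g).

(* pi is a *-representation of the algebra crossA q c on the dense domain D;
   only the restriction of pi a to D matters. *)
Definition star_representation (R : realType) (q c : R) (HH : hilbertType R)
    (D : set HH) (pi : crossA q c -> HH -> HH) : Prop :=
  [/\ subspace D /\ dense D,
      forall a x, D x -> D (pi a x),
      forall a k x y, D x -> D y -> pi a (k *: x + y) = k *: pi a x + pi a y,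
      [/\ forall k a b x, D x -> pi (k *: a + b) x = k *: pi a x + pi b x,
          forall x, D x -> pi 1 x = x
        & forall a b x, D x -> pi (a * b) x = pi a (pi b x)]
    & forall a x y, D x -> D y -> '[pi a x, y] = '[x, pi (crossA_star a) y]].

Section Constants.
Variables (R : realType) (q c : R).

Definition lam : R := q - q^-1.
Definition lamn (n : nat) : R := Num.sqrt (1 - q ^+ (2 * n)).
(* s = false is the sign +, s = true is the sign -. *)
Definition lampm (s : bool) : R := 2^-1 + (-1) ^+ s * Num.sqrt (c + 4^-1).
Definition cpm (s : bool) (n : nat) : R :=
  Num.sqrt (c + lampm s * q ^+ (2 * n) - (lampm s * q ^+ (2 * n)) ^+ 2).

End Constants.

(* Main.v *)
(* The representation acts on finite families u : nat -> nat -> G of smooth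
   vectors of H (vectors in the domain of every power H ^ k, k an integer). There
   E, F, K, A, B act by matrices whose entries are H, H ^ -1, real constants and
   the roots r_j = (alpha_j + H ^ -4)^(1/2), so that the relations only need that
   the r_j commute with H and satisfy r_j ^ 2 = alpha_j + H ^ -4; relations are
   preserved by the involution because the action has an adjoint for the inner
   product and smooth vectors are dense.

   The identification of r_j with the functional calculus is where the spectral
   theorem enters. Put B = (1 + H^2)^-1. The square root Y of the bounded operator
   alpha (1 - B)^2 + B^2 gives r y = Y (1 + H^-2) y on smooth vectors. To compare it
   with the integral of f(t) = (alpha + t^-4)^(1/2) against a resolution E of H,
   call f a density of y with respect to x when d(E y) = f d(E x) locally, with
   errors that are small against a monotone function; densities add, multiply and
   can be inverted, and the density of Y x is determined by that of Y (Y x) since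
   Y is positive. As 0 is not an atom of E, the density f of r x with respect to x
   identifies r x with the operator integral of f at x. *)
Require Import Defs.
From HB Require Import structures.
From mathcomp Require Import all_boot all_order all_algebra sesquilinear.
From mathcomp Require Import complex ring lra.
From mathcomp Require Import all_classical all_reals all_analysis.
From mathcomp Require Import measurable_realfun.

Set Implicit Arguments.
Unset Strict Implicit.
Unset Printing Implicit Defensive.

Import Order.TTheory GRing.Theory Num.Theory.
Import numFieldNormedType.Exports.

Local Open Scope classical_set_scope.
Local Open Scope ring_scope.
Local Open Scope complex_scope.

(* Unqualified, these names denote the subspace topology of MathComp-Analysis
   and its inverse of a function on a set. *)
Local Notation subspace := Defs.subspace.
Local Notation oinv := Defs.oinv.

(** * Real geometry of a complex Hilbert space *)

(** [fcalc] integrates against whichever resolution a choice operator returns. Constructing one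
    resolution of H is therefore not enough: every [E] whose integral of t is H must be shown to
    commute with H and to localize it on spectral intervals. This is done for an arbitrary such [E],
    in place of a uniqueness theorem.

    The second obstacle is that the measure [rmeasure E x] changes with x, so integrals for
    different vectors cannot be compared directly. Each identity between them is reduced to one
    between squared norms on small intervals and carried to the integrals by additivity in the
    interval.

    The existence statements of Hilbert space theory that occur (resolvents, orthogonal projections,
    solvability of H x = h on a spectral window) are instances of one least-squares problem. Square
    roots come from an iteration that needs contractions, which explains the normalizing
    constants. *)

Section RealInnerProduct.
Variables (R : realType) (G : hilbertType R).
Implicit Types (x y z : G) (r : R).

(** Estimates are made with this real-valued product, where ordered-field automation applies;
    [hdotE] recovers the complex product from its values at [y] and ['i *: y]. *)
Definition rdot x y : R := complex.Re '[x, y].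
Definition sqn x : R := rdot x x.

Lemma hdot_herm x y : '[y, x] = ('[x, y])^*.
Proof. by rewrite hermC expr0 mul1r. Qed.

Lemma rdotC x y : rdot x y = rdot y x.
Proof. by rewrite /rdot hdot_herm; case: '[y, x]. Qed.

Lemma rdotDl x y z : rdot (x + y) z = rdot x z + rdot y z.
Proof. by rewrite /rdot linearDl /= raddfD. Qed.

Lemma rdotZl r x z : rdot (r%:C *: x) z = r * rdot x z.
Proof.
by rewrite /rdot linearZl_LR /=; case: '[x, z] => a b /=; rewrite mul0r subr0.
Qed.

Lemma rdotil x z : rdot ('i *: x) z = - complex.Im '[x, z].
Proof. by rewrite /rdot linearZl_LR /=; case: '[x, z] => a b /=; ring. Qed.

Lemma rdotDr x y z : rdot z (x + y) = rdot z x + rdot z y.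
Proof. by rewrite ![rdot z _]rdotC rdotDl. Qed.
Lemma rdotZr r x z : rdot z (r%:C *: x) = r * rdot z x.
Proof. by rewrite ![rdot z _]rdotC rdotZl. Qed.
Lemma rdot0l x : rdot 0 x = 0.
Proof. by have := rdotZl 0 x x; rewrite scale0r mul0r. Qed.
Lemma rdot0r x : rdot x 0 = 0. Proof. by rewrite rdotC rdot0l. Qed.
Lemma rdotNl x y : rdot (- x) y = - rdot x y.
Proof. by apply/eqP; rewrite -addr_eq0 -rdotDl addNr rdot0l. Qed.
Lemma rdotNr x y : rdot x (- y) = - rdot x y.
Proof. by rewrite rdotC rdotNl rdotC. Qed.
Lemma rdotBl x y z : rdot (x - y) z = rdot x z - rdot y z.
Proof. by rewrite rdotDl rdotNl. Qed.
Lemma rdotBr x y z : rdot z (x - y) = rdot z x - rdot z y.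
Proof. by rewrite rdotDr rdotNr. Qed.

Lemma rdotir x z : rdot x ('i *: z) = complex.Im '[x, z].
Proof. by rewrite rdotC rdotil hdot_herm; case: '[x, z] => a b /=; ring. Qed.

Lemma rdotii x y : rdot ('i *: x) ('i *: y) = rdot x y.
Proof.
by rewrite rdotil /rdot linearZr_LR /=; case: '[x, y] => a b /=; ring.
Qed.

Lemma rdotiN x y : rdot ('i *: x) y = - rdot x ('i *: y).
Proof. by rewrite rdotil rdotir. Qed.

Lemma hdotE x y : '[x, y] = (rdot x y)%:C + 'i * (rdot x ('i *: y))%:C.
Proof. by rewrite rdotir [LHS]complexE. Qed.

Lemma normE x : `|x| = (Num.sqrt (sqn x))%:C.
Proof.
have e := hdot_norm x; have n0 := normr_ge0 x.
have : 0 <= '[x, x] by rewrite -e exprn_ge0.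
rewrite lecE /= => /andP[/eqP im re].
have sx : '[x, x] = (sqn x)%:C by rewrite [LHS]complexE im mulr0 addr0.
apply/eqP; rewrite -(@eqrXn2 _ 2)//; last by rewrite lecR sqrtr_ge0.
by rewrite e sx -rmorphXn/= sqr_sqrtr.
Qed.

Lemma sqn_ge0 x : 0 <= sqn x.
Proof.
have : 0 <= '[x, x] by rewrite -hdot_norm exprn_ge0.
by rewrite lecE => /andP[].
Qed.

Lemma sqn_eq0 x : sqn x = 0 -> x = 0.
Proof. by move=> e; apply: normr0_eq0; rewrite normE e sqrtr0. Qed.

Lemma sqn_le0 x : sqn x <= 0 -> x = 0.
Proof. by move=> e; apply/sqn_eq0/eqP; rewrite eq_le e sqn_ge0. Qed.

Lemma sqn0 : sqn 0 = 0. Proof. by rewrite /sqn rdot0l. Qed.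

Lemma sqnD x y : sqn (x + y) = sqn x + 2 * rdot x y + sqn y.
Proof. by rewrite /sqn !(rdotDl, rdotDr) (rdotC y x); ring. Qed.
Lemma sqnB x y : sqn (x - y) = sqn x - 2 * rdot x y + sqn y.
Proof. by rewrite /sqn !(rdotBl, rdotBr) (rdotC y x); ring. Qed.
Lemma sqnN x : sqn (- x) = sqn x.
Proof. by rewrite /sqn rdotNl rdotNr opprK. Qed.
Lemma sqnBC x y : sqn (x - y) = sqn (y - x).
Proof. by rewrite -sqnN opprB. Qed.
Lemma sqnZ r x : sqn (r%:C *: x) = r ^+ 2 * sqn x.
Proof. by rewrite /sqn rdotZl rdotZr; ring. Qed.
Lemma sqni x : sqn ('i *: x) = sqn x.
Proof. exact: rdotii. Qed.

Lemma sqnD_le x y : sqn (x + y) <= 2 * sqn x + 2 * sqn y.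
Proof. have := sqn_ge0 (x - y); rewrite sqnB sqnD; lra. Qed.
Lemma sqnB_le x y : sqn (x - y) <= 2 * sqn x + 2 * sqn y.
Proof. by rewrite -(sqnN y) sqnD_le. Qed.

Lemma rdotxi x : rdot x ('i *: x) = 0.
Proof. have := rdotiN x x; rewrite rdotC; lra. Qed.

Lemma sqnZc (k : R[i]) x :
  sqn (k *: x) = (complex.Re k ^+ 2 + complex.Im k ^+ 2) * sqn x.
Proof.
rewrite {1}(complexE k) scalerDl mulrC -scalerA sqnD !sqnZ sqni.
by rewrite rdotZl rdotZr rdotxi; ring.
Qed.

Lemma cauchy_schwarz x y : rdot x y ^+ 2 <= sqn x * sqn y.
Proof.
have [->|y0] := eqVneq y 0; first by rewrite rdot0r sqn0 mulr0 expr0n.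
have sy : 0 < sqn y.
  by rewrite lt_neqAle sqn_ge0 eq_sym andbT; apply: contra_neq y0 => /sqn_eq0.
have := sqn_ge0 ((sqn y)%:C *: x - (rdot x y)%:C *: y).
rewrite sqnB !sqnZ rdotZl rdotZr => h.
rewrite -subr_ge0 -(pmulr_rge0 _ sy); apply: le_trans h _.
by rewrite le_eqVlt; apply/orP; left; apply/eqP; ring.
Qed.

(** Young's inequality, from the squares of [sqrt e x + y / sqrt e] and [sqrt e x - y / sqrt e]. The
    free weight lets later estimates put the small factor on either term. *)
Lemma rdot_le (e : R) x y : 0 < e ->
  2 * `|rdot x y| <= e * sqn x + e^-1 * sqn y.
Proof.
move=> e0; have sse : 0 < Num.sqrt e by rewrite sqrtr_gt0.
have ee : Num.sqrt e ^+ 2 = e by rewrite sqr_sqrtr// ltW.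
have ev : (Num.sqrt e)^-1 ^+ 2 = e^-1 by rewrite exprVn ee.
have se0 : Num.sqrt e != 0 by rewrite gt_eqF.
have := sqn_ge0 ((Num.sqrt e)%:C *: x - (Num.sqrt e)^-1%:C *: y).
have := sqn_ge0 ((Num.sqrt e)%:C *: x + (Num.sqrt e)^-1%:C *: y).
have w : rdot ((Num.sqrt e)%:C *: x) ((Num.sqrt e)^-1%:C *: y) = rdot x y.
  by rewrite rdotZl rdotZr mulrA divff// mul1r.
rewrite sqnB sqnD !sqnZ w ee ev.
by case: (ger0P (rdot x y)) => _; lra.
Qed.

Lemma rdot_eq x y : (forall z, rdot x z = rdot y z) -> x = y.
Proof.
move=> e; apply/eqP; rewrite -subr_eq0; apply/eqP/sqn_eq0.
by rewrite /sqn {1}rdotBl e subrr.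
Qed.

Definition rnorm x := Num.sqrt (sqn x).

Lemma rnorm_ge0 x : 0 <= rnorm x. Proof. exact: sqrtr_ge0. Qed.
Lemma sqr_rnorm x : rnorm x ^+ 2 = sqn x.
Proof. by rewrite sqr_sqrtr ?sqn_ge0. Qed.
Lemma rnorm_normE x : `|x| = (rnorm x)%:C. Proof. exact: normE. Qed.
Lemma rnormD x y : rnorm (x + y) <= rnorm x + rnorm y.
Proof. by rewrite -lecR rmorphD /= -!rnorm_normE ler_normD. Qed.
Lemma rnormZ r x : 0 <= r -> rnorm (r%:C *: x) = r * rnorm x.
Proof. by move=> r0; rewrite /rnorm sqnZ sqrtrM ?sqr_ge0// sqrtr_sqr ger0_norm. Qed.
Lemma rnorm0 : rnorm 0 = 0. Proof. by rewrite /rnorm sqn0 sqrtr0. Qed.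
Lemma ler_rnorm x y : sqn x <= sqn y -> rnorm x <= rnorm y.
Proof. by move=> h; rewrite ler_sqrt// sqn_ge0. Qed.
Lemma rnorm_leP r x : 0 <= r -> (rnorm x <= r) = (sqn x <= r ^+ 2).
Proof. by move=> r0; rewrite -sqr_rnorm ler_pXn2r// nnegrE rnorm_ge0. Qed.

Lemma cvg_rnormP (T : Type) (F : set_system T) {FF : Filter F} (f : T -> G) x :
  f @ F --> x <-> forall e : R, 0 < e -> \forall t \near F, sqn (f t - x) < e.
Proof.
split=> [/cvgrPdist_lt h e e0|h].
  have se : 0 < (Num.sqrt e)%:C :> R[i] by rewrite ltcR sqrtr_gt0.
  apply: filterS (h _ se) => t; rewrite normE ltcR -/(rnorm _) ltr_sqrt//.
  by rewrite sqnBC.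
apply/cvgrPdist_lt => e; rewrite ltcE /= => /andP[/eqP im re].
have := h _ (exprn_gt0 2 re); apply: filterS => t ht.
rewrite normE ltcE im eqxx /= -(ltr_pXn2r (ltn0Sn 1)) ?nnegrE ?sqrtr_ge0 ?ltW//.
by rewrite sqr_sqrtr ?sqn_ge0// sqnBC.
Qed.

Lemma sqn_cauchy (u : nat -> G) :
  (forall e : R, 0 < e -> exists N, forall n m, (N <= n)%N -> (N <= m)%N ->
     sqn (u n - u m) < e) -> exists x, u @ \oo --> x.
Proof.
move=> h; suff : cvgn u by move=> c; exists (lim (u @ \oo)).
apply/cauchy_cvgP/cauchy_ballP => e; rewrite ltcE /= => /andP[/eqP im re].
have [N hN] := h _ (exprn_gt0 2 re); rewrite near_map2.
exists ([set n | (N <= n)%N], [set n | (N <= n)%N]); first by split; exists N.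
move=> [n m] /= [hn hm]; rewrite -ball_normE /ball_ /=.
rewrite normE ltcE im eqxx /= -(ltr_pXn2r (ltn0Sn 1)) ?nnegrE ?sqrtr_ge0 ?ltW//.
by rewrite sqr_sqrtr ?sqn_ge0// hN.
Qed.

Lemma hcvg_unique (T : Type) (F : set_system T) {FF : ProperFilter F}
  (f : T -> G) x y : f @ F --> x -> f @ F --> y -> x = y.
Proof. exact: cvg_unique. Qed.

Lemma rcvg_unique (T : Type) (F : set_system T) {FF : ProperFilter F}
  (f : T -> R) (a b : R) : f @ F --> a -> f @ F --> b -> a = b.
Proof. exact: cvg_unique. Qed.

Lemma cvg_rdotl (T : Type) (F : set_system T) {FF : Filter F} (f : T -> G) x z :
  f @ F --> x -> (fun t => rdot (f t) z) @ F --> rdot x z.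
Proof.
move=> /cvg_rnormP h; apply/cvgrPdist_lt => e e0.
have d0 : 0 < e ^+ 2 / (sqn z + 1).
  by rewrite divr_gt0 ?exprn_gt0// ltr_wpDl ?sqn_ge0.
apply: filterS (h _ d0) => t ht; rewrite distrC -rdotBl.
have z1 : 0 < sqn z + 1 by rewrite ltr_wpDl ?sqn_ge0.
have cs := cauchy_schwarz (f t - x) z.
move: ht; rewrite ltr_pdivlMr// => ht.
rewrite -(ltr_pXn2r (ltn0Sn 1)) ?nnegrE ?normr_ge0 ?(ltW e0)// real_normK ?num_real//.
have := sqn_ge0 (f t - x); have := sqn_ge0 z; nra.
Qed.

Lemma cvg_rdotr (T : Type) (F : set_system T) {FF : Filter F} (f : T -> G) x z :
  f @ F --> x -> (fun t => rdot z (f t)) @ F --> rdot z x.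
Proof.
move=> fx; rewrite rdotC; under eq_fun do rewrite rdotC.
exact: cvg_rdotl.
Qed.

Lemma cvg_sqn (T : Type) (F : set_system T) {FF : Filter F} (f : T -> G) x :
  f @ F --> x -> (fun t => sqn (f t)) @ F --> sqn x.
Proof.
move=> fx; have /cvg_rnormP h := fx.
have hx := cvg_rdotr (z := x) fx.
rewrite [X in _ --> X](_ : _ = 0 + 2 * rdot x x - sqn x); last by rewrite /sqn; ring.
rewrite [X in X @ _](_ : _ = fun t => sqn (f t - x) + 2 * rdot x (f t) - sqn x); last first.
  by apply/funext => t; rewrite sqnB (rdotC (f t)); ring.
apply: cvgB; last exact: cvg_cst.
apply: cvgD; last by apply: cvgMl_tmp => //; exact: hx.
apply/cvgrPdist_lt => e e0; apply: filterS (h _ e0) => t.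
by rewrite sub0r normrN ger0_norm ?sqn_ge0.
Qed.

End RealInnerProduct.

Definition linear_on (K : pzRingType) (U V : lmodType K) (D : set U)
    (L : U -> V) : Prop :=
  forall a x y, D x -> D y -> L (a *: x + y) = a *: L x + L y.

Section Subspaces.
Variables (K : pzRingType) (U V : lmodType K) (D : set U).
Hypothesis sD : subspace D.

Lemma subspace0 : D 0. Proof. by have [] := sD. Qed.
Lemma subspaceD x y : D x -> D y -> D (x + y).
Proof. by have [_ h] := sD => dx dy; rewrite -(scale1r x); exact: h. Qed.
Lemma subspaceZ a x : D x -> D (a *: x).
Proof. by have [d0 h] := sD => dx; rewrite -(addr0 (a *: x)); exact: h. Qed.
Lemma subspaceN x : D x -> D (- x).
Proof. by move=> dx; rewrite -scaleN1r; exact: subspaceZ. Qed.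
Lemma subspaceB x y : D x -> D y -> D (x - y).
Proof. by move=> dx dy; apply: subspaceD => //; exact: subspaceN. Qed.

Variables (L : U -> V).
Hypothesis linL : linear_on D L.

Lemma linear_onD x y : D x -> D y -> L (x + y) = L x + L y.
Proof. by move=> dx dy; rewrite -{1}(scale1r x) linL// scale1r. Qed.
Lemma linear_on0 : L 0 = 0.
Proof.
have := linear_onD subspace0 subspace0; rewrite addr0 => /eqP.
by rewrite -subr_eq0 opprD addNKr oppr_eq0 => /eqP.
Qed.
Lemma linear_onZ a x : D x -> L (a *: x) = a *: L x.
Proof.
by move=> dx; rewrite -[in LHS](addr0 (a *: x)) linL ?linear_on0 ?addr0//;
  exact: subspace0.
Qed.
Lemma linear_onN x : D x -> L (- x) = - L x.
Proof. by move=> dx; rewrite -scaleN1r linear_onZ// scaleN1r. Qed.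
Lemma linear_onB x y : D x -> D y -> L (x - y) = L x - L y.
Proof. by move=> dx dy; rewrite linear_onD ?linear_onN//; exact: subspaceN. Qed.
End Subspaces.

(** * Least squares for a closed pair of operators *)

Section LeastSquares.
Variables (R : realType) (G : hilbertType R).

Lemma quadratic_ge0_linear0 (a b : R) :
  (forall s, 0 <= 2 * s * a + s ^+ 2 * b) -> a = 0.
Proof.
move=> h; have b0 : 0 <= b by have := h 1; have := h (-1); nra.
(* The minimum is at [- a / b]; using [b + 1] covers [b = 0] and still gives a negative value unless
   [a = 0]. *)
have h1 := h (- a / (b + 1)); have b1 : 0 < b + 1 by lra.
have e : 2 * (- a / (b + 1)) * a + (- a / (b + 1)) ^+ 2 * b =
  - (a ^+ 2 * (b + 2)) / (b + 1) ^+ 2 by field; lra.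
have : a ^+ 2 * (b + 2) <= 0.
  move: h1; rewrite e pmulr_lge0 ?invr_gt0 ?exprn_gt0//; lra.
rewrite pmulr_lle0 => [a2|]; last lra.
by apply/eqP; rewrite -sqrf_eq0 eq_le a2 sqr_ge0.
Qed.

Variables (D : set G) (L1 L2 : G -> G).
Hypothesis sD : subspace D.
Hypothesis lin1 : linear_on D L1.
Hypothesis lin2 : linear_on D L2.

(** The vector x minimizes [sqn (L1 x - h) + sqn (L2 x)], and the conclusion is the vanishing of the
    first variation. The pair ([L1], [L2]) is taken as (id, T) for the resolvent, (id, 0) for
    projections and (H, 0) for solving [H x = h] on a spectral window. *)
Lemma least_squares h :
  (forall (u : nat -> G) v w, (forall n, D (u n)) -> L1 \o u @ \oo --> v ->
     L2 \o u @ \oo --> w -> exists x, [/\ D x, L1 x = v & L2 x = w]) ->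
  exists2 x, D x & forall z, D z ->
    rdot (h - L1 x) (L1 z) = rdot (L2 x) (L2 z).
Proof.
move=> clo; pose Phi x := sqn (L1 x - h) + sqn (L2 x).
have Phi0 x : 0 <= Phi x by rewrite addr_ge0 ?sqn_ge0.
pose V := [set Phi x | x in D].
have V0 : V !=set0 by exists (Phi 0); exists 0 => //; exact: subspace0.
have lV : has_lbound V by exists 0 => _ [x _ <-].
have hV : has_inf V by split.
set m := inf V.
have mle x : D x -> m <= Phi x by move=> dx; apply: ge_inf => //; exists x.
have ex n : exists x, D x /\ Phi x < m + n.+1%:R^-1.
  have n0 : 0 < n.+1%:R^-1 :> R by rewrite invr_gt0.
  by have [_ [x dx <-] hx] := inf_adherent n0 hV; exists x.
have [u hu] := choice ex.
have du n : D (u n) by case: (hu n).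
(* Parallelogram law: the midpoint of x and y has value at least [m], so near-minimizers have close
   images under both maps. *)
have par x y : D x -> D y ->
    sqn (L1 x - L1 y) + sqn (L2 x - L2 y) <= 2 * (Phi x + Phi y - 2 * m).
  move=> dx dy; have dxy : D ((2^-1)%:C *: (x + y)).
    by apply: subspaceZ => //; exact: subspaceD.
  have := mle _ dxy; rewrite /Phi (linear_onZ sD lin1) ?(linear_onZ sD lin2);
    try exact: subspaceD.
  rewrite !(linear_onD lin1)// !(linear_onD lin2)//.
  have half v : (2^-1)%:C *: (v + v) = v :> G.
    have -> : v + v = 2%:C *: v by rewrite rmorph_nat scaler_nat.
    by rewrite scalerA -rmorphM mulVf ?pnatr_eq0// scale1r.
  rewrite -{1}(half h) -scalerBr opprD addrACA !sqnZ => hm.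
  have -> : L1 x - L1 y = (L1 x - h) - (L1 y - h) by rewrite opprB addrA subrK.
  move: (L1 x - h) (L1 y - h) hm => p r; rewrite !sqnB !sqnD; lra.
have cau (L : G -> G) : (forall n k, sqn (L (u n) - L (u k)) <=
    2 * (Phi (u n) + Phi (u k) - 2 * m)) -> exists v : G, L \o u @ \oo --> v.
  move=> Lu; apply: (@sqn_cauchy _ _ (L \o u)) => e e0.
  have e4 : 0 < e / 4 by rewrite divr_gt0.
  have [N _ hN] := near_infty_natSinv_lt (PosNum e4).
  exists N => n k Nn Nk; have := Lu n k.
  have := hN _ Nn; have := hN _ Nk; rewrite /=.
  have [_] := hu n; have [_] := hu k => /=. move: (n.+1%:R^-1) (k.+1%:R^-1) => *; lra.
have [v hv] : exists v : G, L1 \o u @ \oo --> v.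
  by apply: cau => n k; apply: le_trans (par _ _ (du n) (du k));
    rewrite lerDl sqn_ge0.
have [w hw] : exists w : G, L2 \o u @ \oo --> w.
  by apply: cau => n k; apply: le_trans (par _ _ (du n) (du k));
    rewrite lerDr sqn_ge0.
have [x [dx xv xw]] := clo u v w du hv hw.
have Phix : Phi x <= m.
  have c1 : (fun n => Phi (u n)) @ \oo --> Phi x.
    rewrite /Phi xv xw; apply: cvgD; last exact: cvg_sqn.
    by apply: cvg_sqn; apply: cvgB => //; exact: cvg_cst.
  have c2 : (fun n : nat => m + n.+1%:R^-1) @ \oo --> m.
    by rewrite -[X in _ --> X]addr0; apply: cvgD; [exact: cvg_cst|exact: cvg_harmonic].
  by apply: ler_cvg_to c1 c2 _; apply: nearW => n; apply: ltW; case: (hu n).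
exists x => // z dz.
suff : rdot (L1 x - h) (L1 z) + rdot (L2 x) (L2 z) = 0.
  by rewrite -(opprB (L1 x)) rdotNl; lra.
apply: (@quadratic_ge0_linear0 _ (sqn (L1 z) + sqn (L2 z))) => s.
have dsz : D (s%:C *: z) by exact: subspaceZ.
have := mle _ (subspaceD sD dx dsz).
rewrite /Phi !(linear_onD lin1)// !(linear_onD lin2)// !(linear_onZ sD lin1)// !(linear_onZ sD lin2)//.
rewrite [L1 x + _ - h]addrAC; move: Phix; rewrite /Phi.
move: (L1 x - h) => p; rewrite !sqnD !sqnZ !rdotZr; lra.
Qed.
End LeastSquares.

(** * Square roots of positive contractions *)

Section BoundedOperators.
Variables (R : realType) (G : hilbertType R).
Implicit Types (S T X : G -> G) (x y z : G).

Definition contraction T :=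
  (forall a x y, T (a *: x + y) = a *: T x + T y) /\
  forall x, sqn (T x) <= sqn x.
(** For complex-linear maps the real condition is the usual symmetry, see [symmetric_hdot]. *)
Definition symmetric_op T := forall x y, rdot (T x) y = rdot x (T y).
Definition positive_op T := forall x, 0 <= rdot (T x) x.
Definition commutes S T := forall x, S (T x) = T (S x).

Lemma subspaceT : subspace [set: G]. Proof. by []. Qed.

Section Linear.
Variable T : G -> G.
Hypothesis linT : forall a x y, T (a *: x + y) = a *: T x + T y.
Let linTT : linear_on setT T. Proof. by move=> a x y _ _. Qed.
Lemma lin0 : T 0 = 0. Proof. exact: (linear_on0 subspaceT linTT). Qed.
Lemma linD x y : T (x + y) = T x + T y. Proof. exact: (linear_onD linTT). Qed.
Lemma linB x y : T (x - y) = T x - T y.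
Proof. exact: (linear_onB subspaceT linTT). Qed.
Lemma linN x : T (- x) = - T x.
Proof. exact: (linear_onN subspaceT linTT). Qed.
Lemma linZ a x : T (a *: x) = a *: T x.
Proof. exact: (linear_onZ subspaceT linTT). Qed.
End Linear.

Lemma contraction_cvg T (U : Type) (F : set_system U) {FF : Filter F}
    (f : U -> G) x : contraction T -> f @ F --> x -> (T \o f) @ F --> T x.
Proof.
move=> [linT cT] /cvg_rnormP h; apply/cvg_rnormP => e e0.
by apply: filterS (h e e0) => t; apply: le_lt_trans; rewrite -linB.
Qed.

(** The first hypothesis makes y nondecreasing, so its increments beyond some index are small and
    control those of u. It yields the limits of monotone families of operators applied to a
    vector. *)
Lemma monotone_cauchy (u : nat -> G) (y : nat -> R) M :
  (forall n k, (n <= k)%N -> sqn (u k - u n) <= y k - y n) ->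
  (forall n, y n <= M) -> exists x : G, u @ \oo --> x.
Proof.
move=> h yM; have hs : has_sup (range y).
  by split; [exists (y 0%N), 0%N|exists M => _ [n _ <-]].
apply: sqn_cauchy => e e0; have e4 : 0 < e / 4 by rewrite divr_gt0.
have [_ [N _ <-] hN] := sup_adherent e4 hs.
have le n : y n <= sup (range y) by apply: sup_ubound; [case: hs|exists n].
exists N => n k Nn Nk; rewrite -(subrK (u N) (u n)) -addrA -(opprB (u k)).
apply: le_lt_trans (sqnB_le _ _) _.
have := h _ _ Nn; have := h _ _ Nk; have := le n; have := le k; lra.
Qed.

Section SquareRoot.
Variable A : G -> G.
Hypotheses (cA : contraction A) (sA : symmetric_op A) (pA : positive_op A).

Let X x := x - A x.
Let linA := cA.1.

(** This is A^2 <= A: positivity is used at [x - A x], and the remaining cubic term is at most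
    [sqn (A x)] because A is a contraction. *)
Lemma positive_contraction x : sqn (A x) <= rdot (A x) x.
Proof.
have := pA (x - A x); rewrite (linB linA) !(rdotBl, rdotBr) (sA (A x) x).
have := sqn_ge0 (A (A x) - A x); rewrite sqnB.
have := cA.2 (A x); rewrite /sqn; lra.
Qed.

Let linX a x y : X (a *: x + y) = a *: X x + X y.
Proof. by rewrite /X linA scalerBr opprD addrACA. Qed.

Let cX x : sqn (X x) <= sqn x.
Proof.
have := positive_contraction x; have := pA x; rewrite /X sqnB rdotC; lra.
Qed.

(** A fixed point L of the operator iteration [Y (n+1) = (X + Y n ^ 2) / 2], with X = 1 - A,
    satisfies (1 - L)^2 = A, so the root is 1 - L. The numbers [y n] are the same iteration for X =
    1; they increase within [0, 1] and dominate [Y n] and its increments in norm. *)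
Let y := fix y n : R := if n is n.+1 then (1 + y n ^+ 2) / 2 else 0.
Let Y := fix Y n x : G := if n is n.+1 then (2^-1)%:C *: (X x + Y n (Y n x)) else 0.

Let y01 n : 0 <= y n <= 1.
Proof. by elim: n => [|n]/=; rewrite ?lexx ?ler01//; set t := y n; nra. Qed.

Let y_nd n : y n <= y n.+1.
Proof. by rewrite /= -/(y n); have := sqr_ge0 (y n - 1); lra. Qed.

Let linY n a x z : Y n (a *: x + z) = a *: Y n x + Y n z.
Proof.
elim: n a x z => [|n IH] a x z /=; first by rewrite scaler0 addr0.
rewrite !IH linX addrACA -scalerDr [LHS]scalerDr; congr (_ + _).
by rewrite !scalerA mulrC.
Qed.

Let Ycomm T : (forall a x z, T (a *: x + z) = a *: T x + T z) ->
  commutes T A -> forall n, commutes T (Y n).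
Proof.
move=> linT TA; elim=> [|n IH] x /=; first exact: lin0.
by rewrite (linZ linT) (linD linT) !IH /X (linB linT) TA.
Qed.

Let YA n : commutes (Y n) A.
Proof. by move=> x; rewrite (Ycomm linA). Qed.

Let YY n m : commutes (Y n) (Y m).
Proof. exact: (Ycomm (linY n)). Qed.

Let symY n : symmetric_op (Y n).
Proof.
elim: n => [|n IH] x z /=; first by rewrite rdot0l rdot0r.
by rewrite rdotZl rdotZr !(rdotDl, rdotDr) !(rdotNl, rdotNr) !IH sA.
Qed.

Let bY n x : rnorm (Y n x) <= y n * rnorm x.
Proof.
elim: n x => [|n IH] x /=; first by rewrite rnorm0 mul0r.
rewrite rnormZ ?invr_ge0//.
have := rnormD (X x) (Y n (Y n x)).
have := ler_rnorm (cX x); have := IH x; have := IH (Y n x).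
have /andP[y0 _] := y01 n; rewrite -/(y n).
move: (rnorm (Y n (Y n x))) (rnorm_ge0 x) => a b; nra.
Qed.

(** The iterates commute, so the difference of their squares factors; the same factorization of the
    scalar iteration closes the induction. *)
Let dY n x : rnorm (Y n.+1 x - Y n x) <= (y n.+1 - y n) * rnorm x.
Proof.
elim: n x => [|n IH] x.
  have := bY 1 x; by rewrite /= !subr0.
have -> : Y n.+2 x - Y n.+1 x =
    (2^-1)%:C *: (Y n.+1 (Y n.+1 x - Y n x) + Y n (Y n.+1 x - Y n x)).
  rewrite !(linB (linY _)) (YY n n.+1) addrA subrK.
  rewrite -[Y n.+2 x]/((2^-1)%:C *: (X x + Y n.+1 (Y n.+1 x))).
  rewrite -[Y n.+1 x in LHS]/((2^-1)%:C *: (X x + Y n (Y n x))).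
  by rewrite -scalerBr opprD addrACA subrr add0r.
rewrite rnormZ ?invr_ge0//.
have := rnormD (Y n.+1 (Y n.+1 x - Y n x)) (Y n (Y n.+1 x - Y n x)).
have := bY n.+1 (Y n.+1 x - Y n x); have := bY n (Y n.+1 x - Y n x).
have := IH x; have /andP[y0 _] := y01 n; have /andP[y1 _] := y01 n.+1.
have := rnorm_ge0 x; have := y_nd n.
have -> : y n.+2 - y n.+1 = (y n.+1 + y n) / 2 * (y n.+1 - y n).
  rewrite -[y n.+2]/((1 + y n.+1 ^+ 2) / 2) -[X in _ - X]/((1 + y n ^+ 2) / 2).
  by field.
move: (y n) (y n.+1) (rnorm x) (rnorm (Y n.+1 x - Y n x)) y0 y1
  => p p1 r d p0 q0 pq r0 dr h1 h2 h3.
have : (p1 + p) * d <= (p1 + p) * ((p1 - p) * r) by apply: ler_wpM2l => //; lra.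
lra.
Qed.

Let dYk n k x : rnorm (Y (n + k) x - Y n x) <= (y (n + k) - y n) * rnorm x.
Proof.
elim: k => [|k IH]; first by rewrite addn0 !subrr rnorm0 mul0r.
rewrite addnS -(subrK (Y (n + k) x) (Y _.+1 x)) -addrA.
apply: le_trans (rnormD _ _) _; have := dY (n + k) x; move: IH; lra.
Qed.

Let y_mono n k : (n <= k)%N -> y n <= y k.
Proof.
move=> /subnK <-; elim: (_ - _)%N => // j IH.
by rewrite addSn; exact: le_trans IH (y_nd _).
Qed.

Let Ycvg x : exists v : G, Y^~ x @ \oo --> v.
Proof.
apply: (@monotone_cauchy (Y^~ x) (fun n => y n * sqn x) (sqn x)) => [n k nk|n].
  have := dYk n (k - n) x; rewrite subnKC//.
  have := y_mono nk; have /andP[n0 _] := y01 n; have /andP[_ k1] := y01 k.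
  rewrite -(sqr_rnorm (_ - _)) -(sqr_rnorm x); have := rnorm_ge0 (Y k x - Y n x).
  have := rnorm_ge0 x; move: (rnorm _) (rnorm x) (y n) (y k) n0 k1 => a b c d.
  move=> c0 d1 b0 a0 cd h.
  (* Since [0 <= d - c <= 1], the square of [d - c] is at most [d - c], so y itself serves as the
     bounded monotone control. *)
  have : a ^+ 2 <= ((d - c) * b) ^+ 2 by rewrite ler_pXn2r// nnegrE mulr_ge0// subr_ge0.
  move=> h2; apply: (le_trans h2); rewrite -mulrBl exprMn.
  by apply: ler_wpM2r; [exact: sqr_ge0|nra].
by have /andP[_ y1] := y01 n; rewrite ler_piMl ?sqn_ge0.
Qed.

Lemma positive_sqrt : exists S : G -> G,
  [/\ contraction S, symmetric_op S, positive_op S, forall x, S (S x) = A x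
    & forall T, contraction T -> commutes T A -> commutes T S].
Proof.
have [L hL] := choice Ycvg.
have linL a x z : L (a *: x + z) = a *: L x + L z.
  apply: hcvg_unique (hL _) _.
  have -> : Y^~ (a *: x + z) = (fun n => a *: Y n x + Y n z).
    by apply/funext => n; rewrite linY.
  by apply: cvgD; [apply: cvgZl_tmp|]; exact: hL.
have cL x : sqn (L x) <= sqn x.
  apply: (ler_cvg_to (cvg_sqn (hL x)) (cvg_cst (sqn x))); apply: nearW => n.
  rewrite -(sqr_rnorm x) -rnorm_leP ?rnorm_ge0//; apply: le_trans (bY n x) _.
  by rewrite ler_piMl ?rnorm_ge0//; case/andP: (y01 n).
have symL : symmetric_op L.
  move=> x z; apply: rcvg_unique (cvg_rdotl (z := z) (hL x)) _.
  rewrite (_ : (fun _ => _) = (fun n => rdot x (Y n z))); last first.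
    by apply/funext => n; rewrite symY.
  exact: cvg_rdotr.
have fixL x : L x = (2^-1)%:C *: (X x + L (L x)).
  have := hL x; rewrite -cvg_shiftS /= => hS; apply: hcvg_unique hS _.
  apply: cvgZl_tmp; apply: cvgD; first exact: cvg_cst.
  apply/cvg_rnormP => e e0; have e4 : 0 < e / 4 by rewrite divr_gt0.
  have [/cvg_rnormP/(_ _ e4) h1 /cvg_rnormP/(_ _ e4) h2] := (hL x, hL (L x)).
  near=> n; rewrite -(subrK (Y n (L x)) (Y n (Y n x))) -addrA.
  apply: le_lt_trans (sqnD_le _ _) _.
  have : sqn (Y n (L x) - L (L x)) < e / 4 by near: n.
  have : sqn (Y n x - L x) < e / 4 by near: n.
  have : sqn (Y n (Y n x) - Y n (L x)) <= sqn (Y n x - L x).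
    rewrite -(linB (linY n)) -(sqr_rnorm (Y n x - _)) -rnorm_leP ?rnorm_ge0//.
    apply: le_trans (bY n _) _.
    by rewrite ler_piMl ?rnorm_ge0//; case/andP: (y01 n).
  lra.
have e2 x : (2%:C : R[i]) *: L x = X x + L (L x).
  by rewrite {1}fixL scalerA -rmorphM divff// scale1r.
pose S x := x - L x.
have linS a x z : S (a *: x + z) = a *: S x + S z.
  by rewrite /S linL scalerBr opprD addrACA.
have symS : symmetric_op S by move=> x z; rewrite /S rdotBl rdotBr symL.
have SS x : S (S x) = A x.
  have e : L (L x) = L x + L x - X x.
    by rewrite -mulr2n -scaler_nat -(rmorph_nat (real_complex R)) e2 addrAC subrr add0r.
  rewrite /S (linB linL) e.
  have -> : L x - (L x + L x - X x) = X x - L x by rewrite opprB addrCA opprD addNKr.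
  by rewrite opprB addrA subrK opprB addrCA subrr addr0.
exists S; split=> //.
- split=> // x; rewrite /sqn symS SS rdotC.
  have := positive_contraction x; have := sqn_ge0 (A x - x); rewrite sqnB -/(sqn x); lra.
- move=> x; rewrite /S rdotBl -/(sqn x).
  have := sqn_ge0 (L x - x); rewrite sqnB; have := cL x; lra.
- move=> T [linT cT] TA x; rewrite /S (linB linT); congr (_ - _).
  apply: hcvg_unique (contraction_cvg (conj linT cT) (hL x)) _ => /=.
  rewrite [X in X @ _](_ : _ = Y^~ (T x)); first exact: hL.
  by apply/funext => n /=; rewrite (Ycomm linT TA).
Unshelve. all: by end_near. Qed.

End SquareRoot.
End BoundedOperators.

(** * Resolvent and bounded transforms of a self-adjoint operator *)

Section SelfAdjoint.
Variables (R : realType) (G : hilbertType R) (T : operator G).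
Hypothesis hT : self_adjoint T.
Implicit Types (x y z w h : G).

Lemma sa_subspace : subspace (odom T). Proof. by case: hT. Qed.
Lemma sa_linear : linear_on (odom T) T. Proof. by case: hT. Qed.

Lemma sa_symmetric x y : odom T x -> odom T y -> rdot (T x) y = rdot x (T y).
Proof.
move=> dx dy; have [_ _ _ /(_ y (T y))[_ h]] := hT.
by rewrite /rdot (h (conj dy erefl)).
Qed.

(** Real parts suffice because the domain is a complex subspace: the imaginary part is the real
    identity at ['i *: x]. *)
Lemma sa_adjoint y z : (forall x, odom T x -> rdot (T x) y = rdot x z) ->
  odom T y /\ T y = z.
Proof.
move=> h; have [_ _ _ /(_ y z)[+ _]] := hT; apply=> x dx.
rewrite !hdotE h//; congr (_ + 'i * _%:C).
apply: oppr_inj; rewrite -!rdotiN -h; last exact: (subspaceZ sa_subspace).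
by rewrite (linear_onZ sa_subspace sa_linear).
Qed.

Lemma sa_closed (u : nat -> G) v w : (forall n, odom T (u n)) ->
  u @ \oo --> v -> (fun n => T (u n)) @ \oo --> w -> odom T v /\ T v = w.
Proof.
move=> du uv uw; apply: sa_adjoint => x dx.
apply: rcvg_unique (cvg_rdotr (z := T x) uv) _.
rewrite (_ : (fun _ => _) = (fun n => rdot x (T (u n)))); first exact: cvg_rdotr.
by apply/funext => n; rewrite sa_symmetric.
Qed.

(** Minimizing [sqn (x - h) + sqn (T x)] gives [rdot (h - x) z = rdot (T x) (T z)] on the domain,
    which says that [T x] lies in the domain of the adjoint, with value [h - x]. *)
Lemma sa_resolvent h :
  exists x, [/\ odom T x, odom T (T x) & x + T (T x) = h].
Proof.
have lin_id : linear_on (odom T) (@id G) by [].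
have [|x dx hx] := least_squares sa_subspace lin_id sa_linear h.
  move=> u v w du uv uw; exists v;
    by have [] := sa_closed du uv uw.
exists x; have [z dz|dTx ->] := @sa_adjoint (T x) (h - x).
  by rewrite rdotC -hx// rdotC.
by split=> //; rewrite addrC subrK.
Qed.

Lemma sa_resolvent_unique x y : odom T x -> odom T (T x) ->
  odom T y -> odom T (T y) -> x + T (T x) = y + T (T y) -> x = y.
Proof.
move=> dx ddx dy ddy e; apply/eqP; rewrite -subr_eq0; apply/eqP/sqn_le0.
have sD := sa_subspace; have sL := sa_linear.
have dz : odom T (x - y) by exact: subspaceB.
have dTz : odom T (T (x - y)) by rewrite (linear_onB sD sL)//; exact: subspaceB.
have : rdot (x - y + T (T (x - y))) (x - y) = 0.
  rewrite !(linear_onB sD sL)// addrACA -opprD e subrr.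
  by rewrite rdot0l.
rewrite rdotDl sa_symmetric// -!/(sqn _).
by have := sqn_ge0 (T (x - y)); lra.
Qed.

(* B = (1 + T^2)^-1 and C = T B. *)
Lemma sa_bounded : exists B C : G -> G,
  [/\ contraction B, symmetric_op B, positive_op B, contraction C
    & symmetric_op C] /\
  [/\ forall h, odom T (B h) /\ T (B h) = C h,
      forall h, odom T (C h) /\ B h + T (C h) = h,
      commutes B C, forall h, B h = 0 -> h = 0
    & forall y w, (odom T y /\ T y = w) <-> C y = B w].
Proof.
have [B hB] := choice sa_resolvent.
have dB h : odom T (B h) by case: (hB h).
have dTB h : odom T (T (B h)) by case: (hB h).
have BE h : B h + T (T (B h)) = h by case: (hB h).
have sD := sa_subspace; have sL := sa_linear.
pose C h := T (B h).
have BU h x : odom T x -> odom T (T x) -> x + T (T x) = h -> B h = x.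
  by move=> dx ddx e; apply: sa_resolvent_unique => //; rewrite BE.
have linB a x y : B (a *: x + y) = a *: B x + B y.
  apply: BU; rewrite ?sL ?sL//; try by case: sD => _; apply.
  by rewrite addrACA -scalerDr !BE.
have linC a x y : C (a *: x + y) = a *: C x + C y by rewrite /C linB sL.
have energy h : rdot h (B h) = sqn (B h) + sqn (C h).
  by rewrite -{1}(BE h) rdotDl sa_symmetric.
have energy_le h : sqn (B h) + sqn (C h) <= sqn h.
  have := energy h; have := sqn_ge0 (h - B h); rewrite sqnB.
  have := sqn_ge0 (C h); lra.
have symB : symmetric_op B.
  move=> x y; rewrite -{2}(BE x) -{1}(BE y) rdotDl rdotDr.
  by rewrite -sa_symmetric// [in RHS]sa_symmetric.
(* Applying T to [B y + T (T (B y)) = y] shows that [T (B y)] solves the resolvent equation for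
   [T y]. *)
have BT y : odom T y -> odom T (T (B y)) /\ B (T y) = T (B y).
  move=> dy; split=> //; apply: BU => //.
    have -> : T (T (B y)) = y - B y by rewrite -{2}(BE y) addrAC subrr add0r.
    exact: subspaceB.
  have dd : odom T (T (T (B y))).
    have -> : T (T (B y)) = y - B y by rewrite -{2}(BE y) addrAC subrr add0r.
    exact: subspaceB.
  by rewrite -(linear_onD sL)// BE.
have symC : symmetric_op C.
  move=> x y; rewrite /C -{2}(BE x) -{1}(BE y) rdotDl rdotDr.
  by rewrite sa_symmetric// -(sa_symmetric (dTB x)).
(* From [C y = B w] follows [y = B y + C w], whose terms lie in the domain, and then
   [T y = B w + T (C w) = w]. The graph of T is thus expressed by bounded operators, so whatever
   commutes with B and C preserves it. *)
have graph y w : (odom T y /\ T y = w) <-> C y = B w.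
  split=> [[dy <-]|e]; first by rewrite (BT _ dy).2.
  have ey : y = B y + C w by rewrite -{1}(BE y) -[T (B y)]/(C y) e.
  have dy : odom T y by rewrite ey; exact: (subspaceD sD (dB y) (dTB w)).
  split=> //; rewrite ey; apply: etrans (linear_onD sL (dB y) (dTB w)) _.
  by apply: etrans (congr1 (+%R^~ _) e) _; exact: BE.
exists B, C; split.
  split=> //.
  - by split=> // x; have := energy_le x; have := sqn_ge0 (C x); lra.
  - by move=> x; rewrite rdotC energy addr_ge0 ?sqn_ge0.
  - by split=> // x; have := energy_le x; have := sqn_ge0 (B x); lra.
split; [by []|by move=> h; split; [exact: dTB|exact: BE]| | |exact: graph].
  by move=> h; exact: (BT _ (dB h)).2.
by move=> h Bh; rewrite -(BE h) Bh !(linear_on0 sD sL) addr0.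
Qed.

End SelfAdjoint.

Section AbsoluteValue.
Variables (R : realType) (G : hilbertType R).
Implicit Types S T : G -> G.

Lemma absolute_value S : contraction S -> symmetric_op S -> exists W : G -> G,
  [/\ contraction W, symmetric_op W, positive_op W,
      forall x, W (W x) = S (S x)
    & forall T, contraction T -> commutes T S -> commutes T W].
Proof.
move=> [linS cS] sS; have [||x|W [h1 h2 h3 h4 h5]] := @positive_sqrt _ _ (S \o S).
- by split=> [a x y|x]/=; rewrite ?linS//; apply: le_trans (cS _) (cS _).
- by move=> x y /=; rewrite !sS.
- by rewrite /= sS; exact: sqn_ge0.
exists W; split=> // T cT TS; apply: h5 => // x /=.
by rewrite !TS.
Qed.

(** With W the square root of S, the product equals [rdot (T (W x)) (W x)]. *)
Lemma positive_product S T : contraction S -> symmetric_op S -> positive_op S ->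
  contraction T -> positive_op T -> commutes T S ->
  forall x, 0 <= rdot (T x) (S x).
Proof.
move=> cS sS pS cT pT TS x.
have [W [cW sW _ WW comm]] := positive_sqrt cS sS pS.
by rewrite -WW -sW -(comm T).
Qed.

End AbsoluteValue.

(** * The spectral resolution of a self-adjoint operator *)

Section Projections.
Variables (R : realType) (G : hilbertType R).
Implicit Types (M D : set G) (x y z : G).

(** In the last clause, [rdot (T x - T (P x)) z = rdot (x - P x) (T z)] vanishes for z in M, so T
    also preserves the orthogonal complement. *)
Lemma orthogonal_projection M : subspace M ->
  (forall (u : nat -> G) v, (forall n, M (u n)) -> u @ \oo --> v -> M v) ->
  exists P : G -> G,
    [/\ contraction P, symmetric_op P, forall x, M (P x),
        forall x, M x -> P x = x
      & forall T, (forall a x y, T (a *: x + y) = a *: T x + T y) ->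
          symmetric_op T -> (forall x, M x -> M (T x)) -> commutes T P].
Proof.
move=> sM cM.
have lin_id : linear_on M (@id G) by [].
have lin_0 : linear_on M (fun _ => 0 : G) by move=> a x y _ _; rewrite scaler0 addr0.
have ex h : exists x, M x /\ forall z, M z -> rdot (h - x) z = 0.
  have [|x dx hx] := least_squares sM lin_id lin_0 h.
    move=> u v w du uv uw; exists v; split=> //; first exact: cM uv.
    by apply: hcvg_unique uw; exact: cvg_cst.
  by exists x; split=> // z /hx ->; rewrite rdot0l.
have [P hP] := choice ex.
have MP x : M (P x) by case: (hP x).
have PP x z : M z -> rdot (x - P x) z = 0 by case: (hP x) => _; apply.
have U x y : M y -> (forall z, M z -> rdot (x - y) z = 0) -> P x = y.
  move=> My h; apply/eqP; rewrite -subr_eq0; apply/eqP/sqn_eq0.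
  have d : M (P x - y) by exact: subspaceB.
  have -> : sqn (P x - y) = rdot (x - y) (P x - y) - rdot (x - P x) (P x - y).
    by rewrite -rdotBl opprB [x - y + _]addrC addrA subrK.
  by rewrite h// PP// subrr.
have linP a x y : P (a *: x + y) = a *: P x + P y.
  apply: U => [|z Mz]; first by have [_] := sM; apply.
  rewrite opprD addrACA -scalerBr rdotDl (PP y)// addr0.
  rewrite (complexE a) scalerDl rdotDl rdotZl PP// mulr0 add0r mulrC -scalerA.
  by rewrite rdotZl rdotiN PP ?oppr0 ?mulr0//; exact: subspaceZ.
have sP x y : rdot (P x) y = rdot (P x) (P y).
  by apply/eqP; rewrite -subr_eq0 -rdotBr rdotC PP.
exists P; split=> //.
- split=> // x; have := sqn_ge0 (x - P x); rewrite sqnB rdotC sP -/(sqn _); lra.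
- by move=> x y; rewrite sP [RHS]rdotC (sP y x) rdotC.
- by move=> x Mx; apply: U => // z Mz; rewrite subrr rdot0l.
- move=> T linT sT MT x; apply/esym; apply: U => [|z Mz]; first exact: MT.
  by rewrite -(linB linT) sT PP//; exact: MT.
Qed.

(** With P the projection onto the closure M of D, [y - P y] is orthogonal to D, hence by hypothesis
    to y, and so it is zero. *)
Lemma dense_orthogonal D y : subspace D ->
  (forall z, (forall d, D d -> rdot d z = 0) -> rdot y z = 0) ->
  exists2 u : nat -> G, (forall n, D (u n)) & u @ \oo --> y.
Proof.
move=> sD hy; pose M := [set x | forall e : R, 0 < e -> exists2 d, D d & sqn (x - d) < e].
have sM : subspace M.
  split=> [e e0|a x1 x2 m1 m2 e e0].
    by exists 0; [exact: subspace0|rewrite subrr sqn0].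
  pose k := 2 * (complex.Re a ^+ 2 + complex.Im a ^+ 2) + 1.
  have k0 : 0 < k.
    by rewrite /k; have := sqr_ge0 (complex.Re a); have := sqr_ge0 (complex.Im a); lra.
  have ek : 0 < e / k / 2 by rewrite !divr_gt0.
  have e4 : 0 < e / 4 by rewrite divr_gt0.
  have [[d1 D1 h1] [d2 D2 h2]] := (m1 _ ek, m2 _ e4).
  exists (a *: d1 + d2); first by have [_] := sD; apply.
  rewrite opprD addrACA -scalerBr; apply: le_lt_trans (sqnD_le _ _) _.
  rewrite sqnZc; have := sqn_ge0 (x1 - d1); move: h1.
  rewrite ltr_pdivlMr// ltr_pdivlMr// /k; move: h2.
  by move: (_ + complex.Im a ^+ 2) (sqn _) (sqn _) => K s1 s2; lra.
have cM (u : nat -> G) v : (forall n, M (u n)) -> u @ \oo --> v -> M v.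
  move=> Mu /cvg_rnormP h e e0; have e4 : 0 < e / 4 by rewrite divr_gt0.
  have [N _ hN] := h _ e4; have [d Dd dN] := Mu N _ e4; exists d => //.
  have := hN N (leqnn N); rewrite /= sqnBC => hv.
  rewrite -(subrK (u N) v) -addrA.
  by apply: le_lt_trans (sqnD_le _ _) _; lra.
have [P [cP sP MP PM _]] := orthogonal_projection sM cM.
have PMz x z : M z -> rdot (x - P x) z = 0.
  by move=> Mz; rewrite -(PM _ Mz) -sP (linB cP.1) (PM _ (MP x)) subrr rdot0l.
have MD d : D d -> M d by move=> Dd e e0; exists d; rewrite ?subrr ?sqn0.
have : sqn (y - P y) = 0.
  rewrite /sqn {1}rdotBl hy ?sub0r.
    by rewrite rdotC PMz ?oppr0//; exact: MP.
  by move=> d Dd; rewrite rdotC PMz//; exact: MD.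
move=> /sqn_eq0/eqP; rewrite subr_eq0 => /eqP yP.
have ex n : exists d, D d /\ sqn (y - d) < n.+1%:R^-1.
  have n0 : 0 < n.+1%:R^-1 :> R by rewrite invr_gt0.
  by have := MP y; rewrite -yP => /(_ _ n0)[d]; exists d.
have [u hu] := choice ex; exists u => [n|]; first by case: (hu n).
apply/cvg_rnormP => e e0.
have [N _ hN] := near_infty_natSinv_lt (PosNum e0).
exists N => // n Nn; have [_ h] := hu n; rewrite /= sqnBC.
exact: lt_trans h (hN _ Nn).
Qed.

End Projections.

Section SpectralFamily.
Variables (R : realType) (G : hilbertType R) (B C : G -> G).
Hypotheses (cB : contraction B) (sB : symmetric_op B) (pB : positive_op B).
Hypotheses (cC : contraction C) (sC : symmetric_op C) (BC : commutes B C).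
Hypothesis injB : forall x, B x = 0 -> x = 0.
Implicit Types (x y z : G) (s t : R).

(** Informally [(T - t) B], which has the sign of T - t; dividing by [1 + |t|] makes it a
    contraction. *)
Let S t x := (1 + `|t|)^-1%:C *: (C x - t%:C *: B x).

Let t1 t : 0 < 1 + `|t|. Proof. by rewrite ltr_pwDl. Qed.

Let SE t x : C x - t%:C *: B x = (1 + `|t|)%:C *: S t x.
Proof. by rewrite /S scalerA -rmorphM divff ?scale1r// gt_eqF. Qed.

Let cS t : contraction (S t).
Proof.
split=> [a x y|x].
  rewrite /S cB.1 cC.1 [t%:C *: (_ + _)]scalerDr opprD addrACA [t%:C *: (a *: _)]scalerA.
  rewrite [t%:C * a]mulrC -scalerA -scalerBr scalerDr; congr (_ + _).
  by rewrite !scalerA mulrC.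
rewrite /S sqnZ exprVn mulrC ler_pdivrMr ?exprn_gt0// sqnB sqnZ rdotZr.
have := @rdot_le _ _ 1 (C x) (B x) ltr01; rewrite invr1 !mul1r => h.
have h1 := cC.2 x; have h2 := cB.2 x.
have h3 : - (2 * (t * rdot (C x) (B x))) <= `|t| * (2 * `|rdot (C x) (B x)|).
  by apply: le_trans (ler_norm _) _; rewrite normrN !normrM (ger0_norm (ler0n _ 2)) mulrCA.
have h4 : t ^+ 2 * sqn (B x) <= t ^+ 2 * sqn x by rewrite ler_wpM2l ?sqr_ge0.
have := normr_ge0 t; rewrite -(real_normK (num_real t)) in h4 *.
nra.
Qed.

Let sS t : symmetric_op (S t).
Proof. by move=> x y; rewrite /S rdotZl rdotZr rdotBl rdotBr rdotZl rdotZr sC sB. Qed.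

Let SB t : commutes B (S t).
Proof. by move=> x; rewrite /S (linZ cB.1) (linB cB.1) (linZ cB.1) BC. Qed.

Let commS V t : contraction V -> commutes V B -> commutes V C -> commutes V (S t).
Proof.
by move=> cV VB VC x; rewrite /S (linZ cV.1) (linB cV.1) (linZ cV.1) VB VC.
Qed.

(** In the construction, [W t] is the absolute value of [S t] and [E t] projects onto the kernel of
    [W t + S t], the part where T <= t. By the last clause this part contains the kernel of [S t],
    and that makes the family continuous from the right. *)
Definition spectral_family (W E : R -> G -> G) :=
  [/\ forall t, [/\ contraction (W t), symmetric_op (W t) & positive_op (W t)],
      forall t, [/\ contraction (E t) , symmetric_op (E t)
                  & forall x, E t (E t x) = E t x],
      forall V t, contraction V -> symmetric_op V -> commutes V B ->
        commutes V C -> commutes V (W t) /\ commutes V (E t),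
      forall t x, E t x = x -> t%:C *: B x - C x = (1 + `|t|)%:C *: W t x
    & forall t x, E t x = 0 -> C x - t%:C *: B x = (1 + `|t|)%:C *: W t x] /\
  [/\ forall s t, commutes (W s) (W t), forall s t, commutes (E s) (E t)
    & forall t x, C x = t%:C *: B x -> E t x = x].

Lemma spectral_family_exists : exists W E, spectral_family W E.
Proof.
have [W hW] := choice (fun t => absolute_value (cS t) (sS t)).
have cW t : contraction (W t) by case: (hW t).
have sW t : symmetric_op (W t) by case: (hW t).
have pW t : positive_op (W t) by case: (hW t).
have WW t x : W t (W t x) = S t (S t x) by case: (hW t).
have commW t V : contraction V -> commutes V (S t) -> commutes V (W t).
  by case: (hW t) => _ _ _ _; apply.
pose M t := [set x | W t x + S t x = 0].
have sM t : subspace (M t).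
  rewrite /M; split=> [|a x y] /=; first by rewrite (lin0 (cW t).1) (lin0 (cS t).1) addr0.
  by move=> hx hy; rewrite (cW t).1 (cS t).1 addrACA -scalerDr hx hy scaler0 addr0.
have cM t (u : nat -> G) v : (forall n, M t (u n)) -> u @ \oo --> v -> M t v.
  move=> Mu uv.
  have h : (W t \o u) + (S t \o u) @ \oo --> W t v + S t v.
    by apply: cvgD; exact: contraction_cvg.
  apply: hcvg_unique h _; rewrite (_ : _ + _ = fun=> 0); first exact: cvg_cst.
  by apply/funext => n; exact: Mu.
have [E hE] := choice (fun t => orthogonal_projection (sM t) (cM t)).
have cE t : contraction (E t) by case: (hE t).
have sE t : symmetric_op (E t) by case: (hE t).
have ME t x : M t (E t x) by case: (hE t).
have EM t x : M t x -> E t x = x by case: (hE t) => _ _ _ + _; apply.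
have commE t V : contraction V -> symmetric_op V -> commutes V B ->
    commutes V C -> commutes V (W t) /\ commutes V (E t).
  move=> cV sV VB VC; have VS : commutes V (S t) by exact: commS.
  have VW : commutes V (W t) by exact: commW.
  split=> //; case: (hE t) => _ _ _ _; apply=> // [|x]; first exact: cV.1.
  by rewrite /M /= -VW -VS -(linD cV.1) => ->; exact: lin0 cV.1.
have CB : commutes C B by move=> x; rewrite BC.
have [WB WC] : (forall t, commutes (W t) B) /\ (forall t, commutes (W t) C).
  split=> t x; apply/esym.
    by case: (@commE t B) => //; apply.
  by case: (@commE t C) => //; apply.
have [EB EC] : (forall t, commutes (E t) B) /\ (forall t, commutes (E t) C).
  split=> t x; apply/esym.
    by case: (@commE t B) => //; apply.
  by case: (@commE t C) => //; apply.
have WS t : commutes (W t) (S t) by exact: commS.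
have EE t x : E t (E t x) = E t x by rewrite EM.
exists W, E; split; split.
- by [].
- by [].
- by move=> V t; exact: commE.
- move=> t x Ex; have := ME t x; rewrite Ex /M /= => /eqP.
  by rewrite addr_eq0 -opprB SE => /eqP ->; rewrite scalerN.
- move=> t x Ex; rewrite SE; congr (_ *: _).
  (* Since (W + S)(S - W) = S^2 - W^2 = 0, [E t] fixes this vector; but [E t] commutes with [S t]
     and [W t] and kills x, so the vector is zero. *)
  have : M t (S t x - W t x).
    rewrite /M /= (linB (cW t).1) (linB (cS t).1) WW WS.
    by rewrite addrA subrK subrr.
  move=> /EM; rewrite (linB (cE t).1).
  rewrite (commS t (cE t) (EB t) (EC t)) (commE t _ (cE t) (sE t) (EB t) (EC t)).1.
  rewrite Ex (lin0 (cS t).1) (lin0 (cW t).1) subrr => /esym/eqP.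
  by rewrite subr_eq0 => /eqP.
- by move=> s t; case: (@commE t (W s)).
- by move=> s t; case: (@commE t (E s)).
- move=> t x Cx; apply: EM; rewrite /M /= /S Cx subrr scaler0 addr0.
  apply: sqn_eq0; rewrite /sqn sW WW /S Cx subrr scaler0 -/(S t 0).
  by rewrite (lin0 (cS t).1) rdot0r.
Qed.

End SpectralFamily.

Section SpectralResolution.
Variables (R : realType) (G : hilbertType R).
Implicit Types (x y z : G) (s t a b : R).

Lemma symmetric_hdot (P : G -> G) :
  (forall k x y, P (k *: x + y) = k *: P x + P y) -> symmetric_op P ->
  forall x y, '[P x, y] = '[x, P y].
Proof.
by move=> linP sP x y; rewrite !hdotE -(linZ linP) !sP.
Qed.

Section Family.
Variables B C : G -> G.
Hypotheses (cB : contraction B) (sB : symmetric_op B) (pB : positive_op B).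
Hypotheses (cC : contraction C) (sC : symmetric_op C) (BC : commutes B C).
Hypothesis injB : forall x, B x = 0 -> x = 0.
Variables W E : R -> G -> G.
Hypothesis hWE : spectral_family B C W E.

Let cE t : contraction (E t). Proof. by case: hWE => -[_ /(_ t)[]]. Qed.
Let sE t : symmetric_op (E t). Proof. by case: hWE => -[_ /(_ t)[]]. Qed.
Let EE t x : E t (E t x) = E t x. Proof. by case: hWE => -[_ /(_ t)[]]. Qed.
Let pW t : positive_op (W t). Proof. by case: hWE => -[/(_ t)[]]. Qed.
Let commE s t x : E s (E t x) = E t (E s x).
Proof. by case: hWE => _ [_ h _]; exact: h. Qed.

Lemma family_le t x : E t x = x -> rdot (C x) x <= t * rdot (B x) x.
Proof.
case: hWE => -[_ _ _ h _] _ /h/(congr1 (fun u => rdot u x)).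
rewrite rdotBl !rdotZl; have := mulr_ge0 (addr_ge0 ler01 (normr_ge0 t)) (pW t x).
lra.
Qed.

Lemma family_ge t x : E t x = 0 -> t * rdot (B x) x <= rdot (C x) x.
Proof.
case: hWE => -[_ _ _ _ h] _ /h/(congr1 (fun u => rdot u x)).
rewrite rdotBl !rdotZl; have := mulr_ge0 (addr_ge0 ler01 (normr_ge0 t)) (pW t x).
lra.
Qed.

Let B0 x : rdot (B x) x <= 0 -> x = 0.
Proof.
move=> h; apply: injB; apply: sqn_le0.
exact: le_trans (positive_contraction cB sB pB x) h.
Qed.

(** For s < t, the vector [y = E s (x - E t x)] is fixed by [E s] and killed by [E t], so
    [t <B y, y> <= <C y, y> <= s <B y, y>] and y = 0. *)
Lemma family_mul s t x : s <= t -> E s (E t x) = E s x.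
Proof.
rewrite le_eqVlt => /predU1P[->//|st].
suff h : E s (x - E t x) = 0.
  by apply/esym/eqP; rewrite -subr_eq0 -(linB (cE s).1) h.
set y := E s _; have ys : E s y = y by exact: EE.
have yt : E t y = 0.
  by rewrite /y -commE (linB (cE t).1) EE subrr (lin0 (cE s).1).
apply: B0; have := family_le ys; have := family_ge yt.
have : 0 < t - s by rewrite subr_gt0.
move: (rdot (B y) y) => r; nra.
Qed.

Let mulr' s t x : s <= t -> E t (E s x) = E s x.
Proof. by move=> st; rewrite commE family_mul. Qed.

Let sqnE s t x : s <= t -> sqn (E t x - E s x) = sqn (E t x) - sqn (E s x).
Proof.
move=> st; have e : rdot (E t x) (E s x) = sqn (E s x).
  by rewrite sE mulr'// -{1}EE -sE.
by rewrite sqnB e; ring.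
Qed.

Let sqnE_le s t x : s <= t -> sqn (E s x) <= sqn (E t x).
Proof. by move=> st; rewrite -subr_ge0 -sqnE// sqn_ge0. Qed.

(** Along t + 1/(n+1) the differences tend to a vector v with [E t v = 0] and [E s v = v] for all s
    > t. The two form bounds give [<C v, v> = t <B v, v>], so [W t v = 0] and [C v = t B v]; then
    [E t] fixes v, and v = 0. *)
Lemma family_right t x : E s x @[s --> t^'+] --> E t x.
Proof.
pose r (n : nat) := t + n.+1%:R^-1.
have rt n : t < r n by rewrite ltrDl invr_gt0.
have rle n k : (n <= k)%N -> r k <= r n.
  by move=> nk; rewrite lerD2l lef_pV2 ?posrE// ler_nat ltnS.
have [v hv] : exists v : G, (fun n => E t x - E (r n) x) @ \oo --> v.
  apply: (@monotone_cauchy _ _ _ (fun n => - sqn (E (r n) x)) 0) => [n k nk|n].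
    rewrite opprB addrC addrA subrK sqnE ?rle//; lra.
  by rewrite oppr_le0 sqn_ge0.
have Et : E t v = 0.
  apply: hcvg_unique (contraction_cvg (cE t) hv) _.
  rewrite (_ : _ \o _ = fun=> 0); first exact: cvg_cst.
  by apply/funext => n /=; rewrite (linB (cE t).1) EE family_mul ?subrr// ltW.
have Es s : t < s -> E s v = v.
  move=> ts; apply: hcvg_unique (contraction_cvg (cE s) hv) _.
  have st : 0 < s - t by rewrite subr_gt0.
  have [N _ hN] := near_infty_natSinv_lt (PosNum st).
  apply: cvg_trans hv; apply: near_eq_cvg; exists N => // n Nn /=.
  have := hN _ Nn; rewrite /= => h; rewrite (linB (cE s).1) !mulr' ?(ltW ts)//.
  by rewrite /r -lerBrDl ltW.
have v0 : v = 0.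
  have h1 := family_ge Et.
  have h2 : rdot (C v) v <= t * rdot (B v) v.
    rewrite leNgt; apply/negP => h.
    have [b0|b0] := lerP (rdot (B v) v) 0.
      by move: h; rewrite (B0 b0) (lin0 cC.1) (lin0 cB.1) !rdot0l mulr0 ltxx.
    pose s := (rdot (C v) v / rdot (B v) v + t) / 2.
    have q : t < rdot (C v) v / rdot (B v) v by rewrite ltr_pdivlMr.
    have ts : t < s by rewrite /s; lra.
    have := family_le (Es _ ts); rewrite -ler_pdivrMr// /s; lra.
  have := h1; case: hWE => -[hW _ _ _ h] [_ _ h0].
  have e := h _ _ Et; have [cW sW pW'] := hW t.
  have : rdot (W t v) v = 0.
    have k0 : 0 < 1 + `|t| by rewrite ltr_pwDl.
    have := congr1 (fun u => rdot u v) e; rewrite rdotBl !rdotZl => e1.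
    have : (1 + `|t|) * rdot (W t v) v <= 0 by lra.
    by rewrite pmulr_rle0// => w0; apply/eqP; rewrite eq_le w0 pW'.
  have := positive_contraction cW sW pW' v => + w0 _; rewrite w0 => /sqn_le0 Wv.
  rewrite -Et; apply/esym/h0/eqP.
  by rewrite -subr_eq0 e Wv scaler0.
rewrite v0 in hv; apply/cvg_rnormP => e e0.
have /cvg_rnormP/(_ _ e0)[N _ hN] := hv.
have := hN N (leqnn N); rewrite /= subr0 sqnBC => h.
near=> s; apply: le_lt_trans h.
have ts : t <= s by apply: ltW; near: s; exact: nbhs_right_gt.
rewrite !sqnE ?(ltW (rt _))// lerD2r; apply: sqnE_le.
by near: s; apply: nbhs_right_le; exact: rt.
Unshelve. all: by end_near. Qed.

(** Serves both limits at infinity: a vector supported where |T| >= n for every n is zero. *)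
Let bound0 v : (forall n : nat, n%:R * rdot (B v) v <= `|rdot (C v) v|) -> v = 0.
Proof.
move=> h; apply: B0; rewrite leNgt; apply/negP => b0.
have := h (Num.bound (`|rdot (C v) v| / rdot (B v) v)).
rewrite leNgt => /negP; apply; rewrite -ltr_pdivrMr//.
by rewrite (lt_le_trans (archi_boundP _))// divr_ge0// ltW.
Qed.

Lemma family_ninfty x : E s x @[s --> -oo] --> (0 : G).
Proof.
pose r (n : nat) : R := - n%:R.
have rle n k : (n <= k)%N -> r k <= r n by move=> nk; rewrite lerN2 ler_nat.
have [v hv] : exists v : G, (fun n => E (r n) x) @ \oo --> v.
  apply: (@monotone_cauchy _ _ _ (fun n => - sqn (E (r n) x)) 0) => [n k nk|n].
    rewrite sqnBC sqnE ?rle//; lra.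
  by rewrite oppr_le0 sqn_ge0.
have Es n : E (r n) v = v.
  apply: hcvg_unique (contraction_cvg (cE _) hv) _.
  apply: cvg_trans hv; apply: near_eq_cvg; exists n => // k nk /=.
  by rewrite mulr'// rle.
have v0 : v = 0.
  apply: bound0 => n; have := family_le (Es n); rewrite /r mulNr.
  by have := ler_norm (- rdot (C v) v); rewrite normrN; lra.
rewrite v0 in hv; apply/cvg_rnormP => e e0.
have /cvg_rnormP/(_ _ e0)[N _ hN] := hv.
have := hN N (leqnn N); rewrite /= subr0 => h.
near=> s; rewrite subr0; apply: le_lt_trans h; apply: sqnE_le.
by near: s; exact: nbhs_ninfty_le (num_real _).
Unshelve. all: by end_near. Qed.

Lemma family_pinfty x : E s x @[s --> +oo] --> x.
Proof.
pose r (n : nat) : R := n%:R.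
have rle n k : (n <= k)%N -> r n <= r k by move=> nk; rewrite ler_nat.
have [v hv] : exists v : G, (fun n => x - E (r n) x) @ \oo --> v.
  apply: (@monotone_cauchy _ _ _ (fun n => sqn (E (r n) x)) (sqn x)) => [n k nk|n].
    by rewrite opprB addrC addrA subrK sqnBC sqnE ?rle.
  exact: (cE _).2.
have Es n : E (r n) v = 0.
  apply: hcvg_unique (contraction_cvg (cE _) hv) _.
  apply: cvg_near_cst; exists n => // k nk /=.
  by rewrite (linB (cE _).1) family_mul ?rle// subrr.
have v0 : v = 0.
  apply: bound0 => n; have := family_ge (Es n); rewrite /r.
  by have := ler_norm (rdot (C v) v); lra.
rewrite v0 in hv; apply/cvg_rnormP => e e0.
have /cvg_rnormP/(_ _ e0)[N _ hN] := hv.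
have := hN N (leqnn N); rewrite /= subr0 => h.
near=> s; rewrite sqnBC; apply: le_lt_trans h.
have Ns : r N <= s by near: s; exact: nbhs_pinfty_ge (num_real _).
have e1 t : sqn (x - E t x) = sqn x - sqn (E t x).
  by rewrite sqnB -[in rdot _ _]EE -sE -/(sqn _); ring.
by rewrite !e1 lerD2l lerN2 sqnE_le.
Unshelve. all: by end_near. Qed.

Lemma family_resolution : exists F : resolution G, forall t x, F t x = E t x.
Proof.
have lE t : linear (E t) by move=> a x y; exact: (cE t).1.
have syE t : forall x y, '[E t x, y] = '[x, E t y].
  exact: symmetric_hdot (cE t).1 (sE t).
have mE s t x : E s (E t x) = E (Num.min s t) x.
  by have [st|/ltW ts] := leP s t; [exact: family_mul|exact: mulr'].
by exists (Resolution lE syE mE family_right family_ninfty family_pinfty).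
Qed.

End Family.

(** The bound around the midpoint is proved on vectors [B w] with w in the range of [E b - E a],
    where T is given by C, and extended by density and closedness of T. *)
Lemma spectral_resolution_exists (T : operator G) : self_adjoint T ->
  exists E : resolution G,
    (forall t x, odom T x -> odom T (E t x) /\ T (E t x) = E t (T x)) /\
    (forall a b x, a <= b -> E a x = 0 -> E b x = x ->
      odom T x /\
      sqn (T x - ((a + b) / 2)%:C *: x) <= ((b - a) / 2) ^+ 2 * sqn x).
Proof.
move=> hT; have [B [C [[cB sB pB cC sC] [TB TC BC injB graph]]]] := sa_bounded hT.
have [W [E hWE]] := spectral_family_exists cB sB cC sC BC.
have [F FE] := family_resolution cB sB pB cC injB hWE.
have sD := sa_subspace hT; have sL := sa_linear hT.
have CB : commutes C B by move=> x; rewrite BC.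
have [hW hE comm h1 h2] := hWE.1; have [WW EE _] := hWE.2.
have EB t : commutes (E t) B.
  by move=> x; have [_ ->] := comm B t cB sB (fun=> erefl) BC.
have EC t : commutes (E t) C.
  by move=> x; have [_ ->] := comm C t cC sC CB (fun=> erefl).
have cE t : contraction (E t) by case: (hE t).
exists F; split=> [t x dx|a b x ab]; rewrite !FE.
  have [/(_ (conj dx erefl)) e _] := graph x (T x).
  by apply/graph; rewrite -EC e EB.
move=> Ea Eb; set m := (a + b) / 2; set d := (b - a) / 2.
have est w : E a w = 0 -> E b w = w ->
    sqn (T (B w) - m%:C *: B w) <= d ^+ 2 * sqn (B w).
  move=> aw bw; have e1 := h2 _ _ aw; have e2 := h1 _ _ bw.
  have [cWa sWa pWa] := hW a; have [cWb sWb pWb] := hW b.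
  (* This is (b - T)(T - a) >= 0: the factors are multiples of the commuting positive operators
     [W b] and [W a]. As [m ^+ 2 - d ^+ 2 = a b], expanding it gives the estimate. *)
  have : 0 <= rdot (b%:C *: B w - C w) (C w - a%:C *: B w).
    rewrite e1 e2 rdotZl rdotZr !mulr_ge0 ?addr_ge0//.
    exact: (positive_product cWa sWa pWa cWb pWb (WW b a)).
  rewrite (TB w).2 sqnB sqnZ rdotZr !(rdotBl, rdotBr, rdotZl, rdotZr) -!/(sqn _).
  rewrite (rdotC (B w)) /m /d; lra.
(* If z is orthogonal to the image under B of the slab, with projection P, then
   [<B (P z), P z> = 0]; injectivity of B gives [P z = 0], and z is orthogonal to [x = P x]. *)
have [u Du ux] : exists2 u : nat -> G,
    (forall n, exists w, [/\ E a w = 0, E b w = w & u n = B w]) & u @ \oo --> x.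
  apply: (@dense_orthogonal _ _ [set y | exists w, [/\ E a w = 0, E b w = w & y = B w]]).
    split=> [|k y z [w [w1 w2 ->]] [w' [w1' w2' ->]]] /=.
      by exists 0; rewrite (lin0 (cE _).1) (lin0 (cE _).1) (lin0 cB.1).
    exists (k *: w + w'); rewrite !(cE _).1 w1 w1' w2 w2' cB.1.
    by rewrite scaler0 addr0.
  move=> z hz; pose P y := E b y - E a y.
  have aP y : E a (P y) = 0.
    rewrite (linB (cE a).1) -!FE !rproj_mul minxx (min_idPl ab).
    by rewrite subrr.
  have bP y : E b (P y) = P y.
    by rewrite /P (linB (cE b).1) -!FE !rproj_mul minxx (min_idPr ab).
  have sP : symmetric_op P.
    by move=> y y'; rewrite /P rdotBl rdotBr; case: (hE a) => _ -> _; case: (hE b) => _ -> _.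
  have PB : commutes P B by move=> y; rewrite /P EB EB (linB cB.1).
  have PP y : P (P y) = P y by rewrite {1}/P aP bP subr0.
  have Pz0 : P z = 0.
    apply: injB; apply: sqn_le0; apply: le_trans (positive_contraction cB sB pB _) _.
    by rewrite -sP PB PP hz//; exists (P z).
  have Px : P x = x by rewrite /P Ea Eb subr0.
  by rewrite -Px sP Pz0 rdot0r.
have Dsub n k : exists w, [/\ E a w = 0, E b w = w & u n - u k = B w].
  have [w [w1 w2 ->]] := Du n; have [w' [w1' w2' ->]] := Du k.
  exists (w - w'); rewrite !(linB (cE _).1) w1 w1' w2 w2' (linB cB.1).
  by rewrite subrr.
have dT n : odom T (u n) by have [w [_ _ ->]] := Du n; case: (TB w).
have [v Tuv] : exists v : G, (fun n => T (u n)) @ \oo --> v.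
  pose K := 2 * (d ^+ 2 + m ^+ 2) + 1.
  have K0 : 0 < K by rewrite /K; have := sqr_ge0 d; have := sqr_ge0 m; lra.
  apply: (@sqn_cauchy _ _ (fun n => T (u n))) => e e0.
  have e4 : 0 < e / K / 4 by rewrite !divr_gt0.
  have /cvg_rnormP/(_ _ e4)[N _ hN] := ux; exists N => n k Nn Nk.
  rewrite -(linear_onB sD sL)//.
  have le : sqn (u n - u k) < e / K.
    rewrite -(subrKA x) -(opprB (u k) x); apply: le_lt_trans (sqnB_le _ _) _.
    by have := hN _ Nn; have := hN _ Nk; rewrite /=; lra.
  have [w [w1 w2 wE]] := Dsub n k; move: le; rewrite wE ltr_pdivlMr// => le.
  have := est _ w1 w2; rewrite -[T (B w)](subrK (m%:C *: B w)) addrK => h.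
  apply: le_lt_trans (sqnD_le _ _) _; rewrite sqnZ; apply: le_lt_trans _ le.
  by rewrite /K; have := sqn_ge0 (B w); lra.
have [dx Tx] : odom T x /\ T x = v by exact: (sa_closed hT dT ux Tuv).
split=> //; rewrite Tx.
have c1 : (fun n => sqn (T (u n) - m%:C *: u n)) @ \oo --> sqn (v - m%:C *: x).
  by apply: cvg_sqn; apply: cvgB => //; exact: cvgZl_tmp.
have c2 : (fun n => d ^+ 2 * sqn (u n)) @ \oo --> d ^+ 2 * sqn x.
  by apply: cvgMl_tmp; exact: cvg_sqn.
apply: ler_cvg_to c1 c2 _; apply: nearW => n.
by have [w [w1 w2 ->]] := Du n; exact: est.
Qed.

End SpectralResolution.

(** * Densities with respect to a resolution of the identity *)

Section IntervalFunctions.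
Variable R : realType.
Implicit Types (a b c s t : R) (F : R -> R -> R) (nu : R -> R).

(* A tagged-partition (Cousin) argument, phrased with suprema. *)
Lemma additive_interval_eq0 F nu a b : {homo nu : s t / s <= t} ->
  (forall s t, a <= s -> s <= t -> t <= b -> F a t = F a s + F s t) -> a <= b ->
  (forall t, a <= t <= b -> forall e, 0 < e -> exists2 d, 0 < d &
     forall a' b', a <= a' -> b' <= b -> `|a' - t| < d -> `|b' - t| < d ->
       a' <= b' -> `|F a' b'| <= e * (nu b' - nu a')) ->
  F a b = 0.
Proof.
move=> nd add ab loc.
have Faa : F a a = 0.
  by have /eqP := add a a (lexx _) (lexx _) ab; rewrite -subr_eq0 opprD addNKr oppr_eq0 => /eqP.
have key e : 0 < e -> `|F a b| <= e * (nu b - nu a).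
  move=> e0; pose S := [set s | a <= s <= b /\ `|F a s| <= e * (nu s - nu a)].
  have Sa : S a by split; rewrite ?lexx ?ab// Faa normr0 subrr mulr0.
  have hS : has_sup S by split; [exists a|exists b => s [/andP[]]].
  set m := sup S.
  have am : a <= m by apply: sup_ubound => //; case: hS.
  have mb : m <= b by apply: ge_sup => //; [exists a|move=> s [/andP[]]].
  have [|d d0 hd] := loc m _ e e0; first by rewrite am mb.
  have [s [/andP[sa sb] hs] ms] := sup_adherent d0 hS.
  have sm : s <= m by apply: sup_ubound => //; [case: hS|split; rewrite ?sa].
  have ext s' : s <= s' -> s' <= b -> s' < m + d -> S s'.
    move=> ss s'b s'm; split; first by rewrite (le_trans sa ss).
    rewrite (add s s')//; apply: le_trans (ler_normD _ _) _.
    have : `|F s s'| <= e * (nu s' - nu s).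
      by apply: hd => //; rewrite ltr_norml; rewrite -/m in ms; lra.
    have := nd _ _ ss; move: hs; lra.
  pose s' := Num.min b (m + d / 2).
  have md : m < m + d / 2 by rewrite ltrDl divr_gt0.
  have Ss' : S s'.
    apply: ext; rewrite /s' ?ge_min ?lexx// ?le_min ?sb /=.
      by rewrite (le_trans sm)// ltW.
    by rewrite gt_min; apply/orP; right; lra.
  have s'm : s' <= m by apply: sup_ubound => //; case: hS.
  have s'E : s' = b.
    by move: s'm; rewrite /s'; case: (leP b (m + d / 2)) => // _; rewrite leNgt md.
  by rewrite -s'E; case: Ss'.
apply/eqP; rewrite -normr_le0; apply/ler_addgt0Pr => e e0; rewrite add0r.
have n0 : 0 <= nu b - nu a by rewrite subr_ge0 nd.
have := key (e / (nu b - nu a + 1)); rewrite divr_gt0 ?ltr_wpDl// => /(_ isT).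
move=> h; apply: le_trans h _.
by rewrite mulrAC ler_pdivrMr ?ltr_wpDl// ler_pM2l// lerDl.
Qed.

End IntervalFunctions.

Section Slabs.
Variables (R : realType) (G : hilbertType R) (E : resolution G).
Implicit Types (x y z w : G) (a b c t : R) (f g nu : R -> R).

(** For [a <= b], the spectral projection of the half-open interval ]a, b]. *)
Definition slab a b x := E b x - E a x.

Lemma resolution_lin t k x y : E t (k *: x + y) = k *: E t x + E t y.
Proof. exact: rproj_linear. Qed.
Lemma resolution_sym t : symmetric_op (E t).
Proof. by move=> x y; rewrite /rdot rproj_sym. Qed.
Lemma resolution_id t x : E t (E t x) = E t x.
Proof. by rewrite rproj_mul minxx. Qed.
Lemma resolution_contraction t : contraction (E t).
Proof.
split=> [|x]; first exact: resolution_lin.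
have := sqn_ge0 (x - E t x); rewrite sqnB -[in rdot _ _]resolution_id.
by rewrite -(resolution_sym t) -/(sqn (E t x)); lra.
Qed.

Lemma slab_lin a b k x y : slab a b (k *: x + y) = k *: slab a b x + slab a b y.
Proof. by rewrite /slab !resolution_lin opprD addrACA -scalerBr. Qed.
Lemma slab_sym a b : symmetric_op (slab a b).
Proof. by move=> x y; rewrite rdotBl rdotBr !resolution_sym. Qed.
Lemma slab_cat a b c x : slab a c x = slab a b x + slab b c x.
Proof. by rewrite /slab [RHS]addrC addrA subrK. Qed.
Lemma slab_id a b x : a <= b -> slab a b (slab a b x) = slab a b x.
Proof.
move=> ab; rewrite /slab !(linB (resolution_lin _)) !rproj_mul !minxx.
by rewrite (min_idPl ab) (min_idPr ab) subrr subr0.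
Qed.
Lemma slabE_l a b t x : t <= a -> a <= b -> E t (slab a b x) = 0.
Proof.
move=> ta ab; rewrite /slab (linB (resolution_lin _)) !rproj_mul.
by rewrite (min_idPl ta) (min_idPl (le_trans ta ab)) subrr.
Qed.
Lemma slabE_r a b t x : a <= b -> b <= t -> E t (slab a b x) = slab a b x.
Proof.
move=> ab bt; rewrite /slab (linB (resolution_lin _)) !rproj_mul.
by rewrite (min_idPr bt) (min_idPr (le_trans ab bt)).
Qed.
Lemma rdistrE x t : rdistr E x t = rdot (E t x) x. Proof. by []. Qed.
Lemma sqn_slab a b x : a <= b -> sqn (slab a b x) = rdistr E x b - rdistr E x a.
Proof.
by move=> ab; rewrite /sqn slab_sym slab_id// rdotC rdotBl.
Qed.
Lemma sqn_slab_cat a b c x : a <= b -> b <= c ->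
  sqn (slab a c x) = sqn (slab a b x) + sqn (slab b c x).
Proof.
by move=> ab bc; rewrite !sqn_slab ?(le_trans ab bc)// [RHS]addrC addrA subrK.
Qed.
Lemma slab_contraction a b : a <= b -> contraction (slab a b).
Proof.
move=> ab; split=> [|x]; first exact: slab_lin.
have := sqn_ge0 (x - slab a b x); rewrite sqnB -[in rdot _ _]slab_id//.
by rewrite -(slab_sym a b) -/(sqn (slab a b x)); lra.
Qed.
Lemma slab_comm a b a' b' x : slab a b (slab a' b' x) = slab a' b' (slab a b x).
Proof.
have c s t : E s (E t x) = E t (E s x) by rewrite !rproj_mul minC.
rewrite /slab !(linB (resolution_lin _)) !(c a') !(c b').
by rewrite opprD addrACA -opprD.
Qed.

(* Informally, d(E y) = f d(E x) away from 0; the measure nu only controls the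
   error terms. *)
Definition spectral_density f x y := exists2 nu,
  {homo nu : s t / s <= t} &
  forall t, t != 0 -> forall e, 0 < e -> exists2 d, 0 < d &
    forall a b, `|a - t| < d -> `|b - t| < d -> a <= b ->
      sqn (slab a b y - (f t)%:C *: slab a b x) <= e * (nu b - nu a).

Lemma density_ext f g x y : (forall t, t != 0 -> f t = g t) ->
  spectral_density f x y -> spectral_density g x y.
Proof.
by move=> fg [nu nd h]; exists nu => // t t0 e e0; rewrite -fg//; exact: h.
Qed.

Lemma density_cst k x : spectral_density (fun=> k) x (k%:C *: x).
Proof.
exists (fun=> 0) => // t t0 e e0; exists 1 => // a b _ _ _.
by rewrite (linZ (slab_lin _ _)) !subrr sqn0 mulr0.
Qed.

Lemma densityD f g x y z : spectral_density f x y -> spectral_density g x z ->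
  spectral_density (fun t => f t + g t) x (y + z).
Proof.
move=> [n1 nd1 h1] [n2 nd2 h2]; exists (fun t => 2 * n1 t + 2 * n2 t).
  by move=> s t st; have := nd1 _ _ st; have := nd2 _ _ st; lra.
move=> t t0 e e0; have [d1 d10 H1] := h1 t t0 e e0.
have [d2 d20 H2] := h2 t t0 e e0; exists (Num.min d1 d2).
  by rewrite lt_min d10.
move=> a b; rewrite !lt_min => /andP[a1 a2] /andP[b1 b2] ab.
rewrite (linD (slab_lin _ _)) rmorphD scalerDl opprD addrACA.
apply: le_trans (sqnD_le _ _) _.
by have := H1 _ _ a1 b1 ab; have := H2 _ _ a2 b2 ab; lra.
Qed.

Lemma densityM f g x y z : spectral_density f x y -> spectral_density g y z ->
  spectral_density (fun t => g t * f t) x z.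
Proof.
move=> [n1 nd1 h1] [n2 nd2 h2]; exists (fun t => 2 * n1 t + 2 * n2 t).
  by move=> s t st; have := nd1 _ _ st; have := nd2 _ _ st; lra.
move=> t t0 e e0; have g1 : 0 < g t ^+ 2 + 1 by rewrite ltr_wpDl ?sqr_ge0.
have [d1 d10 H1] := h1 t t0 _ (divr_gt0 e0 g1).
have [d2 d20 H2] := h2 t t0 e e0; exists (Num.min d1 d2).
  by rewrite lt_min d10.
move=> a b; rewrite !lt_min => /andP[a1 a2] /andP[b1 b2] ab.
have -> : slab a b z - (g t * f t)%:C *: slab a b x =
    (slab a b z - (g t)%:C *: slab a b y) +
    (g t)%:C *: (slab a b y - (f t)%:C *: slab a b x).
  move: (slab a b x) (slab a b y) (slab a b z) => u v w.
  by rewrite scalerBr scalerA -rmorphM addrA subrK.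
apply: le_trans (sqnD_le _ _) _; rewrite sqnZ.
have := H1 _ _ a1 b1 ab; rewrite mulrAC ler_pdivlMr//.
have := H2 _ _ a2 b2 ab; have := sqn_ge0 (slab a b y - (f t)%:C *: slab a b x).
move: (g t ^+ 2) (sqn _) (sqn _) => k u v; lra.
Qed.

(** Errors are controlled separately at each t, so dividing by [f t ^+ 2] only changes the radius d;
    f may tend to 0 at the origin or at infinity. *)
Lemma densityV f x y : (forall t, t != 0 -> f t != 0) ->
  spectral_density f x y -> spectral_density (fun t => (f t)^-1) y x.
Proof.
move=> f0 [nu nd h]; exists nu => // t t0 e e0.
have ft := f0 t t0.
have [|d d0 H] := h t t0 (e * f t ^+ 2).
  by rewrite mulr_gt0 ?exprn_even_gt0.
exists d => // a b ad bd ab; have := H a b ad bd ab.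
have -> : slab a b x - (f t)^-1%:C *: slab a b y =
    - ((f t)^-1%:C *: (slab a b y - (f t)%:C *: slab a b x)).
  move: (slab a b x) (slab a b y) => u v.
  by rewrite scalerBr scalerA -rmorphM mulVf// scale1r opprB.
rewrite sqnN sqnZ exprVn ler_pdivrMl ?exprn_even_gt0//.
by rewrite -mulrA mulrCA.
Qed.

(** With [u = (Y - g t) v], (Y^2 - g(t)^2) v is (Y + g(t)) u, whose norm is at least [g t] times
    that of u because Y is positive. *)
Lemma density_sqrt f g x (Y : G -> G) : contraction Y -> symmetric_op Y ->
  positive_op Y -> (forall t, t != 0 -> 0 < g t) ->
  (forall a b, commutes Y (slab a b)) ->
  spectral_density (fun t => g t ^+ 2) x (Y (Y x)) -> spectral_density g x (Y x).
Proof.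
move=> cY sY pY g0 YE [nu nd h]; exists nu => // t t0 e e0.
have gt := g0 t t0.
have [|d d0 H] := h t t0 (e * g t ^+ 2).
  by rewrite mulr_gt0 ?exprn_gt0.
exists d => // a b ad bd ab; have := H a b ad bd ab.
rewrite -!YE; move: (slab a b x) => v.
set u := Y v - (g t)%:C *: v.
have -> : Y (Y v) - (g t ^+ 2)%:C *: v = Y u + (g t)%:C *: u.
  rewrite /u (linB cY.1) (linZ cY.1) scalerBr scalerA -rmorphM -expr2.
  by rewrite addrA subrK.
rewrite sqnD sqnZ rdotZr => hu.
have := mulr_ge0 (ltW gt) (pY u); have := sqn_ge0 (Y u) => h1 h2.
have : g t ^+ 2 * sqn u <= g t ^+ 2 * (e * (nu b - nu a)) by lra.
by rewrite ler_pM2l ?exprn_gt0.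
Qed.

End Slabs.

(* Locked, since conversion between integrals against distinct measures is very
   slow. *)
HB.lock Definition itvint (R : realType) (G : hilbertType R) (E : resolution G)
  (f : R -> R) (x : G) (a b : R) : R :=
  \int[rmeasure E x]_(t in `]a, b]%classic) f t.

HB.lock Definition sint (R : realType) (G : hilbertType R) (E : resolution G)
  (f : R -> R) (x : G) : R := \int[rmeasure E x]_t f t.

Section SpectralMeasure.
Variables (R : realType) (G : hilbertType R) (E : resolution G).
Implicit Types (x y z : G) (a b c t k e : R) (f : R -> R).

Lemma rmeasure_itv x a b : a <= b ->
  rmeasure E x `]a, b]%classic = (sqn (slab E a b x))%:E.
Proof.
move=> ab; rewrite /rmeasure /lebesgue_stieltjes_measure /measure_extension/= measurable_mu_extE/=;
  last exact: is_ocitv.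
by rewrite wlength_itv_bnd// sqn_slab// EFinB.
Qed.

Lemma bigcup_itv : \bigcup_n `](- n%:R), n%:R]%classic = [set: R].
Proof.
apply/seteqP; split=> // t _; exists (Num.bound `|t|) => //=.
have := archi_boundP (normr_ge0 t); rewrite ltr_norml in_itv/= => /andP[-> /ltW].
by [].
Qed.

Lemma rmeasure_setT x : (rmeasure E x setT <= (sqn x)%:E)%E.
Proof.
have h : rmeasure E x \o (fun n => `](- n%:R), n%:R]%classic) @ \oo -->
    rmeasure E x (\bigcup_n `](- n%:R), n%:R]%classic).
  apply: nondecreasing_cvg_mu => //.
  - by rewrite bigcup_itv.
  - apply/nondecreasing_seqP => n; apply/subsetPset => t /=; rewrite !in_itv/=.
    move=> /andP[h1 h2]; rewrite (le_lt_trans _ h1) ?lerN2 ?ler_nat//=.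
    by rewrite (le_trans h2)// ler_nat.
rewrite -bigcup_itv -(cvg_lim _ h)//; apply: lime_le; first by apply/cvg_ex; exists (rmeasure E x (\bigcup_n `](- n%:R), n%:R]%classic)).
apply: nearW => n /=; rewrite rmeasure_itv ?lee_fin.
  by apply: (slab_contraction E _).2; rewrite (@le_trans _ _ 0)// oppr_le0.
by rewrite (@le_trans _ _ 0)// oppr_le0.
Qed.

Lemma rmeasure_lty x (A : set (measurableTypeR R)) : measurable A -> (rmeasure E x A < +oo)%E.
Proof.
move=> mA; apply: le_lt_trans (ltry (sqn x)).
by apply: le_trans (rmeasure_setT x); apply: le_measure => //; rewrite inE.
Qed.

(** Accommodates [alpha + t ^- 4], which the convention [0^-1 = 0] makes discontinuous at 0. *)
Definition continuous_off0 f := forall t, t != 0 -> {for t, continuous f}.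

Lemma continuous_off0_measurable f : continuous_off0 f ->
  measurable_fun [set: measurableTypeR R] f.
Proof.
move=> fc; have -> : [set: measurableTypeR R] = [set 0] `|` ~` [set 0].
  by rewrite setUCr.
apply/measurable_funU; [exact: measurable_set1| |split].
  by apply: measurableC; exact: measurable_set1.
- exact: measurable_fun_set1.
- apply: open_continuous_measurable_fun.
    by apply: closed_openC; exact: closed_eq.
  by move=> t; rewrite inE/= => /eqP; exact: fc.
Qed.

Definition off0 a b := 0 < a \/ b < 0.

Lemma off0_neq0 a b t : off0 a b -> a <= t <= b -> t != 0.
Proof.
by move=> [a0|b0] /andP[ta tb]; apply/eqP => t0; lra.
Qed.

(** Integrals run over ]a, b], but continuity on the closed interval provides a bound by
    compactness. *)
Definition regular f a b := measurable_fun [set: measurableTypeR R] f /\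
  forall t, a <= t <= b -> {for t, continuous f}.

Lemma off0_regular f a b : continuous_off0 f -> off0 a b -> regular f a b.
Proof.
move=> fc ab0; split; first exact: continuous_off0_measurable.
by move=> t tab; exact/fc/off0_neq0/tab.
Qed.

Lemma continuous_regular f a b : continuous f -> regular f a b.
Proof. by move=> fc; split=> // [|t _]; [exact: continuous_measurable_fun|exact: fc]. Qed.

Lemma regular_sub f a b a' b' : a <= a' -> b' <= b -> regular f a b -> regular f a' b'.
Proof.
by move=> aa bb [mf fc]; split=> // t /andP[h1 h2]; apply: fc; lra.
Qed.

Lemma regular_bounded f a b : regular f a b ->
  exists M, forall t, a <= t <= b -> `|f t| <= M.
Proof.
move=> [_ fc]; have cf : {within `[a, b], continuous f}.
  by apply: continuous_in_subspaceT => t; rewrite inE/= in_itv/= => /fc.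
have [M [Mr hM]] := compact_bounded (continuous_compact cf (@segment_compact _ _ _)).
exists (M + 1) => t tab; apply: (hM (M + 1)); first by rewrite ltrDl.
by exists t => //=; rewrite in_itv.
Qed.

Lemma integrable_bounded f x M (A : set (measurableTypeR R)) :
  measurable_fun [set: measurableTypeR R] f -> measurable A ->
  (forall t, A t -> `|f t| <= M) -> (rmeasure E x).-integrable A (EFin \o f).
Proof.
move=> mf mA h; apply: measurable_bounded_integrable => //.
- exact: rmeasure_lty.
- exact: measurable_funTS.
exists M; split; first exact: num_real.
by move=> k Mk t /h /= /le_trans; apply; exact: ltW.
Qed.

Lemma regular_integrable f x a b : regular f a b ->
  (rmeasure E x).-integrable `]a, b]%classic (EFin \o f).
Proof.
move=> fr; have [M hM] := regular_bounded fr.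
apply: (integrable_bounded x fr.1 (M := M)); first exact: measurable_itv.
by move=> t /=; rewrite in_itv/= => /andP[/ltW at_ tb]; apply: hM; rewrite at_.
Qed.

Local Notation itvint := (itvint E).

Lemma itvint_cat f x a b c : regular f a c -> a <= b -> b <= c ->
  itvint f x a c = itvint f x a b + itvint f x b c.
Proof.
move=> fr ab bc; rewrite itvint.unlock.
have abc : `]a, c]%classic = `]a, b]%classic `|` `]b, c]%classic.
  by rewrite -(@itv_bndbnd_setU _ _ (BRight a) (BRight b) (BRight c)) ?bnd_simp.
rewrite abc Rintegral_setU//=; try exact: measurable_itv.
- by rewrite -abc; exact: regular_integrable.
- apply/disj_setPS => t [] /=; rewrite !in_itv/= => /andP[_ h1] /andP[h2 _].
  by move: (lt_le_trans h2 h1); rewrite ltxx.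
Qed.

Lemma itvint_near f x a b k e : regular f a b -> a <= b ->
  (forall t, a <= t <= b -> `|f t - k| <= e) ->
  `|itvint f x a b - k * sqn (slab E a b x)| <= e * sqn (slab E a b x).
Proof.
move=> fr ab h.
have mab : measurable (`]a, b]%classic : set (measurableTypeR R)).
  exact: measurable_itv.
have muab : fine (rmeasure E x `]a, b]%classic) = sqn (slab E a b x).
  by rewrite rmeasure_itv.
have ic r : (rmeasure E x).-integrable `]a, b]%classic (EFin \o cst r).
  apply: measurable_bounded_integrable => //; first exact: rmeasure_lty.
  exact: bounded_cst.
have if_ := regular_integrable x fr.
have := le_Rintegral mab if_ (ic (k + e)); have := le_Rintegral mab (ic (k - e)) if_.
rewrite /= !Rintegral_cst// muab => h1 h2; rewrite itvint.unlock.
have in_itv_le t : `]a, b]%classic t -> a <= t <= b.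
  by rewrite /= in_itv/= => /andP[/ltW -> ->].
have l1 : (k - e) * sqn (slab E a b x) <= \int[rmeasure E x]_(t in `]a, b]%classic) f t.
  by apply: h1 => t /in_itv_le/h; rewrite ler_norml; lra.
have l2 : \int[rmeasure E x]_(t in `]a, b]%classic) f t <= (k + e) * sqn (slab E a b x).
  by apply: h2 => t /in_itv_le/h; rewrite ler_norml; lra.
by rewrite ler_norml; move: l1 l2; lra.
Qed.

Lemma itvint_ge0 f x a b : (forall t, 0 <= f t) -> 0 <= itvint f x a b.
Proof. by move=> f0; rewrite itvint.unlock; apply: Rintegral_ge0. Qed.

(* The rdistr are not syntactically equal as cumulative functions, whence the
   detour through uniqueness of the Stieltjes measure. *)
Lemma eq_rdistr_measure x y (A : set (measurableTypeR R)) :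
  rdistr E x =1 rdistr E y -> measurable A -> rmeasure E x A = rmeasure E y A.
Proof.
move=> xy mA; apply: lebesgue_stieltjes_measure_unique => // _ [[a b] _ <-] /=.
have [ab|/ltW ba] := leP a b.
  by rewrite -!/(rmeasure E _) !rmeasure_itv// !sqn_slab// !xy.
by rewrite set_itv_ge ?measure0// bnd_simp -leNgt.
Qed.

End SpectralMeasure.

Section SpectralIntegral.
Variables (R : realType) (G : hilbertType R) (E : resolution G).
Implicit Types (x y z u : G) (a b c t k e : R) (f nu : R -> R).

(** An additive interval function is determined by its infinitesimal behaviour, here [f t] times a
    combination of squared slab norms of several vectors. This evaluates sums of integrals against
    different measures without comparing the measures. *)
Lemma additive_itvint f (F : R -> R -> R) nu (s : seq (R * G)) a b :
  regular f a b -> {homo nu : s t / s <= t} ->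
  (forall s t, a <= s -> s <= t -> t <= b -> F a t = F a s + F s t) ->
  (forall t, a <= t <= b -> forall e, 0 < e -> exists2 d, 0 < d &
     forall a b, `|a - t| < d -> `|b - t| < d -> a <= b ->
       `|F a b - f t * \sum_(p <- s) p.1 * sqn (slab E a b p.2)|
         <= e * (nu b - nu a)) ->
  a <= b -> F a b = \sum_(p <- s) p.1 * itvint E f p.2 a b.
Proof.
move=> fr nd Fadd loc ab; apply/eqP; rewrite -subr_eq0; apply/eqP.
(* The added distribution functions absorb the oscillation of f around t. *)
pose n2 t := nu t + \sum_(p <- s) `|p.1| * rdistr E p.2 t.
apply: (@additive_interval_eq0 _ (fun a b =>
  F a b - \sum_(p <- s) p.1 * itvint E f p.2 a b) n2) => //.
- move=> t t' tt'; rewrite /n2 lerD ?nd//; apply: ler_sum => p _.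
  by rewrite ler_wpM2l// rdistr_nd.
- move=> t t' at_ tt' t'b; rewrite (Fadd t t')// addrACA -opprD -big_split /=.
  congr (_ - _); apply: eq_bigr => p _; rewrite -mulrDr; congr (_ * _).
  by apply: itvint_cat => //; exact: regular_sub fr.
move=> t tab e e0; have [d d0 hd] := loc t tab e e0.
have /cvgrPdist_le/(_ _ e0)[d' /= d'0 hd'] := fr.2 t tab.
exists (Num.min d d'); first by rewrite lt_min d0.
move=> a' b' aa' b'b; rewrite !lt_min => /andP[a1 a2] /andP[b1 b2] a'b'.
have near p : `|itvint E f p a' b' - f t * sqn (slab E a' b' p)| <=
    e * sqn (slab E a' b' p).
  apply: itvint_near => // [|r /andP[ar rb]].
    exact: regular_sub fr.
  rewrite distrC; apply: hd'; rewrite /= distrC ltr_norml.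
  by move: a2 b2; rewrite !ltr_norml; lra.
have -> : F a' b' - \sum_(p <- s) p.1 * itvint E f p.2 a' b' =
    (F a' b' - f t * \sum_(p <- s) p.1 * sqn (slab E a' b' p.2)) -
    \sum_(p <- s) p.1 * (itvint E f p.2 a' b' - f t * sqn (slab E a' b' p.2)).
  rewrite mulr_sumr -addrA; congr (_ + _); rewrite -opprD -big_split /=.
  by congr (- _); apply: eq_bigr => p _; ring.
apply: le_trans (ler_normB _ _) _; rewrite /n2 opprD addrACA mulrDr lerD ?hd//.
apply: le_trans (ler_norm_sum _ _ _) _.
rewrite -sumrB mulr_sumr; apply: ler_sum => p _.
by rewrite normrM -mulrBr -sqn_slab// mulrCA ler_wpM2l.
Qed.

(** Linear relations between squared slab norms pass to integrals: the zero interval function is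
    additive and has the required local behaviour. *)
Lemma itvint_lincomb0 f (s : seq (R * G)) a b : regular f a b -> a <= b ->
  (forall a b, \sum_(p <- s) p.1 * sqn (slab E a b p.2) = 0) ->
  \sum_(p <- s) p.1 * itvint E f p.2 a b = 0.
Proof.
move=> fr ab s0; rewrite -(@additive_itvint f (fun _ _ => 0) (fun=> 0))//.
  by move=> *; rewrite addr0.
move=> t _ e e0; exists 1 => // a' b' _ _ _.
by rewrite s0 mulr0 !subr0 normr0 mulr0.
Qed.

Lemma itvint_parallelogram f x z a b : regular f a b -> a <= b ->
  itvint E f (x + z) a b + itvint E f (x - z) a b =
  2 * itvint E f x a b + 2 * itvint E f z a b.
Proof.
move=> fr ab; have := @itvint_lincomb0 f
  [:: (2, x); (2, z); (-1, x + z); (-1, x - z)] a b fr ab.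
rewrite !big_cons !big_nil /=.
move: (itvint E f x a b) (itvint E f z a b) (itvint E f (x + z) a b)
  (itvint E f (x - z) a b) => p q r w h; suff : 2 * p + (2 * q + (-1 * r + (-1 * w + 0))) = 0 by lra.
apply: h => a' b'; rewrite !big_cons !big_nil /=.
rewrite (linB (slab_lin _ _ _)) (linD (slab_lin _ _ _)) sqnB sqnD.
by move: (sqn _) (sqn _) (rdot _ _) => A B C; ring.
Qed.

Lemma itvint_pythagoras f (P : G -> G) x a b :
  (forall (k : R[i]) x y, P (k *: x + y) = k *: P x + P y) -> symmetric_op P ->
  (forall x, P (P x) = P x) -> (forall a b, commutes P (slab E a b)) ->
  regular f a b -> a <= b ->
  itvint E f x a b = itvint E f (P x) a b + itvint E f (x - P x) a b.
Proof.
move=> linP sP PP Pc fr ab; have := @itvint_lincomb0 f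
  [:: (1, x); (-1, P x); (-1, x - P x)] a b fr ab.
rewrite !big_cons !big_nil /=.
move: (itvint E f x a b) (itvint E f (P x) a b) (itvint E f (x - P x) a b)
  => p q r h.
suff : 1 * p + (-1 * q + (-1 * r + 0)) = 0 by lra.
apply: h => a' b'; rewrite !big_cons !big_nil /=.
rewrite (linB (slab_lin _ _ _)) sqnB -Pc -[in rdot _ _]PP -sP.
by rewrite -/(sqn (P _)); move: (sqn _) (sqn _) => A B; ring.
Qed.

Lemma density_itvint f x y z a b : continuous_off0 f -> spectral_density E f x y ->
  off0 a b -> a <= b ->
  rdot (slab E a b y) z = (itvint E f (x + z) a b - itvint E f (x - z) a b) / 4.
Proof.
move=> fc [nu nd h] ab0 ab.
have := @additive_itvint f (fun a b => rdot (slab E a b y) z)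
  (fun t => nu t + rdistr E z t) [:: (4^-1, x + z); (- 4^-1, x - z)] a b (off0_regular fc ab0).
rewrite !big_cons !big_nil /= => ->//.
- by move: (itvint _ _ _ _ _) (itvint _ _ _ _ _) => p q; lra.
- by move=> s t st; rewrite lerD ?nd ?rdistr_nd.
- by move=> s t _ _ _; rewrite -rdotDl -slab_cat.
move=> t tab e e0.
(* Young's inequality with weight [e^-1] turns the tolerance [e ^+ 2] into an error of order e. *)
have [d d0 hd] := h t (off0_neq0 ab0 tab) _ (exprn_gt0 2 e0).
exists d => // a' b' ad bd ab'; rewrite !big_cons !big_nil /= addr0.
rewrite (linD (slab_lin _ _ _)) (linB (slab_lin _ _ _)) sqnB sqnD.
have -> : rdot (slab E a' b' y) z = rdot (slab E a' b' y) (slab E a' b' z).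
  by rewrite -{1}(slab_id E y ab') slab_sym.
have := hd _ _ ad bd ab'.
have -> : nu b' + rdistr E z b' - (nu a' + rdistr E z a') =
  nu b' - nu a' + sqn (slab E a' b' z) by rewrite sqn_slab//; ring.
move: (slab E a' b' x) (slab E a' b' y) (slab E a' b' z) => x' y' z' hxy.
have -> : rdot y' z' - f t * (4^-1 * (sqn x' + 2 * rdot x' z' + sqn z') +
    - 4^-1 * (sqn x' - 2 * rdot x' z' + sqn z')) = rdot (y' - (f t)%:C *: x') z'.
  by rewrite rdotBl rdotZl; field.
have ei : 0 < e^-1 by rewrite invr_gt0.
have := rdot_le (y' - (f t)%:C *: x') z' ei; rewrite invrK.
have : e^-1 * sqn (y' - (f t)%:C *: x') <= e * (nu b' - nu a').
  by rewrite ler_pdivrMl//; apply: le_trans hxy _; rewrite mulrA -expr2.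
have : 0 <= e * (nu b' - nu a').
  by apply: mulr_ge0; [exact: ltW|rewrite subr_ge0 nd].
have := mulr_ge0 (ltW e0) (sqn_ge0 z'); lra.
Qed.

Lemma regular_sqr f a b : regular f a b -> regular (fun t => f t ^+ 2) a b.
Proof.
move=> [mf fc]; have -> : (fun t => f t ^+ 2) = f \* f.
  by apply/funext => u; rewrite expr2.
split; first exact: measurable_funM.
by move=> t /fc h; apply: continuousM.
Qed.

Lemma continuous_off0_sqr f : continuous_off0 f -> continuous_off0 (fun t => f t ^+ 2).
Proof.
move=> fc t t0; have -> : (fun t => f t ^+ 2) = f \* f.
  by apply/funext => u; rewrite expr2.
by apply: continuousM; exact: fc.
Qed.

Lemma density_sqn_itvint f x y a b : continuous_off0 f -> spectral_density E f x y ->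
  off0 a b -> a <= b ->
  sqn (slab E a b y) = itvint E (fun t => f t ^+ 2) x a b.
Proof.
move=> fc [nu nd h] ab0 ab.
have := @additive_itvint (fun t => f t ^+ 2) (fun a b => sqn (slab E a b y))
  (fun t => nu t + rdistr E x t) [:: (1, x)] a b (regular_sqr (off0_regular fc ab0)).
rewrite !big_cons !big_nil /= mul1r addr0 => ->//.
- by move=> s t st; rewrite lerD ?nd ?rdistr_nd.
- by move=> s t ? ? _; rewrite -sqn_slab_cat.
(* k is the Young weight for the cross term: [k * f t ^+ 2 <= e] handles x, and the coefficient
   [1 + k^-1] left on the density error is compensated by the tolerance [e / (1 + k^-1)]. *)
move=> t tab e e0; pose k := e / (2 * (f t ^+ 2 + 1)).
have f1 : 0 < 2 * (f t ^+ 2 + 1) by have := sqr_ge0 (f t); lra.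
have k0 : 0 < k by rewrite divr_gt0.
have kf : k * (2 * (f t ^+ 2 + 1)) = e by rewrite mulfVK// gt_eqF.
have K0 : 0 < 1 + k^-1 by rewrite ltr_pwDl// ltW// invr_gt0.
have [d d0 hd] := h t (off0_neq0 ab0 tab) _ (divr_gt0 e0 K0).
exists d => // a' b' ad bd ab'; rewrite !big_cons !big_nil /= mul1r addr0.
have := hd _ _ ad bd ab'.
have -> : nu b' + rdistr E x b' - (nu a' + rdistr E x a') =
  nu b' - nu a' + sqn (slab E a' b' x) by rewrite sqn_slab//; ring.
have : 0 <= nu b' - nu a' by rewrite subr_ge0 nd.
move: (nu b' - nu a') (slab E a' b' x) (slab E a' b' y) => N x' y' N0.
rewrite mulrAC ler_pdivlMr// => hxy.
have e1 : sqn y' - f t ^+ 2 * sqn x' = sqn (y' - (f t)%:C *: x') +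
    2 * rdot (y' - (f t)%:C *: x') ((f t)%:C *: x').
  by rewrite sqnB rdotBl sqnZ -/(sqn _) sqnZ; ring.
rewrite e1; have ki : 0 < k^-1 by rewrite invr_gt0.
have := rdot_le (y' - (f t)%:C *: x') ((f t)%:C *: x') ki.
rewrite invrK sqnZ; have := sqn_ge0 x'; have := sqn_ge0 (y' - (f t)%:C *: x').
move: hxy; move: (rdot _ _) => r; move: (sqn (y' - _)) (sqn x') => A B hA A0 B0 hr.
apply: le_trans (ler_normD _ _) _; rewrite (ger0_norm A0) normrM (ger0_norm (ler0n _ 2)).
have : k * (f t ^+ 2 * B) <= e * B.
  by rewrite -kf -mulrA ler_pM2l//; have := sqr_ge0 (f t); nra.
by move: hA hr; rewrite mulrDr mulr1 (mulrC A); lra.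
Qed.

End SpectralIntegral.

(** * Exhaustion of the real line up to a null set *)

Section ExhaustingSets.
Variables (R : realType) (G : hilbertType R) (E : resolution G) (x : G).
Variables (S : nat -> set (measurableTypeR R)) (Z : set (measurableTypeR R)).
Hypotheses (mS : forall n, measurable (S n)) (mZ : measurable Z).
Hypothesis Z0 : rmeasure E x Z = 0%E.
Hypothesis SZ : forall t, ~ Z t -> \forall n \near \oo, S n t.
Variable f : R -> R.
Hypothesis mf : measurable_fun [set: measurableTypeR R] f.

Lemma exhausting_cvg : (rmeasure E x).-integrable setT (EFin \o f) ->
  (fun n => \int[rmeasure E x]_(t in S n) f t) @ \oo -->
  \int[rmeasure E x]_t f t.
Proof.
move=> fi; have [|||||_ _ h] := @dominated_convergence _ (measurableTypeR R) R (rmeasure E x) setT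
  measurableT (fun n => EFin \o (f \_ (S n))) (EFin \o f)
  (fun t => `|(f t)%:E|%E).
- move=> n; apply/measurable_EFinP.
  by apply/(measurable_restrictT _ _).1 => //; exact: measurable_funTS.
- exact/measurable_EFinP.
- exists Z; split=> // t /= ht; apply: contrapT => nZ; apply: ht => _.
  apply: cvg_near_cst; apply: filterS (SZ nZ) => n hn /=.
  by rewrite patchE mem_set.
- exact: integrable_abse.
- apply: aeW => t n _ /=; rewrite patchE; case: ifP => _ //.
  by rewrite normr0 lee_fin.
have intf_fin : (\int[rmeasure E x]_t (f t)%:E)%E \is a fin_num.
  exact: integrable_fin_num.
move: h; rewrite -(fineK intf_fin) => /fine_cvg; apply: cvg_trans.
by apply: near_eq_cvg; apply: nearW => n /=; rewrite Rintegral_mkcond.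
Qed.

Hypothesis f0 : forall t, 0 <= f t.

Lemma exhausting_bound (M : R) : nondecreasing_seq S ->
  (forall n t, S n t -> ~ Z t) ->
  (forall n, (rmeasure E x).-integrable (S n) (EFin \o f)) ->
  (forall n, \int[rmeasure E x]_(t in S n) f t <= M) ->
  (\int[rmeasure E x]_t (f t)%:E <= M%:E)%E.
Proof.
move=> ndS disj intS hM.
have mEf : measurable_fun [set: measurableTypeR R] (fun t => (f t)%:E).
  exact/measurable_EFinP.
have fE0 t : (0 <= (f t)%:E)%E by rewrite lee_fin.
rewrite (@ge0_negligible_integral _ (measurableTypeR R) R (rmeasure E x) setT Z)//.
have <- : \bigcup_n S n = [set: R] `\` Z.
  apply/seteqP; split=> [t [n _ Snt]|t [_ nZ]]; first by split=> //; exact: disj Snt.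
  by have [n _ /(_ n (leqnn n)) h] := SZ nZ; exists n.
have h := @ge0_nondecreasing_set_cvg_integral _ (measurableTypeR R) R S
  (fun t => (f t)%:E) (rmeasure E x) ndS mS
  (fun i => measurable_funTS mEf) (fun i t _ => fE0 t).
rewrite -(cvg_lim _ h)//; apply: lime_le; first by apply/cvg_ex; eexists; exact: h.
apply: nearW => n.
have iof : (\int[rmeasure E x]_(t in S n) (f t)%:E)%E \is a fin_num.
  exact: integrable_fin_num.
by rewrite -(fineK iof) lee_fin; exact: hM.
Qed.

Lemma exhausting_le n : (rmeasure E x).-integrable setT (EFin \o f) ->
  \int[rmeasure E x]_(t in S n) f t <= \int[rmeasure E x]_t f t.
Proof.
move=> fi.
have fiS : (rmeasure E x).-integrable (S n) (EFin \o f) by exact: integrableS fi.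
apply: fine_le; try exact: integrable_fin_num.
apply: ge0_subset_integral => //.
  by apply/measurable_EFinP.
by move=> t _; rewrite lee_fin.
Qed.

End ExhaustingSets.

Section Exhaustion.
Variables (R : realType) (G : hilbertType R) (E : resolution G).
Implicit Types (x y z u : G) (a b c t k e : R) (f nu : R -> R) (n : nat).

(** The strong form of E({0}) = 0; for a resolution of H it expresses the injectivity of H. *)
Definition no_atom0 :=
  forall x, (fun n => slab E (- n.+1%:R^-1) n.+1%:R^-1 x) @ \oo --> (0 : G).

Let N n : R := n.+1%:R.
Let N0 n : 0 < N n. Proof. by rewrite ltr0n. Qed.
Let N1 n : 1 <= N n. Proof. by rewrite ler1n. Qed.
Let iN0 n : 0 < (N n)^-1. Proof. by rewrite invr_gt0. Qed.
Let iN1 n : (N n)^-1 <= 1. Proof. by rewrite invf_le1. Qed.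
Let iNN n : (N n)^-1 <= N n. Proof. exact: le_trans (iN1 n) (N1 n). Qed.

(** The spectral projection of 1/N < |t| <= N up to endpoints, with N = n + 1. On its range both H
    and its inverse are bounded, so cutoffs are smooth vectors. *)
Definition cutoff n x :=
  slab E (- n.+1%:R) (- n.+1%:R^-1) x + slab E n.+1%:R^-1 n.+1%:R x.

Lemma cutoff_off0 n : off0 (- n.+1%:R) (- n.+1%:R^-1 : R) /\
  off0 (n.+1%:R^-1) (n.+1%:R : R).
Proof. by split; [right; rewrite oppr_lt0|left]; exact: iN0. Qed.

Lemma cutoff_le n : - n.+1%:R <= - n.+1%:R^-1 :> R /\ n.+1%:R^-1 <= n.+1%:R :> R.
Proof. by rewrite lerN2; have := iNN n. Qed.

Lemma cutoff_cvg x : no_atom0 -> cutoff^~ x @ \oo --> x.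
Proof.
move=> /(_ x) h.
have h1 : (fun n => E (N n) x) @ \oo --> x.
  apply: cvg_comp (@rproj_pinfty _ _ E x).
  by rewrite (cvg_shiftS (fun n => n%:R : R)); exact: cvgr_idn.
have h2 : (fun n => E (- N n) x) @ \oo --> (0 : G).
  apply: cvg_comp (@rproj_ninfty _ _ E x); apply/cvgNry.
  rewrite (_ : - _ = N); last by apply/funext => n /=; rewrite opprK.
  by rewrite (cvg_shiftS (fun n => n%:R : R)); exact: cvgr_idn.
rewrite (_ : cutoff^~ x = fun n => E (N n) x - E (- N n) x -
    slab E (- (N n)^-1) (N n)^-1 x); last first.
  apply/funext => n; rewrite /cutoff -/(slab E (- N n) (N n) x).
  rewrite (slab_cat E (- N n) (- (N n)^-1) (N n)).
  rewrite (slab_cat E (- (N n)^-1) (N n)^-1 (N n)).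
  move: (slab E (- N n) (- (N n)^-1) x) (slab E (- (N n)^-1) (N n)^-1 x)
    (slab E (N n)^-1 (N n) x) => p r w.
  by rewrite [r + _]addrC addrA addrK.
rewrite -[X in _ --> X]subr0 -[X in _ --> X - _]subr0.
by apply: cvgB => //; exact: cvgB.
Qed.

Let oset n : set (measurableTypeR R) :=
  `](- N n), (- (N n)^-1)]%classic `|` `](N n)^-1, N n]%classic.

Let moset n : measurable (oset n).
Proof. by apply: measurableU; exact: measurable_itv. Qed.

Let oset_mono : nondecreasing_seq oset.
Proof.
apply/nondecreasing_seqP => n; apply/subsetPset => t.
have NN : N n <= N n.+1 by rewrite ler_nat.
have iNN' : (N n.+1)^-1 <= (N n)^-1 by rewrite lef_pV2 ?posrE.
rewrite /oset /= !in_itv/=; move: NN iNN'.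
move: ((N n)^-1) ((N n.+1)^-1) (N n) (N n.+1) => i i' m m' mm ii.
by move=> [/andP[h1 h2]|/andP[h1 h2]]; [left|right]; apply/andP; split; lra.
Qed.

Let oset_near t : t != 0 -> \forall n \near \oo, oset n t.
Proof.
move=> t0; have a0 : 0 < `|t| by rewrite normr_gt0.
have [M _ hM] := near_infty_natSinv_lt (PosNum a0).
have := archi_boundP (normr_ge0 t); set K := Num.bound _ => hK.
exists (maxn M K) => // n /=; rewrite geq_max => /andP[Mn Kn].
have l1 : (N n)^-1 < `|t| by exact: hM Mn.
have l2 : `|t| < N n by apply: lt_le_trans hK _; rewrite ler_nat leqW.
rewrite /oset /= !in_itv/=; move: l1 l2.
move: ((N n)^-1) (N n) => i m.
by have [_|_] := ger0P t; [right|left]; apply/andP; split; lra.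
Qed.

Let oset_bigcup : \bigcup_n oset n = [set: R] `\` [set 0].
Proof.
apply/seteqP; split=> [t [n _]|t [_ /= /eqP t0]].
  rewrite /oset /= !in_itv/= => -[]/andP[h1 h2]; split=> //= t0;
  by have := iN0 n; move: h1 h2; move: ((N n)^-1) (N n) => i m; lra.
by have [n _ /(_ n (leqnn n)) h] := oset_near t0; exists n.
Qed.

Lemma rmeasure_set0 x : no_atom0 -> rmeasure E x [set 0] = 0%E.
Proof.
move=> /(_ x)/cvg_sqn; rewrite sqn0 => h.
apply/eqP; rewrite eq_le measure_ge0 andbT.
apply/lee_addgt0Pr => e e0; rewrite add0e.
have /cvgrPdist_lt/(_ _ e0)[n _ /(_ n (leqnn n))] := h.
rewrite /= sub0r normrN ger0_norm ?sqn_ge0// => hn.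
have nn : - (N n)^-1 <= (N n)^-1 by have := iN0 n; move: ((N n)^-1) => i; lra.
apply: (@le_trans _ _ (rmeasure E x `](- (N n)^-1), (N n)^-1]%classic)).
  apply: le_measure; rewrite ?inE; [exact: measurable_set1|exact: measurable_itv|].
  by move=> _ ->; rewrite /= in_itv/= oppr_lt0 iN0 ltW.
by rewrite rmeasure_itv// lee_fin ltW.
Qed.

Let Rintegral_oset f x n : continuous_off0 f ->
  (rmeasure E x).-integrable (oset n) (EFin \o f) /\
  \int[rmeasure E x]_(t in oset n) f t =
  itvint E f x (- N n) (- (N n)^-1) + itvint E f x (N n)^-1 (N n).
Proof.
move=> fc; have [off1 off2] := cutoff_off0 n.
have [M1 h1] := regular_bounded (off0_regular fc off1).
have [M2 h2] := regular_bounded (off0_regular fc off2).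
have iU : (rmeasure E x).-integrable (oset n) (EFin \o f).
  apply: (integrable_bounded E x (continuous_off0_measurable fc)
    (M := Num.max M1 M2)) => // t.
  rewrite /oset /= !in_itv/= le_max => -[]/andP[/ltW l r]; apply/orP.
    by left; apply: h1; rewrite l.
  by right; apply: h2; rewrite l.
split=> //; rewrite itvint.unlock Rintegral_setU//; try exact: measurable_itv.
apply/disj_setPS => t [] /=; rewrite !in_itv/= => /andP[_ l] /andP[r _].
by have := iN0 n; move: l r; move: ((N n)^-1) (N n) => i m; lra.
Qed.

Let oset_nZ t : ~ [set 0] t -> \forall n \near \oo, oset n t.
Proof. by move=> /eqP; exact: oset_near. Qed.

Let msing0 : measurable ([set 0 : R] : set (measurableTypeR R)).
Proof. exact: measurable_set1. Qed.

Lemma itvint_cvg f x : no_atom0 -> continuous_off0 f ->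
  (rmeasure E x).-integrable setT (EFin \o f) ->
  (fun n => itvint E f x (- n.+1%:R) (- n.+1%:R^-1) +
            itvint E f x n.+1%:R^-1 n.+1%:R) @ \oo -->
  sint E f x.
Proof.
move=> na fc fi; rewrite sint.unlock.
have := exhausting_cvg moset msing0 (rmeasure_set0 x na) oset_nZ
  (continuous_off0_measurable fc) fi.
by apply: cvg_trans; apply: near_eq_cvg; apply: nearW => n;
  have [_ <-] := Rintegral_oset x n fc.
Qed.

Lemma itvint_bound f x (M : R) : no_atom0 -> continuous_off0 f ->
  (forall t, 0 <= f t) ->
  (forall n, itvint E f x (- n.+1%:R) (- n.+1%:R^-1) +
             itvint E f x n.+1%:R^-1 n.+1%:R <= M) ->
  (\int[rmeasure E x]_t (f t)%:E <= M%:E)%E.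
Proof.
move=> na fc f0 hM.
apply: (exhausting_bound moset msing0 (rmeasure_set0 x na) oset_nZ) => //.
- exact: continuous_off0_measurable.
- move=> n t h t0; have : (\bigcup_n oset n) t by exists n.
  by rewrite oset_bigcup => -[_]; apply.
- by move=> n; have [] := Rintegral_oset x n fc.
- by move=> n; have [_ ->] := Rintegral_oset x n fc; exact: hM.
Qed.

Lemma itvint_le f x n : continuous_off0 f -> (forall t, 0 <= f t) ->
  (rmeasure E x).-integrable setT (EFin \o f) ->
  itvint E f x (- n.+1%:R) (- n.+1%:R^-1) + itvint E f x n.+1%:R^-1 n.+1%:R <=
  sint E f x.
Proof.
move=> fc f0 fi; rewrite sint.unlock; have [_ <-] := Rintegral_oset x n fc.
exact: (exhausting_le moset (continuous_off0_measurable fc)).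
Qed.

(** A second exhaustion, which keeps 0, for continuous integrands: [rint_resolves] has to integrate
    t before an atom at 0 is excluded. *)
Let sset n : set (measurableTypeR R) := `](- N n), N n]%classic.

Let msset n : measurable (sset n). Proof. exact: measurable_itv. Qed.

Let sset_near t : ~ set0 t -> \forall n \near \oo, sset n t.
Proof.
move=> _; have := archi_boundP (normr_ge0 t); set K := Num.bound _ => hK.
exists K => // n /= Kn.
have l2 : `|t| < N n by apply: lt_le_trans hK _; rewrite ler_nat leqW.
by rewrite /sset /= in_itv/=; move: l2; rewrite ltr_norml => /andP[-> /ltW].
Qed.

Lemma itvint_cvgT f x : continuous f ->
  (rmeasure E x).-integrable setT (EFin \o f) ->
  (fun n => itvint E f x (- n.+1%:R) n.+1%:R) @ \oo -->
  sint E f x.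
Proof.
move=> fc fi; rewrite sint.unlock itvint.unlock; have mf : measurable_fun [set: measurableTypeR R] f.
  exact: continuous_measurable_fun.
exact: (exhausting_cvg msset measurable0 (measure0 _) sset_near mf fi).
Qed.

Lemma itvint_boundT f x (M : R) : continuous f -> (forall t, 0 <= f t) ->
  (forall n, itvint E f x (- n.+1%:R) n.+1%:R <= M) ->
  (\int[rmeasure E x]_t (f t)%:E <= M%:E)%E.
Proof.
rewrite itvint.unlock => fc f0 hM; have mf : measurable_fun [set: measurableTypeR R] f.
  exact: continuous_measurable_fun.
apply: (exhausting_bound msset measurable0 (measure0 _) sset_near mf f0).
- apply/nondecreasing_seqP => n; apply/subsetPset => t.
  have NN : N n <= N n.+1 by rewrite ler_nat.
  by rewrite /sset /= !in_itv/= => /andP[h1 h2]; apply/andP; split; lra.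
- by move=> n t _ [].
- by move=> n; exact: (regular_integrable E x (continuous_regular (- N n) (N n) fc)).
- exact: hM.
Qed.

Lemma itvint_leT f x n : continuous f -> (forall t, 0 <= f t) ->
  (rmeasure E x).-integrable setT (EFin \o f) ->
  itvint E f x (- n.+1%:R) n.+1%:R <= sint E f x.
Proof.
move=> fc f0 fi; rewrite sint.unlock itvint.unlock; have mf : measurable_fun [set: measurableTypeR R] f.
  exact: continuous_measurable_fun.
exact: (exhausting_le msset mf).
Qed.

End Exhaustion.

(** * Operator integrals and their domains *)

Section OperatorIntegral.
Variables (R : realType) (G : hilbertType R) (E : resolution G).
Implicit Types (x y z u v w : G) (a b c t e : R) (f : R -> R) (n : nat).

Definition rpol f x z : R :=
  (sint E f (x + z) - sint E f (x - z)) / 4.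

(** Brings the four-term polarization to the shape of [hdotE], so that real identities at z and
    ['i *: z] give the complex one. *)
Lemma rformE f x z :
  rform E f x z = (rpol f x z)%:C + 'i * (rpol f x ('i *: z))%:C.
Proof.
rewrite /rform !big_ord_recl big_ord0 /= /bump /=.
rewrite expr0 !scale1r mul1r expr1 (_ : 'i ^+ (1 + 1) = -1 :> R[i]); last first.
  by rewrite -[(1 + 1)%N]/2%N sqr_i.
rewrite (_ : 'i ^+ (1 + (1 + 1)) = - 'i :> R[i]); last first.
  by rewrite -[(1 + (1 + 1))%N]/3%N exprS sqr_i mulrN1.
rewrite scaleN1r scaleNr /rpol sint.unlock.
move: (\int[rmeasure E (x + z)]_t f t) (\int[rmeasure E (x + 'i *: z)]_t f t)
  (\int[rmeasure E (x - z)]_t f t) (\int[rmeasure E (x - 'i *: z)]_t f t)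
  => A0 A1 A2 A3.
have e4 : (4^-1 : R[i]) = (4^-1 : R)%:C by rewrite fmorphV rmorph_nat.
rewrite e4 !rmorphM !rmorphB /=; ring.
Qed.

Lemma rdom_integrable f x : measurable_fun [set: measurableTypeR R] f ->
  rdom E f x ->
  (rmeasure E x).-integrable setT (EFin \o (fun t => f t ^+ 2)) /\
  (rmeasure E x).-integrable setT (EFin \o f).
Proof.
move=> mf fx; have mf2 : measurable_fun [set: measurableTypeR R] (fun t => f t ^+ 2).
  exact: measurable_funX.
have i2 : (rmeasure E x).-integrable setT (EFin \o (fun t => f t ^+ 2)).
  apply/integrableP; split; first exact/measurable_EFinP.
  by under eq_integral => t _ do rewrite /= ger0_norm ?sqr_ge0//.
split=> //; have i1 : (rmeasure E x).-integrable setT (EFin \o cst 1).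
  apply: measurable_bounded_integrable => //; last exact: bounded_cst.
  exact: rmeasure_lty.
apply: le_integrable (integrableD measurableT i1 i2) => //.
  exact/measurable_EFinP.
move=> t _; rewrite /= lee_fin; rewrite [leRHS]ger0_norm; last first.
  by rewrite addr_ge0 ?sqr_ge0.
rewrite -(real_normK (num_real (f t))); have := sqr_ge0 (`|f t| - 1).
have := normr_ge0 (f t); nra.
Qed.

(** Common interface of the two exhaustions: [s n] lists the intervals of stage n, two when 0 is cut
    out and one when it is kept. *)
Definition exhaustible f := exists s : nat -> seq (R * R),
  [/\ forall n p, p \in s n -> p.1 <= p.2 /\ regular f p.1 p.2,
      forall x, (rmeasure E x).-integrable setT (EFin \o f) ->
        (fun n => \sum_(p <- s n) itvint E f x p.1 p.2) @ \oo -->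
        sint E f x,
      forall x (M : R),
        (forall n, \sum_(p <- s n) itvint E (fun t => f t ^+ 2) x p.1 p.2 <= M) ->
        (\int[rmeasure E x]_t (f t ^+ 2)%:E <= M%:E)%E
    & forall x n, (rmeasure E x).-integrable setT (EFin \o (fun t => f t ^+ 2)) ->
        \sum_(p <- s n) itvint E (fun t => f t ^+ 2) x p.1 p.2 <=
        sint E (fun t => f t ^+ 2) x].

Lemma exhaustible_off0 f : no_atom0 E -> continuous_off0 f -> exhaustible f.
Proof.
move=> na fc; have fc2 := continuous_off0_sqr fc.
exists (fun n => [:: (- n.+1%:R, - n.+1%:R^-1); (n.+1%:R^-1, n.+1%:R)]).
have f20 : forall t, 0 <= f t ^+ 2 by move=> t; exact: sqr_ge0.
split.
- move=> n p; rewrite !inE; have [c1 c2] := cutoff_le R n; have [q1 q2] := cutoff_off0 R n.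
  by move=> /orP[]/eqP ->; split=> //; exact: off0_regular.
- move=> x fi; have := itvint_cvg na fc fi; apply: cvg_trans; apply: near_eq_cvg.
  by apply: nearW => n; rewrite !big_cons big_nil /= addr0.
- move=> x M h; apply: (itvint_bound na fc2) => // n.
  by have := h n; rewrite !big_cons big_nil /= addr0.
- move=> x n fi; have := itvint_le n fc2 f20 fi.
  by rewrite !big_cons big_nil /= addr0.
Qed.

Lemma exhaustible_continuous f : continuous f -> exhaustible f.
Proof.
move=> fc; have fc2 : continuous (fun t => f t ^+ 2).
  have -> : (fun t => f t ^+ 2) = f \* f by apply/funext => u; rewrite expr2.
  by move=> t; apply: continuousM; exact: fc.
have f20 t : 0 <= f t ^+ 2 by exact: sqr_ge0.
exists (fun n => [:: (- n.+1%:R, n.+1%:R)]); split.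
- move=> n p; rewrite !inE => /eqP -> /=; split; last exact: continuous_regular.
  by rewrite (@le_trans _ _ 0)// oppr_le0.
- move=> x fi; have := itvint_cvgT fc fi; apply: cvg_trans; apply: near_eq_cvg.
  by apply: nearW => n; rewrite !big_cons big_nil /= addr0.
- move=> x M h; apply: itvint_boundT => // n.
  by have := h n; rewrite !big_cons big_nil /= addr0.
- move=> x n fi; have := itvint_leT n fc2 f20 fi.
  by rewrite !big_cons big_nil /= addr0.
Qed.

Section Exhaustible.
Variable f : R -> R.
Hypothesis mf : measurable_fun [set: measurableTypeR R] f.
Hypothesis exf : exhaustible f.

(** The parallelogram identity for the integrals of f^2 at each stage bounds both integrals
    uniformly. *)
Lemma rdomDB x z : rdom E f x -> rdom E f z ->
  rdom E f (x + z) /\ rdom E f (x - z).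
Proof.
move=> fx fz; have [s [sle _ bound le]] := exf.
have [x2 _] := rdom_integrable mf fx; have [z2 _] := rdom_integrable mf fz.
pose M : R := 2 * sint E (fun t => f t ^+ 2) x + 2 * sint E (fun t => f t ^+ 2) z.
have par n : \sum_(p <- s n) itvint E (fun t => f t ^+ 2) (x + z) p.1 p.2 +
    \sum_(p <- s n) itvint E (fun t => f t ^+ 2) (x - z) p.1 p.2 <= M.
  have hx := le x n x2; have hz := le z n z2.
  apply: (@le_trans _ _ (2 * \sum_(p <- s n) itvint E (fun t => f t ^+ 2) x p.1 p.2 +
    2 * \sum_(p <- s n) itvint E (fun t => f t ^+ 2) z p.1 p.2)).
    rewrite !mulr_sumr -!big_split /=.
    rewrite [leLHS]big_seq [leRHS]big_seq; apply: ler_sum => p /sle[p12 pr].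
    by rewrite itvint_parallelogram//; exact: regular_sqr.
  by rewrite /M lerD// ler_pM2l.
have ge0 u n : 0 <= \sum_(p <- s n) itvint E (fun t => f t ^+ 2) u p.1 p.2.
  by apply: sumr_ge0 => p _; apply: itvint_ge0 => t; exact: sqr_ge0.
split; apply: le_lt_trans (ltry M); apply: bound => n.
  by apply: le_trans (par n); rewrite lerDl.
by apply: le_trans (par n); rewrite lerDr.
Qed.

Lemma rdom_proj_bound (P : G -> G) x :
  (forall (k : R[i]) x y, P (k *: x + y) = k *: P x + P y) -> symmetric_op P ->
  (forall x, P (P x) = P x) -> (forall a b, commutes P (slab E a b)) ->
  rdom E f x ->
  rdom E f (P x) /\
  sint E (fun t => f t ^+ 2) (P x) <= sint E (fun t => f t ^+ 2) x.
Proof.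
move=> linP sP PP Pc fx; have [s [sle _ bound le]] := exf.
have [x2 _] := rdom_integrable mf fx.
have h : (\int[rmeasure E (P x)]_t (f t ^+ 2)%:E <=
    (sint E (fun t => f t ^+ 2) x)%:E)%E.
  apply: bound => n; apply: le_trans (le x n x2).
  rewrite [leLHS]big_seq [leRHS]big_seq; apply: ler_sum => p /sle[p12 pr].
  rewrite (itvint_pythagoras (P := P) x linP sP PP Pc (regular_sqr pr) p12).
  by rewrite lerDl itvint_ge0// => t; exact: sqr_ge0.
have fPx : rdom E f (P x) by exact: le_lt_trans h (ltry _).
split=> //; have [Px2 _] := rdom_integrable mf fPx.
have fin : (\int[rmeasure E (P x)]_t (f t ^+ 2)%:E)%E \is a fin_num.
  exact: integrable_fin_num.
by move: h; rewrite -(fineK fin) lee_fin sint.unlock.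
Qed.

(** The polarized integral depends only on slabwise products. Hence [E t], which commutes with
    slabs, moves from one argument to the other; this is how an operator integral is seen to commute
    with [E t]. *)
Lemma rpol_eq u v u' v' : rdom E f u -> rdom E f v -> rdom E f u' ->
  rdom E f v' ->
  (forall a b, rdot (slab E a b u) (slab E a b v) =
               rdot (slab E a b u') (slab E a b v')) ->
  rpol f u v = rpol f u' v'.
Proof.
move=> fu fv fu' fv' h; have [s [sle cvgs _ _]] := exf.
have cv w : rdom E f w -> (fun n => \sum_(p <- s n) itvint E f w p.1 p.2) @ \oo -->
        sint E f w.
  by move=> fw; apply: cvgs; case: (rdom_integrable mf fw).
have [fp fm] := rdomDB fu fv; have [fp' fm'] := rdomDB fu' fv'.
congr (_ / 4); apply: rcvg_unique (cvgB (cv _ fp) (cv _ fm)) _.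
apply: cvg_trans (cvgB (cv _ fp') (cv _ fm')); apply: near_eq_cvg.
apply: nearW => n /=; rewrite !fctE.
rewrite -!sumrB big_seq [RHS]big_seq; apply: eq_bigr => p /sle[p12 pr].
have := @itvint_lincomb0 _ _ E f
  [:: (1, u' + v'); (-1, u' - v'); (-1, u + v); (1, u - v)] p.1 p.2 pr p12.
rewrite !big_cons !big_nil /=.
move: (itvint E f (u' + v') p.1 p.2) (itvint E f (u' - v') p.1 p.2).
move: (itvint E f (u + v) p.1 p.2) (itvint E f (u - v) p.1 p.2) => A B C D hh.
suff : 1 * C + (-1 * D + (-1 * A + (1 * B + 0))) = 0 by lra.
apply: hh => a b; rewrite !big_cons !big_nil /=.
rewrite !(linB (slab_lin _ _ _)) !(linD (slab_lin _ _ _)).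
have := h a b.
move: (slab E a b u) (slab E a b v) (slab E a b u') (slab E a b v') => p1 q1 p2 q2 e.
by rewrite !sqnB !sqnD e; ring.
Qed.

End Exhaustible.

Lemma rint_eq f x y : measurable_fun [set: measurableTypeR R] f ->
  (forall w, (forall z, rdom E f z -> rdot w z = 0) -> w = 0) ->
  (forall z, rdom E f z -> '[y, z] = rform E f x z) -> rint E f x = y.
Proof.
move=> mf dns h; rewrite /rint /=; case: xgetP => [y' _ /= h'|/(_ y)//].
apply/eqP; rewrite -subr_eq0; apply/eqP/dns => z fz.
by rewrite rdotBl /rdot h// h'// subrr.
Qed.

Section NoAtom.
Hypothesis na : no_atom0 E.

Lemma cutoff_orth n y :
  sqn (cutoff E n y) = sqn (slab E (- n.+1%:R) (- n.+1%:R^-1) y) +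
    sqn (slab E n.+1%:R^-1 n.+1%:R y) /\ sqn (cutoff E n y) <= sqn y.
Proof.
have [c1 c2] := cutoff_le R n; have i0 : 0 < n.+1%:R^-1 :> R by rewrite invr_gt0.
rewrite /cutoff; move: i0 c1 c2; move: (n.+1%:R^-1) => i.
move: (n.+1%:R) => m i0 c1 c2.
set p := slab E (- m) (- i) y; set r := slab E i m y.
have pr0 : rdot p r = 0.
  rewrite /p /r -slab_sym {1}/slab.
  by rewrite !(slabE_r E) ?subrr ?rdot0l//; lra.
have py : rdot p y = sqn p by rewrite /sqn /p -slab_sym slab_id.
have ry : rdot r y = sqn r by rewrite /sqn /r -slab_sym slab_id.
have e : sqn (p + r) = sqn p + sqn r by rewrite sqnD pr0; ring.
split=> //; have := sqn_ge0 (y - (p + r)).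
by rewrite sqnB rdotC rdotDl py ry e; lra.
Qed.

Lemma density_cutoff f x y n : continuous_off0 f -> spectral_density E f x y ->
  sqn (cutoff E n y) = itvint E (fun t => f t ^+ 2) x (- n.+1%:R) (- n.+1%:R^-1) +
    itvint E (fun t => f t ^+ 2) x n.+1%:R^-1 n.+1%:R.
Proof.
move=> fc d; have [-> _] := cutoff_orth n y.
have [c1 c2] := cutoff_le R n; have [q1 q2] := cutoff_off0 R n.
by congr (_ + _); exact: density_sqn_itvint.
Qed.

Lemma density_rdom f x y : continuous_off0 f -> spectral_density E f x y ->
  rdom E f x.
Proof.
move=> fc d; apply: le_lt_trans (ltry (sqn y)).
apply: (itvint_bound na (continuous_off0_sqr fc)) => [t|n]; first exact: sqr_ge0.
by rewrite -(density_cutoff n fc d); have [] := cutoff_orth n y.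
Qed.

Lemma density_sqn_le f x y : continuous_off0 f -> spectral_density E f x y ->
  sqn y <= sint E (fun t => f t ^+ 2) x.
Proof.
move=> fc d; have fx := density_rdom fc d.
have [x2 _] := rdom_integrable (continuous_off0_measurable fc) fx.
have cl : (fun n => sqn (cutoff E n y)) @ \oo --> sqn y.
  by apply: cvg_sqn; exact: cutoff_cvg.
have cr : (fun _ : nat => sint E (fun t => f t ^+ 2) x) @ \oo -->
  sint E (fun t => f t ^+ 2) x by exact: cvg_cst.
apply: ler_cvg_to cl cr _.
apply: nearW => n; rewrite (density_cutoff n fc d).
by apply: (itvint_le n (continuous_off0_sqr fc)) => // t; exact: sqr_ge0.
Qed.

Lemma density_rpol f x y z : continuous_off0 f -> spectral_density E f x y ->
  rdom E f z -> rdot y z = rpol f x z.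
Proof.
move=> fc d fz; have fx := density_rdom fc d.
have mf := continuous_off0_measurable fc.
have [fp fm] := rdomDB mf (exhaustible_off0 na fc) fx fz.
have [_ ip] := rdom_integrable mf fp; have [_ im] := rdom_integrable mf fm.
have cl : (fun n => rdot (cutoff E n y) z) @ \oo --> rdot y z.
  by apply: cvg_rdotl; exact: cutoff_cvg.
apply: rcvg_unique cl _; rewrite /rpol.
pose J u n := itvint E f u (- n.+1%:R) (- n.+1%:R^-1) +
  itvint E f u n.+1%:R^-1 n.+1%:R.
have h : (fun n => (J (x + z) n - J (x - z) n) * 4^-1) @ \oo -->
    (sint E f (x + z) - sint E f (x - z)) / 4.
  by apply: cvgMr_tmp; apply: cvgB; exact: itvint_cvg.
apply: cvg_trans h; apply: near_eq_cvg; apply: nearW => n /=; rewrite /J.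
have [c1 c2] := cutoff_le R n; have [q1 q2] := cutoff_off0 R n.
rewrite /cutoff rdotDl (density_itvint z fc d q1 c1) (density_itvint z fc d q2 c2).
move: (itvint _ _ _ _ _) (itvint _ _ _ _ _) (itvint _ _ _ _ _) (itvint _ _ _ _ _).
by move=> A B C D; lra.
Qed.

Lemma rdom_i f z : measurable_fun [set: measurableTypeR R] f ->
  rdom E f z -> rdom E f ('i *: z).
Proof.
move=> mf fz; apply: le_lt_trans fz.
rewrite le_eqVlt; apply/orP; left; apply/eqP; apply: eq_measure_integral => A mA _.
apply: eq_rdistr_measure => // t; rewrite !rdistrE.
by rewrite (linZ (resolution_lin E t)) rdotii.
Qed.

Lemma rint_density f x y : continuous_off0 f -> spectral_density E f x y ->
  (forall w, (forall z, rdom E f z -> rdot w z = 0) -> w = 0) ->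
  odom (rint E f) x /\ rint E f x = y.
Proof.
move=> fc d dns; split; first exact: density_rdom d.
have mf := continuous_off0_measurable fc.
apply: (rint_eq mf dns) => z fz.
by rewrite rformE hdotE (density_rpol fc d fz) (density_rpol fc d (rdom_i mf fz)).
Qed.

End NoAtom.
End OperatorIntegral.

(** * Self-adjoint operators as spectral integrals *)

Section SpectralTheorem.
Variables (R : realType) (G : hilbertType R).
Implicit Types (x y z u v w : G) (a b c d t e : R) (n : nat) (T : operator G).

Lemma id_continuous : continuous (@id R). Proof. by move=> t; exact: cvg_id. Qed.
Lemma id_measurable : measurable_fun [set: measurableTypeR R] (@id R).
Proof. exact: measurable_id. Qed.
Lemma id_off0 : continuous_off0 (@id R). Proof. by move=> t _; exact: cvg_id. Qed.

Lemma dense_rdot0 (D : set G) : dense D ->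
  forall w, (forall z, D z -> rdot w z = 0) -> w = 0.
Proof.
move=> dD w h; apply: sqn_le0; rewrite leNgt; apply/negP => w0.
have w4 : 0 < sqn w / 4 by rewrite divr_gt0.
have r0 : 0 < Num.sqrt (sqn w / 4) by rewrite sqrtr_gt0.
have rC : 0 < (Num.sqrt (sqn w / 4))%:C :> R[i] by rewrite ltcR.
have bw : ball w (Num.sqrt (sqn w / 4))%:C !=set0.
  by exists w; exact: ballxx.
have [z [bz Dz]] := dD _ bw (ball_open w _).
move: bz; rewrite -ball_normE /ball_ /= normE ltcR ltr_sqrt// => hz.
have : rdot w w = rdot w (w - z) by rewrite rdotBr (h z Dz) subr0.
have := @rdot_le _ _ 1 w (w - z) ltr01; rewrite invr1 !mul1r -/(sqn w) => + e.
by rewrite -e ger0_norm ?sqn_ge0//; lra.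
Qed.

Lemma slab_super (E : resolution G) a b c d x : a <= c -> c <= d -> d <= b ->
  slab E a b (slab E c d x) = slab E c d x.
Proof.
by move=> ac cd db; rewrite {1}/slab slabE_r// slabE_l// subr0.
Qed.

(** The link between E and T in a form free of integrals: E reduces T, and on the slab ]a, b] the
    operator T differs from the midpoint by at most half the length. *)
Definition resolves (E : resolution G) T :=
  (forall t x, odom T x -> odom T (E t x) /\ T (E t x) = E t (T x)) /\
  (forall a b x, a <= b -> E a x = 0 -> E b x = x -> odom T x /\
     sqn (T x - ((a + b) / 2)%:C *: x) <= ((b - a) / 2) ^+ 2 * sqn x).

Section Resolves.
Variables (E : resolution G) (T : operator G).
Hypotheses (hT : self_adjoint T) (hE : resolves E T).

Let sD := sa_subspace hT.
Let sL := sa_linear hT.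

Lemma resolves_slab a b x : odom T x ->
  odom T (slab E a b x) /\ T (slab E a b x) = slab E a b (T x).
Proof.
move=> dx; have [da Ta] := hE.1 a x dx; have [db Tb] := hE.1 b x dx.
by rewrite /slab; split; [exact: subspaceB|rewrite (linear_onB sD sL)// Ta Tb].
Qed.

Lemma slab_dom a b x : a <= b -> odom T (slab E a b x).
Proof.
by move=> ab; have [] := hE.2 a b _ ab (slabE_l E x (lexx a) ab) (slabE_r E x ab (lexx b)).
Qed.

Lemma resolves_density x : odom T x -> spectral_density E id x (T x).
Proof.
move=> dx; exists (rdistr E x); first exact: rdistr_nd.
(* Both the distance from t to the midpoint and the half-length then have square at most e/4, and
   the two terms contribute e/2 each. *)
move=> t _ e e0; exists (Num.sqrt (e / 4)); first by rewrite sqrtr_gt0 divr_gt0.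
move=> a b at_ bt ab; rewrite -(resolves_slab a b dx).2 -sqn_slab//.
have [_] := hE.2 a b _ ab (slabE_l E x (lexx a) ab) (slabE_r E x ab (lexx b)).
set v := slab E a b x => hv; pose m := (a + b) / 2.
have -> : T v - t%:C *: v = (T v - m%:C *: v) + (m - t)%:C *: v.
  by rewrite rmorphB scalerBl addrA subrK.
apply: le_trans (sqnD_le _ _) _; rewrite sqnZ.
have sq s : `|s| < Num.sqrt (e / 4) -> s ^+ 2 <= e / 4.
  move=> hs; rewrite -(real_normK (num_real s)).
  rewrite -(@sqr_sqrtr _ (e / 4)) ?(divr_ge0 (ltW e0))//.
  by rewrite ler_pXn2r ?nnegrE ?sqrtr_ge0 ?normr_ge0// ltW.
have m1 : (m - t) ^+ 2 <= e / 4.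
  by apply: sq; move: at_ bt; rewrite /m !ltr_norml; lra.
have m2 : ((b - a) / 2) ^+ 2 <= e / 4.
  by apply: sq; move: at_ bt; rewrite !ltr_norml; lra.
by have := sqn_ge0 v; move: hv; rewrite -/m; nra.
Qed.

Lemma slab_decreasing_limit x : exists v,
  (fun n => slab E (- n.+1%:R^-1) n.+1%:R^-1 x) @ \oo --> v /\
  forall n, slab E (- n.+1%:R^-1) n.+1%:R^-1 v = v.
Proof.
have i0 n : 0 < n.+1%:R^-1 :> R by rewrite invr_gt0.
have ii n k : (n <= k)%N -> k.+1%:R^-1 <= n.+1%:R^-1 :> R.
  by move=> nk; rewrite lef_pV2 ?posrE ?ltr0n// ler_nat ltnS.
pose s n := slab E (- n.+1%:R^-1) n.+1%:R^-1.
have s_le n : - n.+1%:R^-1 <= n.+1%:R^-1 :> R by have := i0 n; move: (n.+1%:R^-1) => i; lra.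
have ss n k y : (n <= k)%N -> s n (s k y) = s k y.
  by move=> nk; rewrite /s slab_super ?lerN2 ?ii.
have sE n k y : (n <= k)%N -> sqn (s k y - s n y) = sqn (s n y) - sqn (s k y).
  move=> nk; rewrite sqnB; suff -> : rdot (s k y) (s n y) = sqn (s k y) by ring.
  by rewrite /sqn /s -slab_sym slab_super ?lerN2 ?ii// -[RHS]slab_sym slab_id.
have [v hv] : exists v : G, s^~ x @ \oo --> v.
  apply: (@monotone_cauchy _ _ _ (fun n => - sqn (s n x)) 0) => [n k nk|n].
    by rewrite sE//; lra.
  by rewrite oppr_le0 sqn_ge0.
exists v; split=> // n.
have h : (s n \o s^~ x) @ \oo --> s n v.
  by apply: contraction_cvg => //; exact: slab_contraction.
apply: hcvg_unique h _; apply: cvg_trans hv; apply: near_eq_cvg.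
by exists n => // k nk /=; rewrite -/(s n) ss.
Qed.

Hypothesis injT : invertible T.

(** The limit v lies in every slab around 0, so the norm of [T v] is at most 1/(n+1) times that of v
    for all n; injectivity of T gives v = 0. *)
Lemma resolves_no_atom0 : no_atom0 E.
Proof.
move=> x; have [v [hv sv]] := slab_decreasing_limit x.
suff v0 : v = 0 by rewrite -{1}v0.
have i0 n : 0 < n.+1%:R^-1 :> R by rewrite invr_gt0.
have s_le n : - n.+1%:R^-1 <= n.+1%:R^-1 :> R by have := i0 n; move: (n.+1%:R^-1) => i; lra.
have est n : odom T v /\ sqn (T v) <= n.+1%:R^-1 ^+ 2 * sqn v.
  have ea : E (- n.+1%:R^-1) v = 0 by rewrite -(sv n) slabE_l.
  have eb : E n.+1%:R^-1 v = v by rewrite -{1}(sv n) slabE_r.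
  have [dv h] := hE.2 _ _ v (s_le n) ea eb; split=> //.
  move: h; rewrite addNr mul0r scale0r subr0 opprK => h.
  apply: le_trans h _; move: (n.+1%:R^-1) (sqn v) => i q.
  by have -> : (i + i) / 2 = i by field.
have dv : odom T v by case: (est 0%N).
apply: injT => //; apply: sqn_le0; apply/ler_addgt0Pr => e e0; rewrite add0r.
have k0 : 0 < sqn v + 1 by rewrite ltr_wpDl ?sqn_ge0.
have [n _ /(_ n (leqnn n)) hn] := near_infty_natSinv_lt (PosNum (divr_gt0 e0 k0)).
have [_ h] := est n; apply: le_trans h _.
move: hn => /=; rewrite ltr_pdivlMr// => hn.
have i1 : n.+1%:R^-1 <= 1 :> R by rewrite invf_le1 ?ltr0n// ler1n.
have := sqn_ge0 v; have := i0 n; move: (n.+1%:R^-1) (sqn v) hn i1 => i q; nra.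
Qed.

(** For the converse, the truncations of x to ]-n, n] have images under T with orthogonal increments
    and norms bounded by the integral of t^2. They converge, and T is closed. *)
Lemma resolves_rdom x : odom T x <-> rdom E id x.
Proof.
have na := resolves_no_atom0.
split=> [dx|fx].
  exact: (density_rdom na id_off0 (resolves_density dx)).
have nN n : - n%:R <= n%:R :> R by rewrite (@le_trans _ _ 0)// oppr_le0.
pose u n := slab E (- n%:R) n%:R x.
have ux : u @ \oo --> x.
  have h1 : (fun n => E n%:R x) @ \oo --> x.
    by apply: cvg_comp (@rproj_pinfty _ _ E x); exact: cvgr_idn.
  have h2 : (fun n => E (- n%:R) x) @ \oo --> (0 : G).
    apply: cvg_comp (@rproj_ninfty _ _ E x); apply/cvgNry.
    rewrite (_ : - _ = fun n => n%:R); last by apply/funext => n /=; rewrite opprK.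
    exact: cvgr_idn.
  by rewrite -[X in _ --> X]subr0; exact: cvgB.
have du n : odom T (u n) by exact: slab_dom.
have ss n k : (n <= k)%N -> slab E (- n%:R) n%:R (u k) = u n.
  move=> nk; have hk : n%:R <= k%:R :> R by rewrite ler_nat.
  by rewrite /u slab_comm slab_super ?lerN2.
have Tss n k : (n <= k)%N -> slab E (- n%:R) n%:R (T (u k)) = T (u n).
  by move=> nk; rewrite -(resolves_slab _ _ (du k)).2 ss.
pose M := sint E (fun t => t ^+ 2) x.
have Tu n : sqn (T (u n)) <= M.
  apply: le_trans (density_sqn_le na id_off0 (resolves_density (du n))) _.
  have Pc a b : commutes (slab E (- n%:R) n%:R) (slab E a b).
    by move=> y; exact: slab_comm.
  have [_ h] := rdom_proj_bound id_measurable (exhaustible_continuous E id_continuous)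
    (slab_lin E _ _) (slab_sym E _ _) (fun y => slab_id E y (nN n)) Pc fx.
  exact: h.
have [v hv] : exists v : G, (fun n => T (u n)) @ \oo --> v.
  apply: (@monotone_cauchy _ _ _ (fun n => sqn (T (u n))) M) => // n k nk.
  have e : rdot (T (u k)) (T (u n)) = sqn (T (u n)).
    by rewrite -(Tss n k nk) /sqn -[RHS]slab_sym slab_id// -[LHS]slab_sym.
  by rewrite sqnB e; lra.
by have [] := sa_closed hT du ux hv.
Qed.

Lemma resolves_rint : oeq T (rint E id).
Proof.
have na := resolves_no_atom0.
have dns w : (forall z, rdom E id z -> rdot w z = 0) -> w = 0.
  move=> h; have [_ _ dT _] := hT; apply: (dense_rdot0 dT) => z /resolves_rdom.
  exact: h.
split; first by apply/seteqP; split=> x /resolves_rdom.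
move=> x /resolves_rdom dx; have [_ ->//] := rint_density na id_off0 (resolves_density dx) dns.
Qed.

End Resolves.

Theorem spectral_theorem T : self_adjoint T -> invertible T ->
  exists E : resolution G, oeq T (rint E id).
Proof.
move=> hT injT; have [E hE] := spectral_resolution_exists hT.
by exists E; exact: resolves_rint.
Qed.

End SpectralTheorem.

(** * Localization of H by any resolution that integrates to it *)

Section Reconstruction.
Variables (R : realType) (G : hilbertType R) (E : resolution G).
Implicit Types (x y z u v w : G) (a b c d p q t e k : R) (f : R -> R) (n : nat).

Lemma eq_rdistr_sint f x y : rdistr E x =1 rdistr E y -> sint E f x = sint E f y.
Proof.
move=> xy; rewrite sint.unlock /Rintegral (eq_measure_integral (rmeasure E y))//.
by move=> A mA _; exact: eq_rdistr_measure.
Qed.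

Lemma rpol0l f z : rpol E f 0 z = 0.
Proof.
rewrite /rpol add0r sub0r (@eq_rdistr_sint f (- z) z) ?subrr ?mul0r// => t.
by rewrite !rdistrE (linN (resolution_lin E t)) rdotNl rdotNr opprK.
Qed.

Lemma itvint_slab0 f x a b : regular f a b -> a <= b -> slab E a b x = 0 ->
  itvint E f x a b = 0.
Proof.
move=> fr ab x0; have [M hM] := regular_bounded fr.
have := @itvint_near _ _ E f x a b 0 M fr ab.
rewrite x0 sqn0 !mulr0 subr0 normr_le0 => h; apply/eqP/h => t tab.
by rewrite subr0; exact: hM.
Qed.

Section Support.
Variables (w : G) (a b : R).
Hypotheses (ab : a <= b) (aw : E a w = 0) (bw : E b w = w).

Let wE : slab E a b w = w. Proof. by rewrite /slab aw bw subr0. Qed.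

Lemma itvint_support f p q : continuous f -> p <= a -> b <= q ->
  itvint E f w p q = itvint E f w a b.
Proof.
move=> fc pa bq; have fr s t := continuous_regular s t fc.
rewrite (itvint_cat E w (fr p q) pa (le_trans ab bq)).
rewrite (itvint_cat E w (fr a q) ab bq).
rewrite (itvint_slab0 (fr p a) pa) ?add0r; last first.
  by rewrite /slab aw -wE slabE_l ?subrr.
by rewrite (itvint_slab0 (fr b q) bq) ?addr0// /slab bw -{1}wE slabE_r// wE subrr.
Qed.

Let large : exists N : nat, forall n, (N <= n)%N -> - n.+1%:R <= a /\ b <= n.+1%:R.
Proof.
pose m := `|a| + `|b|; have m0 : 0 <= m by rewrite addr_ge0.
have := archi_boundP m0; set N := Num.bound _ => hN; exists N => n Nn.
have l : m <= n.+1%:R.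
  by apply: le_trans (ltW hN) _; rewrite ler_nat leqW.
have := ler_norm b; have := ler_norm (- a); rewrite normrN => h1 h2.
by move: l h1 h2; rewrite /m; have := normr_ge0 a; have := normr_ge0 b;
  move: (`|a|) (`|b|) (n.+1%:R) => A B C; split; lra.
Qed.

Lemma rdom_support f : continuous f -> rdom E f w.
Proof.
move=> fc; have fc2 : continuous (fun t => f t ^+ 2).
  have -> : (fun t => f t ^+ 2) = f \* f by apply/funext => u; rewrite expr2.
  by move=> t; apply: continuousM; exact: fc.
have f20 t : 0 <= f t ^+ 2 by exact: sqr_ge0.
have [N hN] := large; apply: le_lt_trans (ltry (itvint E (fun t => f t ^+ 2) w a b)).
apply: itvint_boundT => // n; have [h1 h2] := hN _ (leq_maxr n N).
rewrite -(itvint_support fc2 h1 h2).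
have nm : n.+1%:R <= (maxn n N).+1%:R :> R by rewrite ler_nat ltnS leq_maxl.
have n0 : - n.+1%:R <= n.+1%:R :> R by rewrite (@le_trans _ _ 0)// oppr_le0.
have fr s t := continuous_regular s t fc2.
have nm' : - (maxn n N).+1%:R <= - n.+1%:R :> R by rewrite lerN2.
rewrite (itvint_cat E w (fr _ _) nm' (le_trans n0 nm)).
rewrite (itvint_cat E w (fr _ _) n0 nm).
have := itvint_ge0 E w (- (maxn n N).+1%:R) (- n.+1%:R) f20.
have := itvint_ge0 E w n.+1%:R (maxn n N).+1%:R f20.
move: (itvint _ _ _ _ _) (itvint _ _ _ _ _) (itvint _ _ _ _ _) => A B C; lra.
Qed.

Lemma sint_support f : continuous f -> sint E f w = itvint E f w a b.
Proof.
move=> fc; have mf := continuous_measurable_fun fc.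
have [_ fi] := rdom_integrable mf (rdom_support fc).
have [N hN] := large; apply: rcvg_unique (itvint_cvgT fc fi) _.
apply: cvg_near_cst; exists N => // n /hN[h1 h2] /=; exact: itvint_support.
Qed.

Lemma sint_near f k e : continuous f ->
  (forall t, a <= t <= b -> `|f t - k| <= e) ->
  `|sint E f w - k * sqn w| <= e * sqn w.
Proof.
move=> fc h; rewrite sint_support// -[in X in k * X]wE -[in leRHS]wE.
by apply: itvint_near => //; exact: continuous_regular.
Qed.

End Support.

Variable H : operator G.
Hypotheses (hH : self_adjoint H) (injH : invertible H) (HE : oeq H (rint E id)).

Let sD := sa_subspace hH.
Let sL := sa_linear hH.

Let domH x : odom H x <-> rdom E id x.
Proof. by case: HE => ->. Qed.

(* Invertibility of H guarantees that the vector picked by rint exists: the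
   default value 0 is taken by H only at 0. *)
Lemma rint_pairing x z : odom H x -> odom H z -> rdot (H x) z = rpol E id x z.
Proof.
move=> dx /domH dz; have [_ HEx] := HE.
have Hx := HEx x ((domH x).1 dx); rewrite /rint /= in Hx.
have RE u s1 s2 : '[u, z] = (s1)%:C + 'i * (s2)%:C -> rdot u z = s1.
  by rewrite /rdot => -> /=; ring.
move: Hx; case: xgetP => [y _ /= hy ->|no Hx0].
  by apply: RE; rewrite hy// rformE.
have x0 := injH dx Hx0; rewrite x0 (linear_on0 sD sL).
by rewrite rpol0l rdot0l.
Qed.

Let eid := exhaustible_continuous E (@id_continuous R).
Let mid := @id_measurable R.

Let Eslab t a b : commutes (E t) (slab E a b).
Proof.
by move=> x; rewrite /slab !(linB (resolution_lin _ _)) !rproj_mul !(minC t).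
Qed.

Let dns w : (forall z, odom H z -> rdot w z = 0) -> w = 0.
Proof. by have [_ _ dH _] := hH; exact: dense_rdot0. Qed.

Let Hcomm t x : odom H x -> odom H (E t x) /\ H (E t x) = E t (H x).
Proof.
have Edom y : odom H y -> odom H (E t y).
  move=> /domH dy; apply/domH.
  have [] // := @rdom_proj_bound _ _ E id mid eid (E t) y (resolution_lin E t)
    (resolution_sym E t) (resolution_id E t) (Eslab t) dy.
move=> dx; have dEx := Edom x dx; split=> //.
apply/eqP; rewrite -subr_eq0; apply/eqP/dns => z dz; have dEz := Edom z dz.
rewrite rdotBl resolution_sym !rint_pairing//.
rewrite (@rpol_eq _ _ E id mid eid (E t x) z x (E t z)) ?subrr//;
  try by apply/domH.
by move=> a b; rewrite -!Eslab resolution_sym.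
Qed.

(** On the slab the quadratic form of H - m is bounded by e. Polarizing it at x and [v = s r], with
    [r = (H - m) x], gives [2 s |r|^2 <= e (|x|^2 + s^2 |r|^2)], and s = 1/e yields
    [|r| <= e |x|]. *)
Lemma rint_resolves : resolves E H.
Proof.
split=> [t x|a b x ab xa xb]; first exact: Hcomm.
have dM w : E a w = 0 -> E b w = w -> odom H w.
  by move=> wa wb; apply/domH; apply: (rdom_support ab wa wb); exact: id_continuous.
have dx := dM x xa xb; split=> //.
set m := (a + b) / 2; set e := (b - a) / 2; set r := H x - m%:C *: x.
have e0 : 0 <= e by rewrite /e; lra.
have near w : E a w = 0 -> E b w = w -> `|sint E id w - m * sqn w| <= e * sqn w.
  move=> wa wb; apply: (sint_near ab wa wb) => [|t /andP[h1 h2]].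
    exact: id_continuous.
  by rewrite ler_norml /m /e; apply/andP; split; lra.
have ra : E a r = 0.
  rewrite /r (linB (resolution_lin _ _)) (linZ (resolution_lin _ _)) xa.
  by rewrite -(Hcomm a dx).2 xa (linear_on0 sD sL) scaler0 subrr.
have rb : E b r = r.
  rewrite /r (linB (resolution_lin _ _)) (linZ (resolution_lin _ _)) xb.
  by rewrite -(Hcomm b dx).2 xb.
have key s : 2 * s * sqn r <= e * (sqn x + s ^+ 2 * sqn r).
  set v := s%:C *: r.
  have va : E a v = 0 by rewrite /v (linZ (resolution_lin _ _)) ra scaler0.
  have vb : E b v = v by rewrite /v (linZ (resolution_lin _ _)) rb.
  have n1 := near (x + v); have n2 := near (x - v).
  rewrite (linD (resolution_lin _ _)) (linD (resolution_lin _ _)) xa va xb vb addr0 in n1.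
  rewrite (linB (resolution_lin _ _)) (linB (resolution_lin _ _)) xa va xb vb subr0 in n2.
  have {}n1 := n1 erefl erefl; have {}n2 := n2 erefl erefl.
  have pr : rdot (H x) v = (sint E id (x + v) - sint E id (x - v)) / 4.
    by rewrite rint_pairing//; exact: dM.
  have e1 : rdot r v = s * sqn r by rewrite /v rdotZr.
  have e2 : rdot r v = rdot (H x) v - m * rdot x v by rewrite {1}/r rdotBl rdotZl.
  have e3 : sqn v = s ^+ 2 * sqn r by rewrite /v sqnZ.
  move: n1 n2; rewrite sqnD sqnB !ler_norml => /andP[_ n1] /andP[n2 _].
  rewrite -e3; move: e2; rewrite e1 pr => e2; rewrite -mulrA e2; move: n1 n2.
  move: (sint E id (x + v)) (sint E id (x - v)) (rdot x v) (sqn x) (sqn v) => A B C D F.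
  lra.
(* The choice s = 1/e needs e nonzero; e = 0 means a = b, and the slab is trivial. *)
have [e00|e_neq0] := eqVneq e 0.
  have ba : b = a by move: e00; rewrite /e; lra.
  have x0 : x = 0 by rewrite -xb ba xa.
  by rewrite /r x0 (linear_on0 sD sL) scaler0 subrr !sqn0 mulr0.
have ep : 0 < e by rewrite lt_neqAle eq_sym e_neq0.
have := key e^-1; have -> : e * (sqn x + e^-1 ^+ 2 * sqn r) = e * sqn x + e^-1 * sqn r.
  by field.
move=> h; have {}h : e^-1 * sqn r <= e * sqn x by lra.
by move: h; rewrite ler_pdivrMl// mulrA -expr2.
Qed.

End Reconstruction.

(** * Smooth vectors and the root operators *)

Section SmoothVectors.
Variables (R : realType) (G : hilbertType R).
Implicit Types (x y z u v w : G) (a b t k : R) (n : nat) (T H : operator G).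

Lemma oexpS T n x : odom (oexp T n.+1) x <-> odom (oexp T n) x /\ odom T (oexp T n x).
Proof. by []. Qed.

Lemma oexpSE T n x : oexp T n.+1 x = oexp T n (T x).
Proof. by elim: n x => [//|n IH] x; rewrite -[LHS]/(T (oexp T n.+1 x)) IH. Qed.

Lemma oexpSr T n x :
  odom (oexp T n.+1) x <-> odom T x /\ odom (oexp T n) (T x).
Proof.
elim: n => [|n IH]; first by split=> // -[].
split=> [/oexpS[/IH[d1 d2]]|[d1 /oexpS[d2 d3]]].
  by rewrite oexpSE => d3; split=> //; apply/oexpS.
by apply/oexpS; rewrite oexpSE; split=> //; apply/IH.
Qed.

Lemma oexp_invariant T (M : set G) : (forall w, M w -> odom T w /\ M (T w)) ->
  forall n w, M w -> odom (oexp T n) w /\ M (oexp T n w).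
Proof.
move=> h; elim=> [//|n IH] w Mw; have [d Mn] := IH w Mw.
by have [d' M'] := h _ Mn; split=> //; apply/oexpS.
Qed.

Definition reduces (V : G -> G) T :=
  forall x, odom T x -> odom T (V x) /\ T (V x) = V (T x).

Lemma oexp_reduces V T n : reduces V T -> reduces V (oexp T n).
Proof.
move=> h; elim: n => [//|n IH] x /oexpS[d1 d2].
have [e1 e2] := IH x d1; have [e3 e4] := h _ d2.
split; first by apply/oexpS; rewrite e2.
by rewrite -[LHS]/(T (oexp T n (V x))) e2 e4.
Qed.

Section Invertible.
Variable H : operator G.
Hypotheses (sD : subspace (odom H)) (sL : linear_on (odom H) H) (injH : invertible H).

Let D0 := odom_infty H.

Lemma inj_on_dom x y : odom H x -> odom H y -> H x = H y -> x = y.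
Proof.
move=> dx dy e; apply/eqP; rewrite -subr_eq0; apply/eqP/injH.
  exact: subspaceB.
by rewrite (linear_onB sD sL)// e subrr.
Qed.

Lemma oinvP x : odom H x -> odom (oinv H) (H x) /\ oinv H (H x) = x.
Proof.
move=> dx; split; first by exists x.
by rewrite /oinv /=; case: xgetP => [y _ [dy /inj_on_dom]|/(_ x)[]//]; apply.
Qed.

Lemma oinv_val y : odom (oinv H) y -> odom H (oinv H y) /\ H (oinv H y) = y.
Proof. by move=> [x dx <-]; have [_ ->] := oinvP dx. Qed.

Lemma infty_dom x : D0 x -> odom H x /\ D0 (H x).
Proof.
move=> dx; have dHx : odom H x by have [/oexpSr[]] := dx 1%N.
split=> // k; split.
  by have [/oexpSr[]] := dx k.+1.
case: k => [//|k]; apply/oexpSr; have [d e] := oinvP dHx; rewrite e.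
by split=> //; have [] := dx k.
Qed.

Lemma infty_inv x : D0 x -> odom (oinv H) x /\ D0 (oinv H x).
Proof.
move=> dx; have dHx : odom (oinv H) x by have [_ /oexpSr[]] := dx 1%N.
have [d e] := oinv_val dHx.
split=> // k; split; last by have [_ /oexpSr[]] := dx k.+1.
case: k => [//|k]; apply/oexpSr; rewrite e.
by split=> //; have [] := dx k.
Qed.

Lemma inftyK x : D0 x -> H (oinv H x) = x.
Proof. by move=> /infty_inv[/oinv_val[]]. Qed.

Lemma infty_invK x : D0 x -> oinv H (H x) = x.
Proof. by move=> /infty_dom[/oinvP[]]. Qed.

Lemma reduces_oinv V : reduces V H -> reduces V (oinv H).
Proof.
move=> h x /oinv_val[d e]; have [d' e'] := h _ d.
by rewrite -{1 2}e -e'; have [] := oinvP d'.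
Qed.

Lemma infty_reduces V : reduces V H -> forall x, D0 x -> D0 (V x).
Proof.
move=> h x dx k; have [d1 d2] := dx k; split.
  by have [] := oexp_reduces h d1.
by have [] := oexp_reduces (reduces_oinv h) d2.
Qed.

Lemma linear_oexp T n : subspace (odom T) -> linear_on (odom T) T ->
  subspace (odom (oexp T n)) /\ linear_on (odom (oexp T n)) (oexp T n).
Proof.
move=> sT lT; elim: n => [//|n [IHs IHl]]; split.
  split; first by apply/oexpS; rewrite (linear_on0 IHs IHl); split; exact: subspace0.
  move=> a x y /oexpS[x1 x2] /oexpS[y1 y2]; apply/oexpS; rewrite IHl//.
  by split; [case: IHs => _|case: sT => _]; apply.
move=> a x y /oexpS[x1 x2] /oexpS[y1 y2].
by rewrite -[LHS]/(T (oexp T n _)) IHl// lT.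
Qed.

Lemma oinv_linear : subspace (odom (oinv H)) /\ linear_on (odom (oinv H)) (oinv H).
Proof.
have key (a : R[i]) x y : odom (oinv H) x -> odom (oinv H) y ->
    odom (oinv H) (a *: x + y) /\ oinv H (a *: x + y) = a *: oinv H x + oinv H y.
  move=> /oinv_val[dx ex] /oinv_val[dy ey].
  have dxy : odom H (a *: oinv H x + oinv H y) by case: sD => _; apply.
  by rewrite -{1 2}ex -{1 2}ey -sL//; exact: oinvP.
split; last by move=> a x y dx dy; have [] := key a x y dx dy.
split; last by move=> a x y dx dy; have [] := key a x y dx dy.
by exists 0; [exact: subspace0|exact: linear_on0 sL].
Qed.

Lemma infty_subspace : subspace D0.
Proof.
have [si li] := oinv_linear.
have s1 (k : nat) := (linear_oexp k sD sL).1; have s2 (k : nat) := (linear_oexp k si li).1.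
split=> [k|a x y dx dy k]; first by split; exact: subspace0.
have [x1 x2] := dx k; have [y1 y2] := dy k.
by split; [case: (s1 k) => _|case: (s2 k) => _]; apply.
Qed.

End Invertible.

Section SelfAdjointInvertible.
Variables (H : operator G) (E : resolution G).
Hypotheses (hH : self_adjoint H) (injH : invertible H) (hE : resolves E H).

Let sD := sa_subspace hH.
Let sL := sa_linear hH.
Let D0 := odom_infty H.

Section Window.
Variables a b : R.
Hypotheses (ab : a <= b) (ab0 : off0 a b).

Let M w := E a w = 0 /\ E b w = w.

Let m := (a + b) / 2.
Let e := (b - a) / 2.

Let sM : subspace M.
Proof.
split=> [|k x y [x1 x2] [y1 y2]].
  by split; rewrite (lin0 (resolution_lin E _)).
by split; rewrite !resolution_lin ?x1 ?x2 ?y1 ?y2 ?scaler0 ?addr0.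
Qed.

Let Mdom w : M w -> odom H w /\ sqn (H w - m%:C *: w) <= e ^+ 2 * sqn w.
Proof. by move=> [w1 w2]; exact: hE.2. Qed.

Let MH w : M w -> odom H w /\ M (H w).
Proof.
move=> [w1 w2]; have [dw _] := Mdom (conj w1 w2); split=> //.
by split; rewrite -(hE.1 _ _ dw).2 ?w1 ?w2// (linear_on0 sD sL).
Qed.

(** As [m ^+ 2 - e ^+ 2 = a * b > 0], the midpoint bound gives
    [|H w|^2 + a b |w|^2 <= 2 m <H w, w>]. Young's inequality with weight [a b / (2 |m|)] absorbs
    half of the term in [|w|^2], which produces K. *)
Let coercive : exists2 K, 0 < K & forall w, M w -> sqn w <= K * sqn (H w).
Proof.
have abp : 0 < a * b.
  case: ab0 => h.
    by apply: mulr_gt0 => //; exact: lt_le_trans h ab.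
  by rewrite nmulr_rgt0 //; exact: le_lt_trans ab h.
have [a0 b0] : a != 0 /\ b != 0.
  by split; apply/eqP => z; move: abp; rewrite z ?mul0r ?mulr0 ltxx.
have m0 : 0 < `|m|.
  rewrite normr_gt0 /m; apply/eqP => h.
  by case: ab0 => h'; move: h h' ab; lra.
exists ((2 * `|m| / (a * b)) ^+ 2); first by rewrite exprn_gt0// divr_gt0// mulr_gt0.
move=> w /Mdom[dw]; rewrite sqnB sqnZ rdotZr => h.
have d0 : 0 < a * b / (2 * `|m|) by rewrite divr_gt0// mulr_gt0.
have := rdot_le w (H w) d0; rewrite invf_div (rdotC w).
have h1 : m * rdot (H w) w <= `|m| * `|rdot (H w) w| by rewrite -normrM ler_norm.
have mm : `|m| ^+ 2 = m ^+ 2 by rewrite real_normK ?num_real.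
have me : m ^+ 2 - e ^+ 2 = a * b by rewrite /m /e; field.
set s := `|rdot (H w) w| in h1 *; set A := sqn w in h *; set C := sqn (H w) in h *.
move=> h2; have C0 : 0 <= C by exact: sqn_ge0.
have h3 : `|m| * (2 * s) <= `|m| * (a * b / (2 * `|m|) * A + 2 * `|m| / (a * b) * C).
  by rewrite ler_pM2l.
have e3 : `|m| * (a * b / (2 * `|m|) * A + 2 * `|m| / (a * b) * C) =
    a * b * A / 2 + 2 * (`|m| ^+ 2 / (a * b) * C).
  by field; rewrite (gt_eqF m0) a0 b0.
rewrite e3 in h3.
have h4 : a * b * A <= 4 * (`|m| ^+ 2 / (a * b) * C).
  have e4 : a * b * A = m ^+ 2 * A - e ^+ 2 * A by rewrite -me mulrBl.
  rewrite real_normK ?num_real // in h3 *; move: h h1 h3 C0 e4.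
  move: (m ^+ 2 / _ * C) (a * b * A) => W V.
  lra.
have -> : (2 * `|m| / (a * b)) ^+ 2 * C = (4 * (`|m| ^+ 2 / (a * b) * C)) / (a * b).
  by field; rewrite a0 b0.
by rewrite ler_pdivlMr// mulrC.
Qed.

(** The residual [r = h - H x] of the least-squares problem is orthogonal to the image of M, so
    [<H r, H r> = <r, H (H r)> = 0] and r = 0. Coercivity makes minimizing sequences converge. *)
Let surj h : M h -> exists2 x, M x & H x = h.
Proof.
move=> Mh; have [K K0 hK] := coercive.
have lM : linear_on M H by move=> k x y /MH[dx _] /MH[dy _]; exact: sL.
have l0 : linear_on M (fun _ => 0 : G) by move=> k x y _ _; rewrite scaler0 addr0.
have [|x Mx hx] := least_squares sM lM l0 h.
  move=> u v w Mu Huv uw.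
  have w0 : 0 = w by apply: hcvg_unique uw; exact: cvg_cst.
  have [x ux] : exists x : G, u @ \oo --> x.
    apply: sqn_cauchy => d d0; have dk : 0 < d / K / 4 by rewrite !divr_gt0.
    have /cvg_rnormP/(_ _ dk)[N _ hN] := Huv; exists N => n k Nn Nk.
    apply: le_lt_trans (hK _ (subspaceB sM (Mu n) (Mu k))) _.
    have [[dn _] [dk' _]] := (MH (Mu n), MH (Mu k)).
    rewrite (linear_onB sD sL)// mulrC -ltr_pdivlMr//.
    rewrite -(subrKA v) -(opprB (H (u k)) v); apply: le_lt_trans (sqnB_le _ _) _.
    by have := hN _ Nn; have := hN _ Nk; rewrite /=; lra.
  have du n : odom H (u n) by case: (MH (Mu n)).
  have [dx Hx] := sa_closed hH du ux Huv; exists x; split=> //; split.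
    have c : (E a \o u) @ \oo --> E a x.
      by apply: contraction_cvg => //; exact: resolution_contraction.
    apply: hcvg_unique c _; apply: cvg_near_cst; apply: nearW => n.
    by have [] := Mu n.
  have c : (E b \o u) @ \oo --> E b x.
    by apply: contraction_cvg => //; exact: resolution_contraction.
  apply: hcvg_unique c _; apply: cvg_trans ux; apply: near_eq_cvg.
  by apply: nearW => n /=; have [] := Mu n.
exists x => //; have [dx MHx] := MH Mx.
have Mr : M (h - H x) by exact: subspaceB.
have [dr MHr] := MH Mr.
apply/esym/eqP; rewrite -subr_eq0; apply/eqP/injH => //.
apply: sqn_le0; rewrite /sqn sa_symmetric//; last by have [] := MH MHr.
by rewrite hx// rdot0l.
Qed.

Lemma slab_infty x : D0 (slab E a b x).
Proof.
have Mx : M (slab E a b x) by split; [exact: slabE_l|exact: slabE_r].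
move=> k; split; first by have [] := oexp_invariant MH k Mx.
have MHi w : M w -> odom (oinv H) w /\ M (oinv H w).
  by move=> /surj[u Mu <-]; have [du _] := MH Mu;
    have [d ->] := oinvP sD sL injH du.
by have [] := oexp_invariant MHi k Mx.
Qed.

End Window.

Lemma infty_dense : forall x, exists2 u : nat -> G, (forall n, D0 (u n)) & u @ \oo --> x.
Proof.
move=> x; have na := resolves_no_atom0 hE injH.
exists (fun n => cutoff E n x); last exact: cutoff_cvg.
move=> n; have [c1 c2] := cutoff_le R n; have [q1 q2] := cutoff_off0 R n.
by apply: (subspaceD (infty_subspace sD sL injH)); exact: slab_infty.
Qed.

End SelfAdjointInvertible.

End SmoothVectors.

(** * The roots on smooth vectors *)

Section RootOperator.
Variables (R : realType) (G : hilbertType R).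
Implicit Types (x y z u v w : G) (t r : R) (H : operator G).

Lemma sqn_convex r x y (M : R) : 0 <= r <= 1 -> sqn x <= M -> sqn y <= M ->
  sqn (r%:C *: x + (1 - r)%:C *: y) <= M.
Proof.
move=> /andP[r0 r1] xM yM; rewrite sqnD !sqnZ rdotZl rdotZr.
have := sqn_ge0 (x - y); rewrite sqnB.
have p0 : 0 <= r * (1 - r) by rewrite mulr_ge0// subr_ge0.
have r10 : 0 <= 1 - r by rewrite subr_ge0.
move: (sqn x) (sqn y) (rdot x y) xM yM => a b d xM yM h.
have h1 : r * (1 - r) * (2 * d) <= r * (1 - r) * (a + b) by apply: ler_wpM2l => //; lra.
have h2 : r * a <= r * M by apply: ler_wpM2l.
have h3 : (1 - r) * b <= (1 - r) * M by apply: ler_wpM2l.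
nra.
Qed.

Lemma complement_contraction (B : G -> G) : contraction B -> symmetric_op B ->
  positive_op B -> contraction (fun x => x - B x) /\ symmetric_op (fun x => x - B x).
Proof.
move=> cB sB pB; split; last by move=> x y; rewrite rdotBl rdotBr sB.
split=> [k x y|x]; first by rewrite cB.1 opprD addrACA -scalerBr.
rewrite sqnB (rdotC x); have := positive_contraction cB sB pB x; have := pB x; lra.
Qed.

(** Applied with r = alpha / (1 + alpha): the normalization turns alpha (1 - B)^2 + B^2 into a
    convex combination of contractions, as [positive_sqrt] requires. *)
Lemma sqrt_mix (B : G -> G) r : 0 <= r <= 1 -> contraction B -> symmetric_op B ->
  positive_op B -> exists Y : G -> G,
  [/\ contraction Y, symmetric_op Y, positive_op Y,
      forall x, Y (Y x) = r%:C *: (x - B x - B (x - B x)) + (1 - r)%:C *: B (B x)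
    & forall V, contraction V -> commutes V B -> commutes V Y].
Proof.
move=> r01 cB sB pB; have [cU sU] := complement_contraction cB sB pB.
have [r0 r1] := andP r01.
have [|||Y [cY sY pY YY comY]] := @positive_sqrt _ _
    (fun x => r%:C *: (x - B x - B (x - B x)) + (1 - r)%:C *: B (B x)).
- split=> [k x y|x]; last first.
    apply: sqn_convex => //; first exact: le_trans (cU.2 _) (cU.2 _).
    exact: le_trans (cB.2 _) (cB.2 _).
  have e : k *: x + y - B (k *: x + y) = k *: (x - B x) + (y - B y) by exact: cU.1.
  rewrite e !cB.1 opprD addrACA -scalerBr !scalerDr addrACA !scalerA.
  by rewrite [_ * k]mulrC [(1 - r)%:C * k]mulrC -!scalerA.
- move=> x y; rewrite [LHS]rdotDl [RHS]rdotDr !rdotZl !rdotZr !sB.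
  by have := sU (x - B x) y => /= ->; have := sU x (y - B y) => /= ->.
- move=> x; rewrite rdotDl !rdotZl sB -/(sqn (B x)).
  have := sU (x - B x) x => /= ->; rewrite -/(sqn (x - B x)).
  by rewrite addr_ge0// mulr_ge0 ?subr_ge0 ?sqn_ge0.
exists Y; split=> // V cV VB; apply: comY => // x.
by rewrite (linD cV.1) !(linZ cV.1) !(linB cV.1) !VB (linB cV.1) !VB.
Qed.

Section Root.
Variables (H : operator G) (alpha : R).
Hypotheses (hH : self_adjoint H) (injH : invertible H) (alpha0 : 0 <= alpha).

Let sD := sa_subspace hH.
Let sL := sa_linear hH.
Let D0 := odom_infty H.
Let Hi := oinv H.

Lemma smooth_oinv_symmetric x y : D0 x -> D0 y -> rdot (Hi x) y = rdot x (Hi y).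
Proof.
move=> dx dy; have [_ ix] := infty_inv sD sL injH dx.
have [_ iy] := infty_inv sD sL injH dy.
rewrite -{1}(inftyK sD sL injH dy) -sa_symmetric//.
- by rewrite (inftyK sD sL injH).
- by have [] := infty_dom sD sL injH ix.
- by have [] := infty_dom sD sL injH iy.
Qed.

Lemma smooth_oinvZD (k : R[i]) x y : D0 x -> D0 y -> Hi (k *: x + y) = k *: Hi x + Hi y.
Proof.
move=> dx dy; apply: (oinv_linear sD sL injH).2.
  by have [] := infty_inv sD sL injH dx.
by have [] := infty_inv sD sL injH dy.
Qed.

(* With B = (1 + H^2)^-1, the root is the square root of
   alpha (1 - B)^2 + B^2 times 1 + H^-2: B (1 + H^-2) = H^-2. *)
Lemma smooth_root :
  let Rt := fcalc H (fun t => Num.sqrt (alpha + t ^- 4)) in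
  [/\ forall x, D0 x -> odom Rt x /\ D0 (Rt x),
      forall (k : R[i]) x y, D0 x -> D0 y -> Rt (k *: x + y) = k *: Rt x + Rt y,
      forall x y, D0 x -> D0 y -> rdot (Rt x) y = rdot x (Rt y),
      forall x, D0 x -> Rt (H x) = H (Rt x)
    & forall x, D0 x -> Rt (Rt x) = alpha%:C *: x + Hi (Hi (Hi (Hi x)))].
Proof.
move=> Rt.
have [B [C [[cB sB pB cC sC] [BC1 BC2 BC injB graph]]]] := sa_bounded hH.
pose E := spectral_resolution H.
have hE : resolves E H.
  have [E1 hE1] := spectral_theorem hH injH.
  suff oe : oeq H (rint E id) by exact: (rint_resolves hH injH oe).
  rewrite /E /spectral_resolution.
  by case: xgetP => [E2 _ h2|nE]; [exact: h2|case: (nE E1)].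
have na := resolves_no_atom0 hE injH.
have a1 : 0 < 1 + alpha by rewrite ltr_wpDr.
pose r := alpha / (1 + alpha).
have r01 : 0 <= r <= 1.
  by rewrite divr_ge0 ?(ltW a1)//= ler_pdivrMr// mul1r lerDr.
have [Y [cY sY pY YY comY]] := sqrt_mix r01 cB sB pB.
have dHi x : D0 x -> D0 (Hi x) by move=> /(infty_inv sD sL injH)[].
have dH x : D0 x -> D0 (H x) by move=> /(infty_dom sD sL injH)[].
have oH x : D0 x -> odom H x by move=> /(infty_dom sD sL injH)[].
have HiK x : D0 x -> H (Hi x) = x by exact: inftyK.
have iHK x : D0 x -> Hi (H x) = x by exact: infty_invK.
have sD0 : subspace D0 := infty_subspace sD sL injH.
have BU x : odom H x -> odom H (H x) -> B (x + H (H x)) = x.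
  move=> d1 d2; have [b1 b2] := BC1 (x + H (H x)).
  have [c1 c2] := BC2 (x + H (H x)).
  by apply: (sa_resolvent_unique hH b1 _ d1 d2); rewrite b2.
(* Y commutes with B and C, hence preserves the graph of H, which is given by [C y = B w]. *)
have redY : reduces Y H.
  move=> x dx; apply/graph; have /graph e : odom H x /\ H x = H x by [].
  by rewrite (comY C)// ?e ?(comY B)// => ?; rewrite BC.
have EB t : commutes (E t) B.
  move=> x; have [b1 b2] := BC1 x; have [c1 c2] := BC2 x.
  have [d1 e1] := hE.1 t _ b1; rewrite b2 in e1.
  have [d2 e2] := hE.1 t _ c1.
  have := BU _ d1; rewrite e1 => /(_ d2) <-; rewrite e2.
  by rewrite -(linD (resolution_lin E t)) c2.
have EY t : commutes Y (E t).
  by move=> x; rewrite (comY (E t))//; exact: resolution_contraction.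
have Hi0 : Hi 0 = 0 by have [si li] := oinv_linear sD sL injH; exact: (linear_on0 si li).
pose P x := x + Hi (Hi x).
have dP x : D0 x -> D0 (P x) by move=> dx; exact: (subspaceD sD0 dx (dHi _ (dHi _ dx))).
have BP x : D0 x -> B (P x) = Hi (Hi x).
  move=> dx; have d1 := dHi _ dx; have d2 := dHi _ d1.
  have := @BU (Hi (Hi x)) (oH _ d2); rewrite HiK// => /(_ (oH _ d1)).
  by rewrite HiK// addrC.
have PZD (k : R[i]) x y : D0 x -> D0 y -> P (k *: x + y) = k *: P x + P y.
  move=> dx dy; rewrite /P smooth_oinvZD// (smooth_oinvZD _ (dHi _ dx) (dHi _ dy)).
  by rewrite addrACA -scalerDr.
have PY x : D0 x -> P (Y x) = Y (P x).
  have redi := reduces_oinv sD sL injH redY.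
  move=> dx; have d1 := dHi _ dx.
  have [di1 _] := infty_inv sD sL injH dx; have [di2 _] := infty_inv sD sL injH d1.
  by rewrite /P (linD cY.1) (redi _ di1).2 (redi _ di2).2.
have dY x : D0 x -> D0 (Y x).
  exact: (infty_reduces sD sL injH redY).
have Psym x y : D0 x -> D0 y -> rdot (P x) y = rdot x (P y).
  move=> dx dy; rewrite rdotDl rdotDr (smooth_oinv_symmetric (dHi _ dx) dy).
  by rewrite (smooth_oinv_symmetric dx (dHi _ dy)).
(* k undoes the division by 1 + alpha in r: since (1 - B) P = 1 and B P = H^-2, the square of k Y P
   is alpha + H^-4. *)
pose k := Num.sqrt (1 + alpha).
have kk : k * k = 1 + alpha by rewrite -expr2 sqr_sqrtr// ltW.
pose f t := Num.sqrt (alpha + t ^- 4).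
have dR x : D0 x -> spectral_density E f x (k%:C *: Y (P x)).
  move=> dx; have d1 := dHi _ dx; have d2 := dHi _ d1.
  have idH y : D0 y -> spectral_density E id y (H y).
    by move=> dy; apply: (resolves_density hH hE); exact: oH.
  have idHi y : D0 y -> spectral_density E (fun t => t^-1) y (Hi y).
    move=> dy; have := idH _ (dHi _ dy); rewrite HiK// => h.
    exact: (densityV _ h).
  (* Obtained by inversion: [y = B y + H (C y)] has density 1 + t^2 with respect to [B y]. *)
  have dB y : spectral_density E (fun t => (1 + t * t)^-1) y (B y).
    have [b1 b2] := BC1 y; have [c1 c2] := BC2 y.
    have h1 := resolves_density hH hE b1; rewrite b2 in h1.
    have h2 := densityD (density_cst E 1 (B y)) (densityM h1 (resolves_density hH hE c1)).
    rewrite scale1r c2 in h2; apply: densityV h2 => t t0 /=.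
    by rewrite gt_eqF// ltr_pwDl// -expr2 sqr_ge0.
  have dU y : spectral_density E (fun t => 1 - (1 + t * t)^-1) y (y - B y).
    have := densityD (density_cst E 1 y) (densityM (dB y) (density_cst E (-1) (B y))).
    rewrite scale1r rmorphN1 scaleN1r; apply: density_ext => t _.
    by rewrite mulN1r.
  pose g t := Num.sqrt (r * (1 - (1 + t * t)^-1) ^+ 2 + (1 - r) * (1 + t * t)^-1 ^+ 2).
  have r1 : 0 < 1 - r.
    rewrite (_ : 1 - r = (1 + alpha)^-1) ?invr_gt0//.
    by rewrite /r; field; rewrite gt_eqF.
  have t20 t : 0 < 1 + t * t by rewrite ltr_pwDl// -expr2 sqr_ge0.
  have g2 t : 0 < r * (1 - (1 + t * t)^-1) ^+ 2 + (1 - r) * (1 + t * t)^-1 ^+ 2.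
    have [r0 _] := andP r01.
    apply: ltr_wpDl; first by rewrite mulr_ge0 ?sqr_ge0.
    by rewrite mulr_gt0// exprn_gt0// invr_gt0.
  have dY' y : spectral_density E g y (Y y).
    apply: density_sqrt => //.
    - by move=> t _; rewrite sqrtr_gt0.
    - by move=> a b z; rewrite /slab (linB cY.1) !EY.
    rewrite YY; have h1 := densityM (dU y) (dU (y - B y)).
    have h2 := densityM (dB y) (dB (B y)).
    have := densityD (densityM h1 (density_cst E r _)) (densityM h2 (density_cst E (1 - r) _)).
    by apply: density_ext => t _; rewrite sqr_sqrtr ?ltW// !expr2.
  have dPx : spectral_density E (fun t => 1 + t^-1 * t^-1) x (P x).
    have := densityD (density_cst E 1 x) (densityM (idHi _ dx) (idHi _ d1)).
    by rewrite scale1r.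
  have dR := densityM (densityM dPx (dY' (P x))) (density_cst E k (Y (P x))).
  apply: density_ext dR => t t0; have p0 : 0 <= 1 + t^-1 * t^-1.
    by rewrite addr_ge0// -expr2 sqr_ge0.
  rewrite -{1}(ger0_norm p0) -sqrtr_sqr /k /g -!sqrtrM ?mulr_ge0 ?(ltW a1) ?(ltW (g2 t))//.
  congr Num.sqrt; rewrite /r; field.
  by rewrite t0 !gt_eqF.
have val x : D0 x -> odom Rt x /\ Rt x = k%:C *: Y (P x).
  have fc : continuous_off0 f.
    move=> t t0; apply: (@continuous_comp _ _ _ (fun t => alpha + t ^- 4)).
      apply: cvgD; first exact: cvg_cst.
      by apply: cvgV; [rewrite expf_neq0|exact: exprn_continuous].
    exact: sqrt_continuous.
  (* The domain of the integral contains the smooth vectors, so it is dense and determines the value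
     chosen by [rint]. *)
  move=> dx; apply: (rint_density na fc (dR _ dx)) => w hw.
  have [u du uw] := infty_dense hH injH hE w.
  apply: sqn_eq0; apply: rcvg_unique (cvg_rdotr (z := w) uw) _.
  rewrite (_ : (fun _ => _) = fun=> 0); first exact: cvg_cst.
  by apply/funext => n; apply: hw; exact: (density_rdom na fc (dR _ (du n))).
have dRt x : D0 x -> D0 (Rt x).
  by move=> dx; rewrite (val x dx).2; apply: (subspaceZ sD0); apply: dY; apply: dP.
split.
- by move=> x dx; split; [exact: (val x dx).1|exact: dRt].
- move=> l x y dx dy; rewrite !(val _ _).2//; last by case: sD0 => _; apply.
  by rewrite PZD// cY.1 scalerDr !scalerA mulrC.
- move=> x y dx dy; rewrite !(val _ _).2// rdotZl rdotZr sY Psym ?PY//.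
  exact: dY.
- move=> x dx; rewrite !(val _ _).2//; last exact: dH.
  have dPx := dP _ dx.
  rewrite (linear_onZ sD sL); last by apply: oH; apply: dY.
  rewrite (redY _ (oH _ dPx)).2; congr (_ *: Y _).
  have d1 := dHi _ dx; have d2 := dHi _ d1.
  by rewrite /P (linear_onD sL (oH _ dx) (oH _ d2)) !HiK// iHK.
move=> x dx; have dPx := dP _ dx; have dPP := dP _ dPx.
have sc l u : D0 u -> P (l *: u) = l *: P u.
  move=> du; have := PZD l u 0 du (subspace0 sD0).
  by rewrite addr0 (_ : P 0 = 0) ?addr0// /P !Hi0 addr0.
rewrite (val _ (dRt _ dx)).2 (val _ dx).2 sc; last exact: dY.
rewrite PY// (linZ cY.1) scalerA -rmorphM/= kk YY.
have UP u : D0 u -> P u - B (P u) = u by move=> du; rewrite BP// addrK.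
rewrite UP// UP// (BP (P x))//.
have d1 := dHi _ dx; have d2 := dHi _ d1; have d3 := dHi _ d2.
have -> : Hi (Hi (P x)) = P (Hi (Hi x)).
  have [si li] := oinv_linear sD sL injH.
  have oHi y : D0 y -> odom Hi y by move=> /(infty_inv sD sL injH)[].
  by rewrite /P !(linear_onD li)//; exact: oHi.
rewrite BP// scalerDr !scalerA -!rmorphM/= (_ : (1 + alpha) * r = alpha).
  rewrite (_ : (1 + alpha) * (1 - r) = 1) ?scale1r//.
  by rewrite /r; field; rewrite gt_eqF.
by rewrite /r; field; rewrite gt_eqF.
Qed.

End Root.
End RootOperator.

(** * The algebraic model on families of smooth vectors *)

Section SubspaceModule.
Variables (K : pzRingType) (V : lmodType K) (D : set V).

(** Carrying the proof [sD] as an argument allows the closure instance to be attached to the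
    predicate. *)
Definition submem (sD : subspace D) : V -> bool := fun x => `[< D x >].

Lemma submem_closed (sD : subspace D) : subsemimod_closed (submem sD).
Proof.
have [d0 dD] := sD; split; first split.
- exact/asboolP.
- move=> x y /asboolP dx /asboolP dy; apply/asboolP.
  by rewrite -(scale1r x); exact: dD.
- move=> k x /asboolP dx; apply/asboolP.
  by rewrite -[k *: x]addr0; exact: dD.
Qed.

HB.instance Definition _ (sD : subspace D) :=
  GRing.isSubmodClosed.Build K V (submem sD) (submem_closed sD).

(** On this type of smooth vectors H, its inverse and the roots become total linear maps, and the
    relations become identities without domain conditions. *)
Record submodule (sD : subspace D) :=
  Submodule { subval : V; subvalP : submem sD subval }.

HB.instance Definition _ (sD : subspace D) := [isSub for @subval sD].
HB.instance Definition _ (sD : subspace D) := [Choice of submodule sD by <:].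
HB.instance Definition _ (sD : subspace D) :=
  [SubChoice_isSubLmodule of submodule sD by <:].

End SubspaceModule.

Section Model.
Variables (R : realType) (G : hilbertType R) (D : set G) (sD : subspace D).
Notation V := (submodule sD).
Implicit Types (v w : V) (u : nat -> nat -> V) (n j : nat) (a : R).

Section Lin.
Variable f : V -> V.
Hypothesis flin : linear f.
Lemma submodule_linD (v w : V) : f (v + w) = f v + f w.
Proof. by rewrite -{1}(scale1r v) flin !scale1r. Qed.
Lemma submodule_lin0 : f 0 = 0.
Proof. by apply: (addrI (f 0)); rewrite -submodule_linD !addr0. Qed.
Lemma submodule_linZ (k : R[i]) (v : V) : f (k *: v) = k *: f v.
Proof. by rewrite -{1}[k *: v]addr0 flin submodule_lin0 addr0. Qed.
Lemma submodule_linN (v : V) : f (- v) = - f v.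
Proof. by rewrite -[- v]scaleN1r submodule_linZ scaleN1r. Qed.
End Lin.

(** The parameter c is eliminated through c = l^2 - l, which turns the constant under the root into
    (1 - 1/l) q^(-2j). Powers are written [q ^+ n ^+ 2] so that [q ^+ n] is an atom for [field]. *)
Record ladder (q l : R) (cp lm : nat -> R) (h hi : V -> V) (r : nat -> V -> V) : Prop := {
  ladder_q : 0 < q < 1;
  ladder_l : l != 0;
  ladder_cp0 : cp 0 = 0;
  ladder_lm0 : lm 0 = 0;
  ladder_cp2 : forall n, cp n ^+ 2 =
    l ^+ 2 - l + l * q ^+ n ^+ 2 - l ^+ 2 * q ^+ n ^+ 4;
  ladder_lm2 : forall j, lm j ^+ 2 = 1 - q ^+ j ^+ 2;
  ladder_h : linear h;
  ladder_hi : linear hi;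
  ladder_r : forall j, linear (r j);
  ladder_hK : forall v, h (hi v) = v;
  ladder_hiK : forall v, hi (h v) = v;
  ladder_rh : forall j v, r j (h v) = h (r j v);
  ladder_rr : forall j v,
    r j (r j v) = ((1 - l^-1) * q ^- j ^+ 2)%:C *: v + hi (hi (hi (hi v)));
  ladder_sym_h : forall v w, rdot (subval (h v)) (subval w) = rdot (subval v) (subval (h w));
  ladder_sym_r : forall j v w, 
    rdot (subval (r j v)) (subval w) = rdot (subval v) (subval (r j w)) }.

Variables (q l : R) (cp lm : nat -> R) (h hi : V -> V) (r : nat -> V -> V).
Let kap := (Num.sqrt q)^-1 * (lam q)^-1.

(** Acts on coefficients: entry (n, j) collects what arrives from its neighbours, so shifts are
    opposite to those of the formulas on [ket]. The truncated predecessors at index 0 are harmless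
    because [cp 0] and [lm 0] vanish. The quotient of [cp n] by [l * q ^+ n] is the root occurring
    in E and F, with the sign of l. *)
Definition act (g : generator) u : nat -> nat -> V := match g with
  | gA => fun n j => (l * q ^+ n ^+ 2)%:C *: u n j
  | gA' => fun n j => (l * q ^+ n ^+ 2)^-1%:C *: u n j
  | gB => fun n j => (cp n.+1)%:C *: u n.+1 j
  | gBs => fun n j => (cp n)%:C *: u n.-1 j
  | gE => fun n j => (kap * (q ^- n * lm j.+1))%:C *: r j.+1 (h (u n j.+1))
      - (kap * (q ^- j * (cp n / (l * q ^+ n))))%:C *: h (u n.-1 j)
  | gF => fun n j => (kap * (q ^- n * lm j))%:C *: r j (h (u n j.-1))
      - (kap * (q ^- j * (cp n.+1 / (l * q ^+ n.+1))))%:C *: h (u n.+1 j)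
  | gK => fun n j => (q ^+ n / q ^+ j)%:C *: h (u n j)
  | gK' => fun n j => (q ^+ j / q ^+ n)%:C *: hi (u n j)
  end.

Fixpoint eval (t : term R) u : nat -> nat -> V := match t with
  | Gen g => act g u
  | Cst k => fun n j => k *: u n j
  | Add t1 t2 => fun n j => eval t1 u n j + eval t2 u n j
  | Mul t1 t2 => eval t1 (eval t2 u)
  end.

Hypothesis L : ladder q l cp lm h hi r.

Let q0 : 0 < q. Proof. by case/andP: (ladder_q L). Qed.
Let q1 : q < 1. Proof. by case/andP: (ladder_q L). Qed.
Let l0 := ladder_l L.
Let cp0 := ladder_cp0 L.
Let lm0 := ladder_lm0 L.
Let cp2 := ladder_cp2 L.
Let lm2 := ladder_lm2 L.
Let hlin := ladder_h L.
Let hilin := ladder_hi L.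
Let rlin := ladder_r L.
Let hK := ladder_hK L.
Let hiK := ladder_hiK L.
Let rh := ladder_rh L.
Let rr := ladder_rr L.

(** Pairing with a fixed vector turns identities between vectors into scalar ones, which [field] can
    prove. *)
Let P z (v : V) := rdot (subval v) z.
Let P_inj v w : (forall z, P z v = P z w) -> v = w.
Proof. by move=> e; apply: val_inj; apply: rdot_eq. Qed.
Let PD z v w : P z (v + w) = P z v + P z w. Proof. exact: rdotDl. Qed.
Let PN z v : P z (- v) = - P z v. Proof. exact: rdotNl. Qed.
Let PZ z a v : P z (a%:C *: v) = a * P z v. Proof. exact: rdotZl. Qed.

Let hD := submodule_linD hlin.
Let hZ := submodule_linZ hlin.
Let hN := submodule_linN hlin.
Let hiD := submodule_linD hilin.
Let hiZ := submodule_linZ hilin.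
Let hiN := submodule_linN hilin.
Let rD j := submodule_linD (rlin j).
Let rZ j := submodule_linZ (rlin j).
Let rN j := submodule_linN (rlin j).

Let simpv := (hD, hZ, hN, hiD, hiZ, hiN, rD, rZ, rN, hK, hiK, rh, rr,
  scaleN1r, scale1r, PD, PN, PZ).

Let rel t1 t2 := forall u, eval t1 u = eval t2 u.

Ltac entrywise := move=> u; apply/funext => -[|n]; apply/funext => -[|j];
  apply: P_inj => z /=; rewrite ?simpv ?cp0 ?lm0 ?mulr0 ?mul0r ?expr0.

(** Paired with a vector, each entry of a relation is a rational identity in l and the powers of q,
    modulo the known squares of [sqrt q], [cp] and [lm]. *)
Lemma eval_rel t1 t2 : cross_rel q (l ^+ 2 - l) t1 t2 -> rel t1 t2.
Proof.
have qn0 n : q ^+ n != 0 by rewrite expf_neq0// gt_eqF.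
have sq0 : Num.sqrt q != 0 by rewrite gt_eqF// sqrtr_gt0.
have qq : Num.sqrt q ^+ 2 = q by rewrite sqr_sqrtr// ltW.
have q21 : q * q - 1 != 0.
  by rewrite -expr2 subr_eq0 lt_eqF// exprn_ilt1// ltW.
have c00 : l ^+ 2 - l + l - l ^+ 2 = 0 by ring.
have c1 : cp 1 ^+ 2 = l ^+ 2 - l + l * q ^+ 2 - l ^+ 2 * q ^+ 4 by rewrite cp2 expr1.
have cn n : cp n.+1 ^+ 2 =
    l ^+ 2 - l + l * (q * q ^+ n) ^+ 2 - l ^+ 2 * (q * q ^+ n) ^+ 4.
  by rewrite cp2 !exprS.
have cnn n : cp n.+2 ^+ 2 = l ^+ 2 - l + l * (q * (q * q ^+ n)) ^+ 2 -
    l ^+ 2 * (q * (q * q ^+ n)) ^+ 4 by rewrite cp2 !exprS.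
have l1 : lm 1 ^+ 2 = 1 - q ^+ 2 by rewrite lm2 expr1.
have ln n : lm n.+1 ^+ 2 = 1 - (q * q ^+ n) ^+ 2 by rewrite lm2 !exprS.
have lnn n : lm n.+2 ^+ 2 = 1 - (q * (q * q ^+ n)) ^+ 2 by rewrite lm2 !exprS.
have nz := (qn0, l0, q21, sq0, lt0r_neq0 q0).
case.
all: entrywise; rewrite ?exprS ?expr0 ?mulr1 /kap /lam.
all: move: (Num.sqrt q) sq0 qq nz => x x0 qq nz.
(* The alternatives distinguish interior entries from those with j = 0, with n = 0 and the corner,
   where the squares of index 1 appear. *)
all: first [by field: qq (cn n) (cnn n) (ln j) (lnn j); rewrite ?nz
  | by field: qq (cn n) (cnn n) l1; rewrite ?nz
  | by field: qq c1 (ln j) (lnn j); rewrite ?nz | by field: qq c1 l1; rewrite ?nz].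
Qed.

End Model.

(** * Finite sums in the Hilbert space direct sum *)

Section FiniteFamilies.
Variables (R : realType) (G HH : hilbertType R) (D : set G) (sD : subspace D).
Variable ket : nat -> nat -> G -> HH.
Hypothesis hk : hilbert_sum ket.
Notation V := (submodule sD).
Implicit Types (v w : V) (u : nat -> nat -> V) (x y : HH) (n j N M : nat).

Let klin n j : linear (ket n j). Proof. by case: hk. Qed.
Let kiso n j (x y : G) : rdot (ket n j x) (ket n j y) = rdot x y.
Proof. by case: hk => _ h _ _; rewrite /rdot h. Qed.
Let korth n j m k (x y : G) : (n, j) != (m, k) -> rdot (ket n j x) (ket m k y) = 0.
Proof. by case: hk => _ _ h _ e; rewrite /rdot h. Qed.
Let ketD n j (x y : G) : ket n j (x + y) = ket n j x + ket n j y.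
Proof. by rewrite -{1}(scale1r x) klin scale1r. Qed.
Let ket0 n j : ket n j 0 = 0.
Proof. by apply: (addrI (ket n j 0)); rewrite -ketD !addr0. Qed.

Let ketB n j (x y : G) : ket n j (x - y) = ket n j x - ket n j y.
Proof.
by apply/eqP; rewrite eq_sym subr_eq -ketD subrK.
Qed.

Definition supported N u := forall n j, (N <= n)%N || (N <= j)%N -> u n j = 0.
Definition fin_supp u := exists N, supported N u.

Lemma supportedW N M u : (N <= M)%N -> supported N u -> supported M u.
Proof.
move=> NM h n j /orP[a|a]; apply: h; apply/orP; [left|right]; exact: leq_trans a.
Qed.

Lemma fin_supp2 u1 u2 : fin_supp u1 -> fin_supp u2 ->
  exists N, supported N u1 /\ supported N u2.
Proof.
move=> [N h1] [M h2]; exists (maxn N M); split.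
  exact: supportedW (leq_maxl _ _) h1.
exact: supportedW (leq_maxr _ _) h2.
Qed.

Definition lincomb (k : R[i]) u1 u2 : nat -> nat -> V :=
  fun n j => k *: u1 n j + u2 n j.

Lemma lincomb_supported N k u1 u2 : supported N u1 -> supported N u2 ->
  supported N (lincomb k u1 u2).
Proof. by move=> h1 h2 n j e; rewrite /lincomb h1// h2// scaler0 addr0. Qed.

Lemma fin_supp_lincomb k u1 u2 : fin_supp u1 -> fin_supp u2 ->
  fin_supp (lincomb k u1 u2).
Proof.
by move=> h1 h2; have [N []] := fin_supp2 h1 h2; exists N; exact: lincomb_supported.
Qed.

Definition partial_sum N u : HH := \sum_(n < N) \sum_(j < N) ket n j (subval (u n j)).
(** The bound is chosen arbitrarily; [vecE] shows that every bound of the support gives the same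
    vector. *)
Definition vec u := partial_sum (xget 0%N [set N | supported N u]) u.

Lemma sum_widen (W : zmodType) (f : nat -> W) N M : (N <= M)%N ->
  (forall n, (N <= n)%N -> f n = 0) -> \sum_(n < M) f n = \sum_(n < N) f n.
Proof.
move=> NM f0; rewrite (big_ord_widen M f NM) [LHS](bigID (fun n : 'I_M => (n < N)%N)) /=.
by rewrite [X in _ + X]big1 ?addr0// => i; rewrite -leqNgt => /f0.
Qed.

Lemma partial_sum_widen N M u : (N <= M)%N -> supported N u ->
  partial_sum M u = partial_sum N u.
Proof.
move=> NM h; rewrite /partial_sum.
rewrite (@sum_widen _ (fun n => \sum_(j < M) ket n j (subval (u n j))) N M NM); last first.
  by move=> n Nn; rewrite big1// => j _; rewrite h ?Nn// ket0.
apply: eq_bigr => n _; apply: (@sum_widen _ (fun j => ket n j (subval (u n j))) N M NM) => j Nj.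
by rewrite h ?Nj ?orbT// ket0.
Qed.

Lemma vecE N u : supported N u -> vec u = partial_sum N u.
Proof.
move=> h; rewrite /vec; case: xgetP => [M _ h'|/(_ N)//].
by rewrite -(partial_sum_widen (leq_maxl N M) h) -(partial_sum_widen (leq_maxr N M) h').
Qed.

Lemma vec_lincomb k u1 u2 : fin_supp u1 -> fin_supp u2 ->
  vec (lincomb k u1 u2) = k *: vec u1 + vec u2.
Proof.
move=> f1 f2; have [N [h1 h2]] := fin_supp2 f1 f2.
rewrite (vecE h1) (vecE h2) (vecE (lincomb_supported k h1 h2)) /partial_sum.
rewrite scaler_sumr -big_split; apply: eq_bigr => n _.
rewrite scaler_sumr -big_split; apply: eq_bigr => j _.
exact: klin.
Qed.

Lemma rdot_suml (W : hilbertType R) (I : Type) (s : seq I) (f : I -> W) z :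
  rdot (\sum_(i <- s) f i) z = \sum_(i <- s) rdot (f i) z.
Proof. exact: (big_morph (fun a : W => rdot a z) (fun a b => rdotDl a b z) (rdot0l z)). Qed.

Lemma rdot_vec_ket u n j (z : G) : fin_supp u ->
  rdot (vec u) (ket n j z) = rdot (subval (u n j)) z.
Proof.
move=> [N h]; have NM : (N <= maxn N (maxn n j).+1)%N by exact: leq_maxl.
move: (maxn _ _) NM (leq_maxr N (maxn n j).+1) => M NM.
rewrite gtn_max => /andP[nM jM].
rewrite (vecE (supportedW NM h)) /partial_sum rdot_suml.
rewrite (bigD1 (Ordinal nM))//= rdot_suml (bigD1 (Ordinal jM))//= kiso.
rewrite !big1 ?addr0// => [m mn|k kj].
  rewrite rdot_suml big1// => k _; apply: korth.
  by rewrite xpair_eqE negb_and -val_eqE /= in mn *; rewrite mn.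
by apply: korth; rewrite xpair_eqE eqxx /=; rewrite -val_eqE in kj.
Qed.

Lemma rdot_vec N u1 u2 : supported N u1 -> supported N u2 ->
  rdot (vec u1) (vec u2) =
  \sum_(n < N) \sum_(j < N) rdot (subval (u1 n j)) (subval (u2 n j)).
Proof.
move=> h1 h2; rewrite (vecE h2) rdotC rdot_suml; apply: eq_bigr => n _.
rewrite rdot_suml; apply: eq_bigr => j _.
by rewrite rdotC rdot_vec_ket//; exists N.
Qed.

Lemma vec_inj u1 u2 : fin_supp u1 -> fin_supp u2 -> vec u1 = vec u2 -> u1 = u2.
Proof.
move=> f1 f2 e; apply/funext => n; apply/funext => j; apply: val_inj.
by apply: rdot_eq => z; rewrite -rdot_vec_ket// e rdot_vec_ket.
Qed.

Lemma finite_sumsE x : finite_sums ket D x <-> exists2 u, fin_supp u & x = vec u.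
Proof.
split=> [[N [u [Du ->]]]|[u [N h] ->]]; last first.
  exists N, (fun n j => subval (u n j)); rewrite (vecE h).
  by split=> // n j; have /asboolP := subvalP (u n j).
pose u' n j : V := if (n < N)%N && (j < N)%N
  then Submodule (sD := sD) (asboolT (Du n j)) else 0.
have h : supported N u'.
  by move=> n j; rewrite /u' !(leqNgt N) -negb_and => /negbTE ->.
exists u'; first by exists N.
rewrite (vecE h); apply: eq_bigr => n _; apply: eq_bigr => j _.
by rewrite /u' !ltn_ord.
Qed.

Definition coefs x : nat -> nat -> V := xget (fun _ _ => 0) [set u | fin_supp u /\ vec u = x].

Lemma vecK u : fin_supp u -> coefs (vec u) = u.
Proof.
by move=> f; rewrite /coefs; case: xgetP => [u' _ [f' /vec_inj]|/(_ u)[]//]; apply.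
Qed.

Lemma coefsP x : finite_sums ket D x -> fin_supp (coefs x) /\ vec (coefs x) = x.
Proof. by move=> /finite_sumsE[u f ->]; rewrite vecK. Qed.

Definition single n j v : nat -> nat -> V :=
  fun m k => if (m == n) && (k == j) then v else 0.

Lemma single_supported n j v : supported (maxn n j).+1 (single n j v).
Proof.
move=> m k; rewrite /single; case: eqP => [->|//]; case: eqP => [->|//].
by rewrite !ltnNge leq_maxl leq_maxr.
Qed.

Lemma vec_single n j v : vec (single n j v) = ket n j (subval v).
Proof.
rewrite (vecE (@single_supported n j v)) /partial_sum /single.
have nM : (n < (maxn n j).+1)%N by rewrite ltnS leq_maxl.
have jM : (j < (maxn n j).+1)%N by rewrite ltnS leq_maxr.
rewrite (bigD1 (Ordinal nM))//= (bigD1 (Ordinal jM))//= !eqxx /=.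
rewrite !big1 ?addr0// => [m mn|k kj].
  by rewrite big1// => k _; rewrite -val_eqE /= in mn; rewrite (negbTE mn) ket0.
by rewrite -val_eqE /= in kj; rewrite (negbTE kj) ket0.
Qed.

Lemma finite_sums_dense : (forall z : G, exists2 s : nat -> G, (forall n, D (s n)) & s @ \oo --> z) ->
  subspace (finite_sums ket D) /\ dense (finite_sums ket D).
Proof.
move=> dD; split.
  split=> [|k x y /finite_sumsE[u1 f1 ->] /finite_sumsE[u2 f2 ->]]; apply/finite_sumsE.
    exists (single 0%N 0%N 0); first by exists 1%N; exact: (@single_supported 0%N 0%N 0).
    by rewrite vec_single ket0.
  by exists (lincomb k u1 u2); [exact: fin_supp_lincomb|rewrite vec_lincomb].
move=> O On0 oO; have [_ _ _ dns] := hk.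
have [x [Ox [N [u [_ xE]]]]] := dns O On0 oO.
have dD' (nj : nat * nat) :
    exists s : nat -> G, (forall n, D (s n)) /\ s @ \oo --> u nj.1 nj.2.
  by have [s] := dD (u nj.1 nj.2); exists s.
have [s hs] := choice dD'.
pose y k : HH := \sum_(n < N) \sum_(j < N) ket n j (s (val n, val j) k).
have yx : y @ \oo --> x.
  rewrite xE; apply: cvg_big => [|n _]; first exact: add_continuous.
  apply: cvg_big => [|j _]; first exact: add_continuous.
  have [_ /cvg_rnormP h] := hs (val n, val j); apply/cvg_rnormP => e e0.
  by apply: filterS (h e e0) => k; rewrite -ketB /sqn kiso.
have [k Oy] : exists k, O (y k).
  have /yx[k _ h] : nbhs x O by exact: open_nbhs_nbhs.
  by exists k; apply: h => /=.
exists (y k); split=> //; exists N, (fun n j => s (n, j) k); split=> // n j.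
by have [] := hs (n, j).
Qed.

End FiniteFamilies.

(** * The star-representation on finite sums *)

Section Representation.
Variables (R : realType) (G HH : hilbertType R) (D : set G) (sD : subspace D).
Variable ket : nat -> nat -> G -> HH.
Hypothesis hk : hilbert_sum ket.
Notation V := (submodule sD).
Implicit Types (v w : V) (u : nat -> nat -> V) (x y : HH) (n j N M : nat) (g : generator).
Variables (q c l : R) (cp lm : nat -> R) (h hi : V -> V) (r : nat -> V -> V).
Hypotheses (L : ladder q l cp lm h hi r) (cE : c = l ^+ 2 - l).
Implicit Types (t : term R).
Notation act := (act q l cp lm h hi r).
Notation eval := (eval q l cp lm h hi r).
Notation vec := (vec ket).

Let hlin := ladder_h L.
Let hilin := ladder_hi L.
Let rlin := ladder_r L.
Let h0 := submodule_lin0 hlin.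
Let hi0 := submodule_lin0 hilin.
Let r0 j := submodule_lin0 (rlin j).

Lemma supported_act N g u : supported N u -> supported N.+1 (act g u).
Proof.
move=> hu; have key n j n' j' : (n <= n'.+1)%N -> (j <= j'.+1)%N ->
    (N.+1 <= n)%N || (N.+1 <= j)%N -> u n' j' = 0.
  move=> a b /orP[e|e]; apply: hu; rewrite -ltnS; apply/orP; [left|right].
    exact: leq_trans a.
  by rewrite -ltnS; exact: leq_trans b.
case: g => n j e /=; rewrite ?(key n j n j)// ?(key n j n j.+1)// ?(key n j n.+1 j)//
  ?(key n j n.-1 j)// ?(key n j n j.-1)// ?leqSpred// ?leqW// ?h0 ?hi0 ?r0 ?scaler0 ?subr0//.
all: by rewrite leqW.
Qed.

Lemma fin_supp_eval t u : fin_supp u -> fin_supp (eval t u).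
Proof.
elim: t u => [g|k|t1 IH1 t2 IH2|t1 IH1 t2 IH2] u fu.
- by case: fu => N hu; exists N.+1; exact: supported_act.
- by case: fu => N hu; exists N => n j e; rewrite /= hu// scaler0.
- have [N [H1 H2]] := fin_supp2 (IH1 _ fu) (IH2 _ fu).
  by exists N => n j e; rewrite /= H1// H2// addr0.
- exact/IH1/IH2.
Qed.

Lemma eval_lincomb t k u1 u2 :
  eval t (lincomb k u1 u2) = lincomb k (eval t u1) (eval t u2).
Proof.
have sc (a : R[i]) v w : a *: (k *: v + w) = k *: (a *: v) + a *: w.
  by rewrite scalerDr !scalerA mulrC.
elim: t u1 u2 => [g|a|t1 IH1 t2 IH2|t1 IH1 t2 IH2] u1 u2.
- apply/funext => n; apply/funext => j.
  case: g; rewrite /= /lincomb ?hlin ?hilin ?rlin ?sc//.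
  + by rewrite opprD addrACA -scalerBr.
  + by rewrite opprD addrACA -scalerBr.
- by apply/funext => n; apply/funext => j; rewrite /= /lincomb sc.
- apply/funext => n; apply/funext => j; rewrite /= IH1 IH2 /lincomb.
  by rewrite addrACA -scalerDr.
- by rewrite /= IH2 IH1.
Qed.

(** Matches raising with lowering operators in the adjoint identities: the term at 0 vanishes with
    [cp 0] or [lm 0], the term at N by finite support. *)
Lemma sum_shift (W : zmodType) (f : nat -> W) N : f 0%N = 0 -> f N = 0 ->
  \sum_(n < N) f n.+1 = \sum_(n < N) f n.
Proof.
move=> f0 fN; have : \sum_(n < N.+1) f n = \sum_(n < N.+1) f n by [].
by rewrite {1}big_ord_recl big_ord_recr /= f0 fN add0r addr0.
Qed.

Let adj g := forall u1 u2, fin_supp u1 -> fin_supp u2 ->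
  rdot (vec (act g u1)) (vec u2) = rdot (vec u1) (vec (act (gstar g) u2)).

Let sym_h := ladder_sym_h L.
Let sym_r := ladder_sym_r L.
Let sym_hi v w : rdot (subval (hi v)) (subval w) = rdot (subval v) (subval (hi w)).
Proof. by rewrite -{1}(ladder_hK L w) -sym_h (ladder_hK L). Qed.

(** The sums run to N + 1 because a generator enlarges the support by at most one. *)
Let adjE g : (forall N u1 u2, supported N u1 -> supported N u2 ->
    \sum_(n < N.+1) \sum_(j < N.+1) rdot (subval (act g u1 n j)) (subval (u2 n j)) =
    \sum_(n < N.+1) \sum_(j < N.+1) rdot (subval (u1 n j)) (subval (act (gstar g) u2 n j))) ->
  adj g.
Proof.
move=> hg u1 u2 f1 f2; have [N [h1 h2]] := fin_supp2 f1 f2.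
have [h1' h2'] := (supportedW (leqnSn N) h1, supportedW (leqnSn N) h2).
rewrite (rdot_vec hk (supported_act g h1) h2').
by rewrite (rdot_vec hk h1' (supported_act (gstar g) h2)) hg.
Qed.

Let adj_gstar g : adj g -> adj (gstar g).
Proof. by move=> a u1 u2 f1 f2; rewrite rdotC -a// gstarK rdotC. Qed.

Let adjB : adj gB.
Proof.
apply: adjE => N u1 u2 h1 h2 /=.
pose f n := \sum_(j < N.+1) cp n * rdot (subval (u1 n j)) (subval (u2 n.-1 j)).
transitivity (\sum_(n < N.+1) f n.+1).
  by apply: eq_bigr => n _; apply: eq_bigr => j _; rewrite rdotZl.
rewrite sum_shift.
- by apply: eq_bigr => n _; apply: eq_bigr => j _; rewrite rdotZr.
- by rewrite /f big1// => j _; rewrite (ladder_cp0 L) mul0r.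
- by rewrite /f big1// => j _; rewrite h1 ?leqnSn// rdot0l mulr0.
Qed.

Let adj_E : adj gE.
Proof.
apply: adjE => N u1 u2 h1 h2 /=; set kap := (_ / lam q).
pose f n j := kap * (q ^- n * lm j) *
  rdot (subval (r j (h (u1 n j)))) (subval (u2 n j.-1)).
pose f' n := \sum_(j < N.+1) kap * (q ^- j * (cp n / (l * q ^+ n))) *
  rdot (subval (h (u1 n.-1 j))) (subval (u2 n j)).
transitivity (\sum_(n < N.+1) \sum_(j < N.+1) f n j.+1 - \sum_(n < N.+1) f' n).
  rewrite -sumrB; apply: eq_bigr => n _; rewrite -sumrB; apply: eq_bigr => j _.
  by rewrite rdotBl !rdotZl.
transitivity (\sum_(n < N.+1) \sum_(j < N.+1) f n j - \sum_(n < N.+1) f' n.+1).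
  congr (_ - _).
    apply: eq_bigr => n _; apply: sum_shift.
      by rewrite /f (ladder_lm0 L) !mulr0 mul0r.
    by rewrite /f h1 ?leqnSn ?orbT// h0 r0 rdot0l mulr0.
  rewrite sum_shift//.
    by rewrite /f' big1// => j _; rewrite (ladder_cp0 L) mul0r !mulr0 mul0r.
  by rewrite /f' big1// => j _; rewrite h2 ?leqnSn// rdot0r mulr0.
rewrite -sumrB; apply: eq_bigr => n _; rewrite -sumrB; apply: eq_bigr => j _.
rewrite rdotBr !rdotZr /f sym_r sym_h; congr (_ - _).
  by congr (_ * _); rewrite -(ladder_rh L).
by congr (_ * _); rewrite sym_h.
Qed.

Lemma act_adjoint g u1 u2 : fin_supp u1 -> fin_supp u2 ->
  rdot (vec (act g u1)) (vec u2) = rdot (vec u1) (vec (act (gstar g) u2)).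
Proof.
case: g; first [exact: adjB|exact: adj_E|exact: (adj_gstar adjB)|exact: (adj_gstar adj_E)|idtac].
all: apply: adjE => N w1 w2 h1 h2 /=; apply: eq_bigr => n _; apply: eq_bigr => j _.
all: by rewrite rdotZl rdotZr ?sym_h ?sym_hi.
Qed.

Lemma vecZ k u : fin_supp u -> vec (fun n j => k *: u n j) = k *: vec u.
Proof.
move=> fu; pose z : nat -> nat -> V := fun _ _ => 0.
have fz : fin_supp z by exists 0%N.
have vz : vec z = 0.
  have := vec_lincomb hk (-1) fz fz; rewrite scaleN1r addNr => <-.
  by congr vec; apply/funext => n; apply/funext => j; rewrite /lincomb scaler0 addr0.
have := vec_lincomb hk k fu fz; rewrite vz addr0 => <-.
by congr vec; apply/funext => n; apply/funext => j; rewrite /lincomb addr0.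
Qed.

Lemma vecD u1 u2 : fin_supp u1 -> fin_supp u2 ->
  vec (fun n j => u1 n j + u2 n j) = vec u1 + vec u2.
Proof.
move=> f1 f2; have := vec_lincomb hk 1 f1 f2; rewrite scale1r => <-.
by congr vec; apply/funext => n; apply/funext => j; rewrite /lincomb scale1r.
Qed.

Lemma eval_adjoint t u1 u2 : fin_supp u1 -> fin_supp u2 ->
  rdot (vec (eval t u1)) (vec u2) = rdot (vec u1) (vec (eval (tstar t) u2)).
Proof.
elim: t u1 u2 => [g|k|t1 IH1 t2 IH2|t1 IH1 t2 IH2] u1 u2 f1 f2 /=.
- exact: act_adjoint.
- by rewrite !vecZ// /rdot linearZl_LR linearZr_LR /= [Num.conj _]conjcK.
- by rewrite !vecD ?rdotDl ?rdotDr ?IH1 ?IH2//; exact: fin_supp_eval.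
- by rewrite IH1 ?IH2//; exact: fin_supp_eval.
Qed.

Lemma eval_teq t1 t2 : teq q c t1 t2 -> forall u, fin_supp u -> eval t1 u = eval t2 u.
Proof.
have evD t u1 u2 : eval t (fun n j => u1 n j + u2 n j) =
    fun n j => eval t u1 n j + eval t u2 n j.
  transitivity (eval t (lincomb 1 u1 u2)).
    by congr eval; apply/funext => n; apply/funext => j; rewrite /lincomb scale1r.
  by rewrite eval_lincomb; apply/funext => n; apply/funext => j; rewrite /lincomb scale1r.
have ev0 t : eval t (fun _ _ => 0) = fun _ _ => 0.
  have e := evD t (fun _ _ => 0) (fun _ _ => 0).
  apply/funext => n; apply/funext => j; apply: (addrI (eval t (fun _ _ => 0) n j)).
  rewrite addr0 -[LHS](congr1 (fun f => f n j) e); congr (eval t _ n j).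
  by apply/funext => n'; apply/funext => j'; rewrite addr0.
have evZ t k u : eval t (fun n j => k *: u n j) = fun n j => k *: eval t u n j.
  have e := eval_lincomb t k u (fun _ _ => 0); rewrite ev0 in e.
  transitivity (eval t (lincomb k u (fun _ _ => 0))).
    by congr eval; apply/funext => n; apply/funext => j; rewrite /lincomb addr0.
  by rewrite e; apply/funext => n; apply/funext => j; rewrite /lincomb addr0.
elim=> {t1 t2}.
- by move=> t1 t2; rewrite cE => /(eval_rel L) e u _.
- by [].
- by move=> t1 t2 _ IH u fu; rewrite IH.
- by move=> t1 t2 t3 _ IH1 _ IH2 u fu; rewrite IH1// IH2.
- by move=> t1 t1' t2 t2' _ IH1 _ IH2 u fu /=; rewrite IH1// IH2.
- by move=> t1 t1' t2 t2' _ IH1 _ IH2 u fu /=; rewrite IH2// IH1//; exact: fin_supp_eval.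
(* The difference of the two values is itself built from finite families, so being orthogonal to all
   of them it is orthogonal to itself. *)
- move=> t1 t2 _ IH u fu.
  have [f1 f2] := (fin_supp_eval (tstar t1) fu, fin_supp_eval (tstar t2) fu).
  apply: (vec_inj hk) => //; apply/eqP; rewrite -subr_eq0; apply/eqP/sqn_eq0.
  have e u' : fin_supp u' ->
      rdot (vec (eval (tstar t1) u) - vec (eval (tstar t2) u)) (vec u') = 0.
    move=> fu'; rewrite rdotBl ![rdot _ (vec u')]rdotC -!eval_adjoint// IH//.
    by rewrite subrr.
  by rewrite /sqn {2}/GRing.add /= rdotBr !e// subrr.
- by move=> t1 t2 t3 u _; apply/funext => n; apply/funext => j /=; rewrite addrA.
- by move=> t1 t2 u _; apply/funext => n; apply/funext => j /=; rewrite addrC.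
- by move=> t u _; apply/funext => n; apply/funext => j /=; rewrite scale0r add0r.
- move=> t u _; apply/funext => n; apply/funext => j /=.
  by rewrite scaleN1r subrr scale0r.
- by [].
- by move=> t u _; apply/funext => n; apply/funext => j /=; rewrite scale1r.
- by [].
- by move=> t1 t2 t3 u _ /=; rewrite evD.
- by move=> k t u _ /=; rewrite evZ.
- by move=> k1 k2 u _; apply/funext => n; apply/funext => j /=; rewrite scalerDl.
- by move=> k1 k2 u _; apply/funext => n; apply/funext => j /=; rewrite scalerA.
Qed.

Definition rep (a : crossA q c) x : HH := vec (eval (repr a) (coefs sD ket x)).

Lemma rep_cls t x : finite_sums ket D x ->
  rep (cls q c t) x = vec (eval t (coefs sD ket x)).
Proof.
move=> /(coefsP sD hk)[f _]; rewrite /rep.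
by rewrite (eval_teq (repr_cls q c t) f).
Qed.

Lemma rep_linear a k x y : finite_sums ket D x -> finite_sums ket D y ->
  rep a (k *: x + y) = k *: rep a x + rep a y.
Proof.
move=> /(coefsP sD hk)[fx ex] /(coefsP sD hk)[fy ey]; rewrite /rep.
have -> : coefs sD ket (k *: x + y) = lincomb k (coefs sD ket x) (coefs sD ket y).
  rewrite -{1}ex -{1}ey -(vec_lincomb hk)// (vecK hk)//.
  exact: fin_supp_lincomb.
by rewrite eval_lincomb (vec_lincomb hk)//; exact: fin_supp_eval.
Qed.

Hypothesis dD : forall z : G, exists2 s : nat -> G, (forall n, D (s n)) & s @ \oo --> z.

Lemma rep_star_representation : star_representation (finite_sums ket D) rep.
Proof.
split.
- exact: (finite_sums_dense sD hk dD).
- move=> a x /(coefsP sD hk)[f _]; apply/(finite_sumsE sD hk).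
  by exists (eval (repr a) (coefs sD ket x)) => //; exact: fin_supp_eval.
- exact: rep_linear.
- split.
  + move=> k a b x dx; have [f _] := coefsP sD hk dx.
    have -> : k *: a + b = cls q c (Add (Mul (Cst k) (repr a)) (repr b)).
      by apply/clsP; apply: teq_add; [exact: repr_cls|exact: teq_refl].
    rewrite rep_cls//= vecD ?vecZ//; first exact: fin_supp_eval.
      by apply: (fin_supp_eval (Mul (Cst k) (repr a))).
    exact: fin_supp_eval.
  + move=> x dx; have [f e] := coefsP sD hk dx.
    rewrite -[1]/(cls q c (Cst 1)) rep_cls//= vecZ// e.
    by rewrite scale1r.
  + move=> a b x dx; have [f _] := coefsP sD hk dx.
    rewrite -[a * b]/(cls q c (Mul (repr a) (repr b))) rep_cls//= /rep (vecK hk)//.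
    exact: fin_supp_eval.
move=> a x y dx dy; have [fx ex] := coefsP sD hk dx; have [fy ey] := coefsP sD hk dy.
have e z : finite_sums ket D z -> rdot (rep a x) z = rdot x (rep (crossA_star a) z).
  move=> dz; have [fz ez] := coefsP sD hk dz.
  have sE : rep (crossA_star a) z =
    vec (eval (tstar (repr a)) (coefs sD ket z)) by exact: rep_cls.
  by rewrite sE /rep -{1}ez -{2}ex eval_adjoint.
have s0 : subspace (finite_sums ket D) by case: (finite_sums_dense sD hk dD).
have di : finite_sums ket D ('i *: y) by exact: subspaceZ.
rewrite !hdotE !e//; congr (_ + 'i * (rdot x _)%:C).
(* The imaginary part is the real identity at ['i *: y]; linearity of the representation brings ['i]
   outside. *)
have := rep_linear (crossA_star a) 'i dy (subspace0 s0).
have -> : rep (crossA_star a) 0 = 0; last by rewrite !addr0.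
have := rep_linear (crossA_star a) (-1) dy dy.
by rewrite !scaleN1r !addNr.
Qed.

End Representation.

(** * Action of the generators on homogeneous vectors *)

Section Formulas.
Variables (R : realType) (G HH : hilbertType R) (D : set G) (sD : subspace D).
Variable ket : nat -> nat -> G -> HH.
Hypothesis hk : hilbert_sum ket.
Notation V := (submodule sD).
Variables (q c l : R) (cp lm : nat -> R) (h hi : V -> V) (r : nat -> V -> V).
Hypotheses (L : ladder q l cp lm h hi r) (cE : c = l ^+ 2 - l).
Implicit Types (v w : V) (n j : nat) (a : R).
Notation act := (act q l cp lm h hi r).
Notation vec := (vec ket).
Notation rep := (rep (q := q) (c := c) ket l cp lm h hi r).
Let kap : R := (Num.sqrt q)^-1 * (lam q)^-1.

Lemma rep_ket g n j v : rep (gen g) (ket n j (subval v)) = vec (act g (single n j v)).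
Proof.
rewrite -(vec_single hk) (rep_cls hk L cE) ?(vecK hk)//.
- by exists (maxn n j).+1; exact: single_supported.
- by apply/(finite_sumsE sD hk); exists (single n j v) => //; eexists; exact: single_supported.
Qed.

Let vecs a n j v : vec (single n j (a%:C *: v)) = a%:C *: ket n j (subval v).
Proof.
rewrite -(vec_single hk) -(vecZ hk); last by eexists; exact: single_supported.
by congr vec; apply/funext => m; apply/funext => k; rewrite /single; case: ifP; rewrite ?scaler0.
Qed.

Lemma ketz_predl n j (x : G) : ketz ket (n.+1%:Z - 1) j%:Z x = ket n j x.
Proof. by rewrite -addn1 PoszD addrK. Qed.
Lemma ketz_predr n j (x : G) : ketz ket n%:Z (j.+1%:Z - 1) x = ket n j x.
Proof. by rewrite -addn1 PoszD addrK. Qed.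

Let hlin := ladder_h L.
Let h0 := submodule_lin0 hlin.
Let r0 j := submodule_lin0 (ladder_r L j).

Ltac families := apply/funext => m; apply/funext => k; rewrite /= /single.

Ltac entries := case: eqP => ?; case: eqP => ?; subst => /=.

Lemma rep_A n j v :
  rep (gen gA) (ket n j (subval v)) = (l * q ^+ n ^+ 2)%:C *: ket n j (subval v).
Proof.
rewrite rep_ket -vecs; congr vec; families.
by entries; rewrite ?scaler0.
Qed.

Lemma rep_K n j v :
  rep (gen gK) (ket n j (subval v)) = (q ^+ n / q ^+ j)%:C *: ket n j (subval (h v)).
Proof.
rewrite rep_ket -vecs; congr vec; families.
by entries; rewrite ?h0 ?scaler0.
Qed.

Lemma rep_Bs n j v :
  rep (gen gBs) (ket n j (subval v)) = (cp n.+1)%:C *: ket n.+1 j (subval v).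
Proof.
rewrite rep_ket -vecs; congr vec; families; case: m => [|m] /=.
  by rewrite (ladder_cp0 L) scale0r.
by rewrite eqSS; entries; rewrite ?scaler0.
Qed.

Lemma rep_B n j v :
  rep (gen gB) (ket n j (subval v)) = (cp n)%:C *: ketz ket (n%:Z - 1) j%:Z (subval v).
Proof.
rewrite rep_ket; case: n => [|n].
  rewrite scaler0 -(scale0r (ket 0 0 (subval v))) -(vecs 0 0 0 v); congr vec; families.
  by rewrite !scale0r if_same scaler0.
rewrite ketz_predl -vecs; congr vec; families.
by rewrite eqSS; entries; rewrite ?scaler0.
Qed.

Let vecB (u1 u2 : nat -> nat -> V) : fin_supp u1 -> fin_supp u2 ->
  vec (fun n j => u1 n j - u2 n j) = vec u1 - vec u2.
Proof.
move=> f1 f2; have := vec_lincomb hk (-1) f2 f1; rewrite scaleN1r addrC => <-.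
congr vec; apply/funext => n; apply/funext => j.
by rewrite /lincomb scaleN1r addrC.
Qed.

Let fs n j v : fin_supp (single n j v).
Proof. by eexists; exact: single_supported. Qed.

Lemma rep_E n j v : rep (gen gE) (ket n j (subval v)) =
  (kap * (q ^- n * lm j))%:C *: ketz ket n%:Z (j%:Z - 1) (subval (r j (h v)))
  - (kap * (q ^- j * (cp n.+1 / (l * q ^+ n.+1))))%:C *: ket n.+1 j (subval (h v)).
Proof.
rewrite rep_ket; have -> : (kap * (q ^- n * lm j))%:C *:
    ketz ket n%:Z (j%:Z - 1) (subval (r j (h v))) =
  vec (single n j.-1 ((kap * (q ^- n * lm j))%:C *: r j (h v))).
  (* For j = 0 the predecessor [0.-1] is again 0, but the coefficient [lm 0] vanishes, as does
     [ketz] at index -1. *)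
  case: j => [|j]; last by rewrite ketz_predr vecs.
  by rewrite vecs (ladder_lm0 L) !mulr0 !scale0r.
rewrite -vecs -vecB//; congr vec; families; congr (_ - _).
  case: j => [|j] /=.
    by rewrite (ladder_lm0 L) !mulr0 scale0r andbF if_same h0 r0 scaler0.
  by rewrite eqSS; entries; rewrite ?h0 ?r0 ?scaler0.
case: m => [|m] /=; first by rewrite (ladder_cp0 L) mul0r !mulr0 scale0r.
by rewrite eqSS; entries; rewrite ?h0 ?scaler0.
Qed.

Lemma rep_F n j v : rep (gen gF) (ket n j (subval v)) =
  (kap * (q ^- n * lm j.+1))%:C *: ket n j.+1 (subval (r j.+1 (h v)))
  - (kap * (q ^- j * (cp n / (l * q ^+ n))))%:C *:
      ketz ket (n%:Z - 1) j%:Z (subval (h v)).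
Proof.
rewrite rep_ket; have -> : (kap * (q ^- j * (cp n / (l * q ^+ n))))%:C *:
    ketz ket (n%:Z - 1) j%:Z (subval (h v)) =
  vec (single n.-1 j ((kap * (q ^- j * (cp n / (l * q ^+ n))))%:C *: h v)).
  case: n => [|n]; last by rewrite ketz_predl vecs.
  by rewrite vecs (ladder_cp0 L) mul0r !mulr0 !scale0r.
rewrite -vecs -vecB//; congr vec; families; congr (_ - _).
  case: k => [|k] /=; first by rewrite (ladder_lm0 L) !mulr0 scale0r andbF.
  by rewrite eqSS; entries; rewrite ?h0 ?r0 ?scaler0.
case: n => [|n] /=.
  by rewrite (ladder_cp0 L) mul0r !mulr0 scale0r if_same h0 scaler0.
by rewrite eqSS; entries; rewrite ?h0 ?scaler0.
Qed.

End Formulas.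

(** * Signs and squares of the constants *)

Section ConstantIdentities.
Variables (R : realType) (q c : R) (s : bool).
Hypotheses (q01 : 0 < q < 1) (c0 : 0 <= c) (sc : s = false \/ 0 < c).
Notation l := (lampm c s).
Notation cp := (cpm q c s).

Lemma lampm_root : c = l ^+ 2 - l.
Proof.
have : Num.sqrt (c + 4^-1) ^+ 2 = c + 4^-1 by rewrite sqr_sqrtr// addr_ge0.
have : ((-1) ^+ s : R) ^+ 2 = 1 by rewrite sqrr_sign.
rewrite /lampm; move: (Num.sqrt _) ((-1) ^+ s) => t e e2 t2.
by rewrite sqrrD exprMn e2 t2; field.
Qed.

(** For s = true this is where c > 0 enters, through sqrt(c + 1/4) > 1/2. *)
Lemma lampm_sign : 0 < (-1) ^+ s * l.
Proof.
have t0 : 0 <= Num.sqrt (c + 4^-1) by exact: sqrtr_ge0.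
have t2 : Num.sqrt (c + 4^-1) ^+ 2 = c + 4^-1 by rewrite sqr_sqrtr// addr_ge0.
rewrite /lampm; move: (Num.sqrt _) t0 t2 => t t0 t2.
case: s sc => [[//|cpos]|_]; rewrite ?expr1 ?expr0 ?mul1r; last lra.
by nra.
Qed.

Lemma lampm_neq0 : l != 0.
Proof. by apply/eqP => e; have := lampm_sign; rewrite e mulr0 ltxx. Qed.

Let qn n : 0 < q ^+ n <= 1.
Proof. by have [a b] := andP q01; rewrite exprn_gt0// exprn_ile1// ltW. Qed.

Lemma cpm_radicand n : c + l * q ^+ (2 * n) - (l * q ^+ (2 * n)) ^+ 2 =
  l ^+ 2 - l + l * q ^+ n ^+ 2 - l ^+ 2 * q ^+ n ^+ 4.
Proof. by rewrite {1}lampm_root mulnC exprM; ring. Qed.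

Lemma cpm_radicand_ge0 n :
  0 <= l ^+ 2 - l + l * q ^+ n ^+ 2 - l ^+ 2 * q ^+ n ^+ 4.
Proof.
have /andP[Q0 Q1] := qn n; move: (q ^+ n) Q0 Q1 => Q Q0 Q1.
(* In the second factor, l and [l * (1 + Q ^+ 2) - 1] have the same sign: l >= 1 for s = false, l <
   0 for s = true. *)
have -> : l ^+ 2 - l + l * Q ^+ 2 - l ^+ 2 * Q ^+ 4 =
    (1 - Q ^+ 2) * (l * (l * (1 + Q ^+ 2) - 1)) by ring.
rewrite mulr_ge0//; first by rewrite subr_ge0 exprn_ile1// ltW.
have Q2 := sqr_ge0 Q; have := lampm_sign; have := lampm_root; have := c0.
case: s; rewrite ?expr1 ?expr0; move: (lampm c _) (Q ^+ 2) Q2 => m P P0 C0 cE m0.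
  rewrite mulr_le0//; nra.
have m1 : 1 <= m by nra.
by rewrite mulr_ge0//; nra.
Qed.

Lemma cpm_sqr n : cp n ^+ 2 = l ^+ 2 - l + l * q ^+ n ^+ 2 - l ^+ 2 * q ^+ n ^+ 4.
Proof. by rewrite /cpm cpm_radicand sqr_sqrtr// cpm_radicand_ge0. Qed.

Lemma cpm_0 : cp 0 = 0.
Proof. by apply/eqP; rewrite -sqrf_eq0 cpm_sqr expr0 !expr1n; apply/eqP; ring. Qed.

Lemma lamn_sqr j : lamn q j ^+ 2 = 1 - q ^+ j ^+ 2.
Proof.
have /andP[Q0 Q1] := qn j; rewrite /lamn mulnC exprM sqr_sqrtr// subr_ge0.
by rewrite exprn_ile1// ltW.
Qed.

(** The squares agree because c = l^2 - l; the quotient has the sign of l, whereas a square root is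
    nonnegative. *)
Lemma cpm_div n : cp n / (l * q ^+ n) =
  (-1) ^+ s * Num.sqrt (l ^- 2 * q ^- (2 * n) * c + l^-1 - q ^+ (2 * n)).
Proof.
have /andP[Q0 _] := qn n; have l0 := lampm_neq0.
have y0 : 0 < (-1) ^+ s * (l * q ^+ n) by rewrite mulrA mulr_gt0// lampm_sign.
have e : l ^- 2 * q ^- (2 * n) * c + l^-1 - q ^+ (2 * n) =
    (cp n / ((-1) ^+ s * (l * q ^+ n))) ^+ 2.
  rewrite expr_div_n cpm_sqr exprMn sqrr_sign mulnC exprM.
  have := lampm_root; move: (lampm c s) l0 => m m0 ->.
  by field; rewrite m0 gt_eqF.
rewrite e sqrtr_sqr ger0_norm; last by rewrite divr_ge0 ?sqrtr_ge0// ltW.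
by rewrite [((-1) ^+ s * _)^-1]invfM invr_sign [RHS]mulrCA signrMK.
Qed.

Lemma lampm_root_div j : l ^- 2 * q ^- (2 * j) * c = (1 - l^-1) * q ^- j ^+ 2.
Proof.
have /andP[Q0 _] := qn j; have l0 := lampm_neq0; rewrite mulnC exprM.
have := lampm_root; move: (lampm c s) l0 => m m0 ->.
by field; rewrite m0 gt_eqF.
Qed.

End ConstantIdentities.

(* The factor (-1) ^+ s gives b the sign of lp: lp * q ^+ n * (-1) ^+ s * b n is
   cpm q c s n. Without it the relations between E, F and A, B, B^* fail by a
   sign for s = true. *)
Theorem mainTheorem3 (R : realType) (q c : R) (s : bool)
    (G HH : hilbertType R) (ket : nat -> nat -> G -> HH) (H : operator G) :
  0 < q < 1 -> 0 <= c -> (s = false \/ 0 < c) ->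
  self_adjoint H -> invertible H -> hilbert_sum ket ->
  let lp := lampm c s in
  let kappa := (Num.sqrt q)^-1 * (lam q)^-1 in
  let D0 := odom_infty H in
  let root (j : nat) :=
    fcalc H (fun t : R => Num.sqrt (lp ^- 2 * q ^- (2 * j) * c + t ^- 4)) in
  let b (n : nat) :=
    Num.sqrt (lp ^- 2 * q ^- (2 * n) * c + lp^-1 - q ^+ (2 * n)) in
  exists pi : crossA q c -> HH -> HH,
    star_representation (finite_sums ket D0) pi /\
    forall (n j : nat) (x : G), D0 x ->
      (odom H x /\ forall k : nat, odom (root k) (H x)) /\
      [/\ pi (gen gA) (ket n j x) = (lp * q ^+ (2 * n))%:C *: ket n j x,
          pi (gen gB) (ket n j x) =
            (cpm q c s n)%:C *: ketz ket (n%:Z - 1) j%:Z x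
        & pi (gen gBs) (ket n j x) = (cpm q c s n.+1)%:C *: ket n.+1 j x] /\
      [/\ pi (gen gE) (ket n j x) =
            kappa%:C *:
              ((q ^- n * lamn q j)%:C *:
                 ketz ket n%:Z (j%:Z - 1) (root j (H x))
               - ((-1) ^+ s * q ^- j * b n.+1)%:C *: ket n.+1 j (H x)),
          pi (gen gF) (ket n j x) =
            kappa%:C *:
              ((q ^- n * lamn q j.+1)%:C *: ket n j.+1 (root j.+1 (H x))
               - ((-1) ^+ s * q ^- j * b n)%:C *:
                   ketz ket (n%:Z - 1) j%:Z (H x))
        & pi (gen gK) (ket n j x) = (q ^ (n%:Z - j%:Z))%:C *: ket n j (H x)].
Proof.
move=> q01 c0 sc hH injH hk lp kappa D0 root b.
have sD := sa_subspace hH; have sL := sa_linear hH.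
have sD0 : subspace D0 := infty_subspace sD sL injH.
have [E1 hE1] := spectral_theorem hH injH.
have dD : forall z : G, exists2 u : nat -> G, (forall n, D0 (u n)) & u @ \oo --> z.
  exact: infty_dense hH injH (rint_resolves hH injH hE1).
have al0 j : 0 <= lp ^- 2 * q ^- (2 * j) * c.
  have [q0 _] := andP q01.
  by rewrite !mulr_ge0// invr_ge0 ?sqr_ge0// exprn_ge0// ltW.
have rt j := smooth_root hH injH (al0 j).
have inD (v : submodule sD0) : D0 (subval v) by apply/asboolP; exact: subvalP.
have lift_in (f : G -> G) (pf : forall x, D0 x -> D0 (f x)) (v : submodule sD0) :
  submem sD0 (f (subval v)) by apply/asboolP/pf.
pose lift (f : G -> G) (pf : forall x, D0 x -> D0 (f x)) (v : submodule sD0) :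
  submodule sD0 := Submodule (lift_in f pf v).
pose h := lift H (fun x dx => (infty_dom sD sL injH dx).2).
pose hi := lift (oinv H) (fun x dx => (infty_inv sD sL injH dx).2).
have rD j x : D0 x -> D0 (root j x) by move=> dx; have [/(_ x dx)[]] := rt j.
pose r j := lift (root j) (rD j).
have dom (v : submodule sD0) := (infty_dom sD sL injH (inD v)).1.
have cE := lampm_root s c0.
have l0 := lampm_neq0 c0 sc.
have L : ladder q lp (cpm q c s) (lamn q) h hi r.
  split=> //.
  - exact: cpm_0.
  - by rewrite /lamn muln0 expr0 subrr sqrtr0.
  - exact: cpm_sqr.
  - exact: lamn_sqr.
  - move=> k v w; apply: val_inj; exact: (sL _ _ _ (dom v) (dom w)).
  - by move=> k v w; apply: val_inj; exact: (smooth_oinvZD hH injH k (inD v) (inD w)).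
  - by move=> j k v w; apply: val_inj; have [_ e _ _ _] := rt j; 
    exact: (e k _ _ (inD v) (inD w)).
  - by move=> v; apply: val_inj; exact: (inftyK sD sL injH (inD v)).
  - by move=> v; apply: val_inj; exact: (infty_invK sD sL injH (inD v)).
  - by move=> j v; apply: val_inj; have [_ _ _ e _] := rt j; exact: (e _ (inD v)).
  - move=> j v; apply: val_inj; have [_ _ _ _ e] := rt j.
    apply: etrans (e _ (inD v)) _; congr (_%:C *: _ + _).
    exact: lampm_root_div.
  - by move=> v w; exact: (sa_symmetric hH (dom v) (dom w)).
  - by move=> j v w; have [_ _ e _ _] := rt j; exact: (e _ _ (inD v) (inD w)).
exists (rep (q := q) (c := c) ket lp (cpm q c s) (lamn q) h hi r); split.
  exact: rep_star_representation.
move=> n j x dx.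
(* [subval v] reduces to x and [subval (h v)] to [H x], so the formulas for [rep] apply up to
   conversion. *)
pose v : submodule sD0 := Submodule (asboolT dx : submem sD0 x).
have dHx := (infty_dom sD sL injH dx).2.
split.
  split; first exact: (infty_dom sD sL injH dx).1.
  by move=> k; have [/(_ _ dHx)[]] := rt k.
split; split.
- by rewrite (rep_A hk L cE n j v) mulnC exprM.
- exact: (rep_B hk L cE n j v).
- exact: (rep_Bs hk L cE n j v).
- rewrite (rep_E hk L cE n j v) (cpm_div q01 c0 sc) scalerBr !scalerA -!rmorphM.
  by congr (_ - _%:C *: _); rewrite -/lp -/(b n.+1) -/kappa; ring.
- rewrite (rep_F hk L cE n j v) (cpm_div q01 c0 sc) scalerBr !scalerA -!rmorphM.
  by congr (_ - _%:C *: _); rewrite -/lp -/(b n) -/kappa; ring.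
- rewrite (rep_K hk L cE n j v); congr (_%:C *: _).
  have [q0 _] := andP q01.
  by rewrite expfzDr ?gt_eqF// -exprnP exprnN.
Qed.
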